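(* Let $\Omega\subset\mathbb{R}^2$ be a bounded convex domain with polygonal boundary, and let $\ell:\Xi\times[0,T]\to\mathbb{R}$ and $g:\Xi\to\mathbb{R}$ be continuous and bounded from below. Let $\Theta$ be a closed subset of $\Xi^{\rm ad}$. Assume that for all sequences $(x^i,v^i)_{i\in\mathbb{N}}$ in $\Theta$ with $\lim_{i\to\infty}(x^i,v^i)=(x,v)\in\Theta$, the following holds: 1. if $x\in(\nu_j,\nu_{j+1})$ for some $j\in\{0,\dots,N-1\}$, then $(v^i\cdot n_j)_+^3=o\big((x-x^i)\cdot n_j\big)$; 2. if $x=\nu_j$ for some $j\in\{0,\dots,N-1\}$ and $v\ne0$, then $(v^i\cdot n_k)_+^3=o\big((x-x^i)\cdot n_k\big)$ for $k=j-1,j$; 3. if $x=\nu_j$ for some $j\in\{0,\dots,N-1\}$ and $v=0$, then $(v^i\cdot n_k)_+\big(|x-x^i|^{2/3}+|v^i|^2\big)=o\big((x-x^i)\cdot n_k\big)$ for $k=j-1,j$. Then the graph of the multivalued map $\Gamma^{\rm opt}:\Theta\to\Gamma$, $(x,v)\mapsto\Gamma^{\rm opt}[x,v]$, is closed in the following sense: for any sequence $(y^i,w^i)_{i\in\mathbb{N}}$ in $\Theta$ with $(y^i,w^i)\to(y,w)$, and any sequence $(\xi^i,\eta^i)\in\Gamma^{\rm opt}[y^i,w^i]$, if $(\xi^i,\eta^i)$ tends to $(\xi,\eta)$ uniformly on $[0,T]$, then $(\xi,\eta)\in\Gamma^{\rm opt}[y,w]$.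
   Context: Fix $T>0$. $(\nu_j)_{0\le j<N}$ are the vertices of $\partial\Omega$, labeled so that $\partial\Omega=\bigcup_{j=0}^{N-1}[\nu_j,\nu_{j+1}]$ with $\nu_N=\nu_0$, and no three successive vertices are aligned. $(\nu_j,\nu_{j+1})$ is the open segment, $n_j$ is the unit normal to $[\nu_j,\nu_{j+1}]$ pointing outward $\Omega$, and $n_{-1}=n_{N-1}$. Tangent cone: $T_\Omega(x)=\{v\in\mathbb{R}^2: x+tv\in\overline\Omega\text{ for }t>0\text{ small enough}\}$ for $x\in\overline\Omega$; thus $T_\Omega(x)=\mathbb{R}^2$ if $x\in\Omega$, $T_\Omega(x)=\{v: v\cdot n_j\le0\}$ if $x\in(\nu_j,\nu_{j+1})$, $T_\Omega(\nu_j)=\{v: v\cdot n_j\le0,\ v\cdot n_{j-1}\le0\}$. $\Xi=\overline\Omega\times\mathbb{R}^2$ and $\Xi^{\rm ad}=\{(x,v): x\in\overline\Omega,\ v\in T_\Omega(x)\}$. $\Gamma$ is the set of pairs $(\xi,\eta)\in C^1([0,T];\mathbb{R}^2)\times AC([0,T];\mathbb{R}^2)$ ($AC$ = absolutely continuous) with $\xi'(s)=\eta(s)$ and $(\xi(s),\eta(s))\in\Xi$ for all $s\in[0,T]$. $\Gamma[x,v]=\{(\xi,\eta)\in\Gamma:\xi(0)=x,\eta(0)=v\}$. $$J(\xi,\eta,\eta')=\int_0^T\Big(\ell(\xi(s),\eta(s),s)+\tfrac12|\eta'(s)|^2\Big)ds+g(\xi(T),\eta(T))$$ (equal to $+\infty$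 if $\eta'\notin L^2$). $\Gamma^{\rm opt}[x,v]$ is the set of $(\xi,\eta)\in\Gamma[x,v]$ with $\eta\in W^{1,2}(0,T;\mathbb{R}^2)$ achieving the minimum of $J$ over $\Gamma[x,v]$. $a_i=o(b_i)$ means: for every $\epsilon>0$, $|a_i|\le\epsilon|b_i|$ for all $i$ large enough. *)

(* Defs.v *)
From HB Require Import structures.
From mathcomp Require Import all_boot all_order all_algebra.
From mathcomp Require Import all_classical all_reals all_analysis.
Import Order.TTheory GRing.Theory Num.Theory.
Import numFieldNormedType.Exports.

Set Implicit Arguments.
Unset Strict Implicit.
Unset Printing Implicit Defensive.

Local Open Scope classical_set_scope.
Local Open Scope ring_scope.

(* The library norm on 'rV[R]_2 is the sup norm: it is used only for the
   topology and for boundedness.  [enorm] is the Euclidean norm. *)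
Definition dot (R : realType) (u v : 'rV[R]_2) : R :=
  \sum_(k < 2) u 0 k * v 0 k.

Definition enorm (R : realType) (u : 'rV[R]_2) : R := Num.sqrt (dot u u).

Definition posp (R : realType) (a : R) : R := Num.max a 0.

Definition closed_segment (R : realType) (a b : 'rV[R]_2) : set 'rV[R]_2 :=
  [set a + t *: (b - a) | t in `[0, 1]].

Definition open_segment (R : realType) (a b : 'rV[R]_2) : set 'rV[R]_2 :=
  [set a + t *: (b - a) | t in `]0, 1[].

Definition aligned (R : realType) (a b c : 'rV[R]_2) : Prop :=
  exists p d : 'rV[R]_2,
    [/\ exists t, a = p + t *: d, exists t, b = p + t *: d
      & exists t, c = p + t *: d].

Definition boundary (R : realType) (A : set 'rV[R]_2) : set 'rV[R]_2 :=
  closure A `\` A°.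

Definition convex_domain (R : realType) (Omega : set 'rV[R]_2) : Prop :=
  [/\ open Omega, Omega !=set0, bounded_set Omega
    & convex_set (Omega : set (convex_lmodType 'rV[R]_2))].

(* Indices of vertices are cyclic: [ordS] and [ord_pred] are the successor and
   the predecessor modulo N. *)
Definition polygonal_boundary (R : realType) (Omega : set 'rV[R]_2) (N : nat)
    (nu : 'I_N -> 'rV[R]_2) : Prop :=
  [/\ injective nu,
      boundary Omega = \bigcup_j closed_segment (nu j) (nu (ordS j))
    & forall j, ~ aligned (nu (ord_pred j)) (nu j) (nu (ordS j))].

Definition outward_normals (R : realType) (Omega : set 'rV[R]_2) (N : nat)
    (nu n : 'I_N -> 'rV[R]_2) : Prop :=
  forall j, [/\ enorm (n j) = 1, dot (n j) (nu (ordS j) - nu j) = 0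
    & forall z, open_segment (nu j) (nu (ordS j)) z ->
        \forall t \near 0^'+, ~ closure Omega (z + t *: n j)].

Definition tangent_cone (R : realType) (Omega : set 'rV[R]_2) (x : 'rV[R]_2) :
    set 'rV[R]_2 :=
  [set v | \forall t \near 0^'+, closure Omega (x + t *: v)].

Definition Xi (R : realType) (Omega : set 'rV[R]_2) :
    set ('rV[R]_2 * 'rV[R]_2) :=
  closure Omega `*` setT.

Definition Xi_ad (R : realType) (Omega : set 'rV[R]_2) :
    set ('rV[R]_2 * 'rV[R]_2) :=
  [set p | closure Omega p.1 /\ tangent_cone Omega p.1 p.2].

Definition closed_in (X : topologicalType) (A B : set X) : Prop :=
  exists2 F : set X, closed F & B = A `&` F.

Definition bounded_from_below (R : realType) (X : Type) (A : set X)
    (f : X -> R) : Prop :=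
  exists m : R, forall x, A x -> m <= f x.

(* Functions on [0, T] are functions on R of which only the values on [0, T]
   matter; the derivative is one-sided at 0 and at T. *)
Definition has_derivative_within (R : realType) (A : set R)
    (f : R -> 'rV[R]_2) (s : R) (l : 'rV[R]_2) : Prop :=
  (t - s)^-1 *: (f t - f s) @[t --> within A s^'] --> l.

Definition C1_on (R : realType) (T : R) (f : R -> 'rV[R]_2) : Prop :=
  exists df : R -> 'rV[R]_2,
    (forall s, s \in `[0, T] -> has_derivative_within `[0, T] f s (df s)) /\
    {within `[0, T], continuous df}.

Definition AC_on (R : realType) (T : R) (f : R -> 'rV[R]_2) : Prop :=
  forall eps : R, 0 < eps -> exists2 delta : R, 0 < delta &
    forall (m : nat) (a b : 'I_m -> R),
      (forall i, 0 <= a i /\ a i <= b i /\ b i <= T) ->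
      trivIset setT (fun i => `]a i, b i[%classic : set R) ->
      \sum_(i < m) (b i - a i) < delta ->
      \sum_(i < m) enorm (f (b i) - f (a i)) < eps.

Definition L2_on (R : realType) (T : R) (f : R -> 'rV[R]_2) : Prop :=
  forall k : 'I_2,
    measurable_fun (`[0, T] : set R) (fun s => f s 0 k) /\
    (@lebesgue_measure R).-integrable `[0, T] (fun s => (f s 0 k ^+ 2)%:E).

Definition test_function (R : realType) (T : R) (phi : R -> R) : Prop :=
  [/\ forall s, derivable phi s 1, continuous (derive1 phi)
    & exists a b : R, [/\ 0 < a, b < T &
        forall s, s \notin `[a, b] -> phi s = 0]].

Definition weak_derivative (R : realType) (T : R) (f df : R -> 'rV[R]_2) :
    Prop :=
  forall (phi : R -> R) (k : 'I_2), test_function T phi ->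
    \int[@lebesgue_measure R]_(s in `[0, T]) (f s 0 k * derive1 phi s) =
    - \int[@lebesgue_measure R]_(s in `[0, T]) (df s 0 k * phi s).

Definition W12 (R : realType) (T : R) (f : R -> 'rV[R]_2) : Prop :=
  L2_on T f /\
  exists2 df : R -> 'rV[R]_2, L2_on T df & weak_derivative T f df.

Definition Gamma (R : realType) (Omega : set 'rV[R]_2) (T : R) :
    set ((R -> 'rV[R]_2) * (R -> 'rV[R]_2)) :=
  [set p | [/\ C1_on T p.1, AC_on T p.2,
     forall s, s \in `[0, T] -> has_derivative_within `[0, T] p.1 s (p.2 s)
   & forall s, s \in `[0, T] -> Xi Omega (p.1 s, p.2 s)]].

Definition Gamma_from (R : realType) (Omega : set 'rV[R]_2) (T : R)
    (x v : 'rV[R]_2) : set ((R -> 'rV[R]_2) * (R -> 'rV[R]_2)) :=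
  [set p | [/\ Gamma Omega T p, p.1 0 = x & p.2 0 = v]].

Definition cost (R : realType) (T : R) (ell : 'rV[R]_2 * 'rV[R]_2 * R -> R)
    (g : 'rV[R]_2 * 'rV[R]_2 -> R) (xi eta deta : R -> 'rV[R]_2) : \bar R :=
  if `[< L2_on T deta >] then
    (\int[@lebesgue_measure R]_(s in `[0%R, T])
        (ell (xi s, eta s, s) + 2^-1 * enorm (deta s) ^+ 2)%:E
     + (g (xi T, eta T))%:E)%E
  else +oo%E.

(* The third argument of [cost] is the classical derivative [derive1 eta]: for
   eta absolutely continuous on [0, T] it exists almost everywhere on ]0, T[,
   where it depends only on the values of eta on [0, T]; at the other points it
   has an arbitrary value, which does not affect the integral. *)
Definition Gamma_opt (R : realType) (Omega : set 'rV[R]_2) (T : R)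
    (ell : 'rV[R]_2 * 'rV[R]_2 * R -> R) (g : 'rV[R]_2 * 'rV[R]_2 -> R)
    (x v : 'rV[R]_2) : set ((R -> 'rV[R]_2) * (R -> 'rV[R]_2)) :=
  [set p | [/\ Gamma_from Omega T x v p, W12 T p.2
   & forall q, Gamma_from Omega T x v q ->
       (cost T ell g p.1 p.2 (derive1 p.2) <= cost T ell g q.1 q.2 (derive1 q.2))%E]].

(* Main.v *)
(* A competitor (xi, eta) of finite cost starting at (y, w) is turned into a
   competitor starting at (y^i, w^i) by adding C^2 cut-off functions along the
   basis dual to the (at most two) normals active at y.  A cut-off that starts
   at distance a inside a wall with outward speed q has to act during a time of
   order a / q, which costs an energy of order q^3 / a: assumptions 1-3 all imply
   (w^i . n)_+^3 = o((y - y^i) . n) for the active normals, so this energy tends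
   to 0.  Hence the limsup of the optimal costs at (y^i, w^i) is at most the cost
   of (xi, eta).  Conversely the running cost and g pass to the uniform limit and
   the energy is lower semicontinuous: for h > 0 the integral of
   |(eta (t + h) - eta t) / h|^2 is bounded by the energy, passes to the limit,
   and Fatou's lemma applies as h tends to 0.  This rests on the fundamental
   theorem of calculus for absolutely continuous functions, obtained from the
   Radon-Nikodym density of the Lebesgue-Stieltjes measure of a monotone one. *)

Require Import Defs.
From HB Require Import structures.
From mathcomp Require Import all_boot all_order all_algebra.
From mathcomp Require Import all_classical all_reals all_analysis.
From mathcomp Require Import measurable_realfun ring lra.
Import Order.TTheory GRing.Theory Num.Theory.
Import numFieldNormedType.Exports.

Set Implicit Arguments.
Unset Strict Implicit.
Unset Printing Implicit Defensive.

Local Open Scope classical_set_scope.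
Local Open Scope ring_scope.

(** * Absolutely continuous functions *)

(** Adding a displacement d to a competitor xi keeps it behind an active wall of normal n exactly
    when (xi - y).n is at most the cut-off -d.n. If w.n < 0, the competitor itself recedes linearly
    from the wall and absorbs a cut-off of slightly negative slope. If w.n = 0, nothing can be
    absorbed and the cut-off has to stay nonnegative: the cubic smallness is used there. The
    exponents come from an acceleration of order a / s^2 acting during a time s of order a / q,
    whose energy is a^2 / s^3. The assumptions speak of the edges through y, whereas a wall
    constrains the curve as soon as its line passes through y; hence the study of the normals active
    at a vertex. Two obstacles precede the comparison of costs. [Theta] is closed only relative to
    the admissible pairs, so (y, w) is first shown admissible, from the velocity of the limit curve.
    And the limit eta is not yet known to be absolutely continuous: one finite-cost curve from (y,
    w), built from the tangent cone alone, bounds the energies of the optimal curves, which makes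
    them equi-absolutely continuous. The sharp comparison with an arbitrary competitor comes only
    then. *)

Definition abs_cont (R : realType) (T : R) (f : R -> R) : Prop :=
  forall eps : R, 0 < eps -> exists2 delta : R, 0 < delta &
    forall (I : finType) (a b : I -> R),
      (forall i, 0 <= a i /\ a i <= b i /\ b i <= T) ->
      trivIset setT (fun i => `]a i, b i[%classic : set R) ->
      \sum_i (b i - a i) < delta ->
      \sum_i `|f (b i) - f (a i)| < eps.

(** Retraction of the line onto [0, T]. Composing with it extends a function of which only the
    values on [0, T] matter to one that is continuous on the whole line. *)
Definition clamp (R : realType) (T x : R) : R := Num.max 0 (Num.min x T).

Lemma measure_mono d (X : measurableType d) (R : realType)
    (m : {measure set X -> \bar R}) (A B : set X) :
  measurable A -> measurable B -> A `<=` B -> (m A <= m B)%E.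
Proof. by move=> mA mB AB; apply: le_measure => //; rewrite inE. Qed.

Section clamp.
Context {R : realType} (T : R).
Hypothesis T0 : 0 <= T.

Lemma clamp_itv x : clamp T x \in `[0, T].
Proof. by rewrite in_itv/= /clamp le_max lexx/= ge_max T0/= ge_min lexx orbT. Qed.

Lemma clamp_id x : x \in `[0, T] -> clamp T x = x.
Proof. by rewrite in_itv/= /clamp => /andP[x0 xT]; rewrite min_l// max_r. Qed.

Lemma clamp_le0 x : x <= 0 -> clamp T x = 0.
Proof. by move=> x0; rewrite /clamp max_l// ge_min x0. Qed.

Lemma clamp_mono : {homo clamp T : x y / x <= y}.
Proof.
move=> x y xy; rewrite /clamp.
have [/= x0|x0] := leP 0 (Num.min x T).
  by rewrite le_max; apply/orP; right; rewrite le_min !ge_min xy lexx !orbT.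
by rewrite le_max lexx.
Qed.

Lemma clamp_lip x y : `|clamp T x - clamp T y| <= `|x - y|.
Proof.
wlog xy : x y / x <= y.
  move=> H; have [/H//|/ltW/H] := leP x y.
  by rewrite distrC (distrC x).
rewrite distrC (distrC x) !ger0_norm ?subr_ge0 ?clamp_mono// /clamp.
rewrite !minElt !maxElt.
by case: (ltP x T) => h1; case: (ltP y T) => h2; case: ltP => h3; case: ltP => h4; lra.
Qed.

Lemma clamp_continuous : continuous (clamp T).
Proof.
move=> x; apply/cvgrPdist_le => e e0; near=> t.
apply: le_trans (clamp_lip _ _) _.
near: t; apply: cvgr_dist_le e0; exact: cvg_id.
Unshelve. all: by end_near. Qed.


End clamp.

Section monotone_abs_cont.
Context {R : realType} (T : R).
Hypothesis T0 : 0 < T.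
Notation mu := (@lebesgue_measure R).

Lemma abs_cont_dist (f : R -> R) (eps : R) : abs_cont T f -> 0 < eps ->
  exists2 delta : R, 0 < delta & forall x y, x \in `[0, T] -> y \in `[0, T] ->
    `|x - y| < delta -> `|f x - f y| < eps.
Proof.
move=> acf /acf[d d0 H]; exists d => // x y.
wlog xy : x y / x <= y.
  move=> W xI yI; have [xy|/ltW xy] := leP x y; first exact: W.
  by rewrite distrC (distrC (f x)); apply: W.
rewrite !in_itv/= => /andP[x0 xT] /andP[y0 yT] xyd.
have := H unit (fun=> x) (fun=> y) (fun=> conj x0 (conj xy yT)).
rewrite !big_const card_unit/= !addr0 (distrC (f x)); apply.
  by apply/trivIsetP => -[] [].
by rewrite distrC ger0_norm ?subr_ge0// in xyd.
Qed.

Lemma abs_cont_clamp_continuous (f : R -> R) : abs_cont T f ->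
  continuous (f \o clamp T).
Proof.
move=> acf x; apply/cvgrPdist_lt => e e0.
have [d d0 H] := abs_cont_dist acf e0.
near=> t; apply: H; [exact: clamp_itv (ltW T0) _|exact: clamp_itv (ltW T0) _|].
apply: le_lt_trans (clamp_lip _ _ _) _.
near: t; apply: cvgr_dist_lt d0; exact: cvg_id.
Unshelve. all: by end_near. Qed.

End monotone_abs_cont.

Section lebesgue_stieltjes_itv.
Context {R : realType} (F : cumulative R R).

Lemma lebesgue_stieltjes_itv_oc (a b : R) : a <= b ->
  lebesgue_stieltjes_measure F `]a, b] = (F b - F a)%:E.
Proof.
move=> ab; rewrite /lebesgue_stieltjes_measure /measure_extension/=.
by rewrite measurable_mu_extE/= ?wlength_itv_bnd//; exact: is_ocitv.
Qed.

End lebesgue_stieltjes_itv.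

(** * Densities of monotone absolutely continuous functions *)

Section monotone_radon_nikodym.
Context {R : realType} (T : R) (f : R -> R).
Hypothesis T0 : 0 < T.
Hypothesis acf : abs_cont T f.
Hypothesis ndf : {in `[0, T] &, nondecreasing_fun f}.
Notation mu := (@lebesgue_measure R).

Let F := f \o clamp T.

Let F_nd : nondecreasing F.
Proof.
move=> x y xy; apply: ndf; [exact: clamp_itv (ltW T0) _|exact: clamp_itv (ltW T0) _|].
exact: clamp_mono.
Qed.

Let F_rc : right_continuous F.
Proof. exact/right_continuousW/abs_cont_clamp_continuous. Qed.

Let Fc : cumulative R R := HB.pack F (isCumulative.Build R _ R F F_nd F_rc).

Local Notation nu := (lebesgue_stieltjes_measure Fc).

(** Outer regularity encloses the null set in an open set of Lebesgue measure below the delta of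
    absolute continuity. This open set is a countable disjoint union of intervals, and the
    increments of f over finitely many of them add up to less than epsilon. *)
Lemma nu_dominated (A : set R) : A `<=` `]0, T] -> measurable A -> mu A = 0%E ->
  nu A = 0%E.
Proof.
move=> AT mA A0; apply/eqP; rewrite eq_le measure_ge0 andbT.
apply/lee_addgt0Pr => e e0; rewrite add0e.
have [d d0 H] := acf e0.
have Afin : (mu A < +oo)%E by rewrite A0.
have [V [oV AV Vd]] := lebesgue_regularity_outer mA Afin d0.
(* The intersection with a bounded interval makes every component of the open set bounded, hence of
   the form []inf, sup[]. *)
pose U := V `&` `]-1, T + 1[%classic.
have oU : open U by apply: openI => //; exact: interval_open.
have AU : A `<=` U.
  move=> x Ax; split; first exact: AV.
  by have := AT _ Ax; rewrite /= !in_itv/= => /andP[? ?]; apply/andP; split; lra.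
have mU : measurable U by exact: open_measurable.
have Ud : (mu U < d%:E)%E.
  apply: le_lt_trans Vd.
  rewrite -[leRHS]adde0 -[X in (_ + X)%E]A0 -measureU//=; last 2 first.
    by apply: measurableD => //; exact: open_measurable.
    by rewrite setDE -setIA setICl setI0.
  rewrite le_measure ?inE//.
    by apply: measurableU => //; apply: measurableD => //; exact: open_measurable.
  by move=> x [Vx _]; have [Ax|Ax] := pselect (A x); [right|left].
apply: (@le_trans _ _ (nu U)).
  by apply: le_measure; rewrite ?inE.
pose I := open_disjoint_itv oU.
have mI k : measurable (I k) by apply: open_measurable; exact: open_disjoint_itv_open.
have IU k : I k `<=` U.
  by move=> x Ix; rewrite (open_disjoint_itv_bigcup oU); exists k.
have trI : trivIset setT I by exact: open_disjoint_itv_trivIset.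
have -> : nu U = (\sum_(0 <= k <oo) nu (I k))%E.
  have UI : U = \bigcup_k I k by exact: open_disjoint_itv_bigcup.
  by rewrite [in LHS]UI measure_semi_bigcup// -UI.
apply: lime_le; first by apply: is_cvg_nneseries => *; exact: measure_ge0.
near=> n.
have IE k : exists ab : R * R, ab.1 <= ab.2 /\ I k = `]ab.1, ab.2[%classic.
  have [->|/set0P[x Ix]] := eqVneq (I k) set0.
    by exists (0, 0); split => //=; rewrite set_itv_ge// bnd_simp ltxx.
  have lI : has_lbound (I k).
    by exists (-1) => y /IU[_] /=; rewrite in_itv/= => /andP[/ltW].
  have uI : has_ubound (I k).
    by exists (T + 1) => y /IU[_] /=; rewrite in_itv/= => /andP[_ /ltW].
  exists (inf (I k), sup (I k)); split => /=.
    by apply: (@le_trans _ _ x); [exact: ge_inf|exact: ub_le_sup].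
  have iI : is_interval (I k) by exact: open_disjoint_itv_is_interval.
  have := interval_bounded_interior iI lI uI.
  have /interior_id -> : open (I k) by exact: open_disjoint_itv_open.
  by move=> {1}->; apply/seteqP; split => y; rewrite /= in_itv.
pose ab k := sval (cid (IE k)).
have abP k : (ab k).1 <= (ab k).2 /\ I k = `](ab k).1, (ab k).2[%classic.
  exact: (svalP (cid (IE k))).
(* The components may stick out of [0, T]. Clamping their endpoints does not change the increments,
   because [F] is f composed with [clamp T]. *)
pose a (i : 'I_n) := clamp T (ab i).1.
pose b (i : 'I_n) := clamp T (ab i).2.
have T0' := ltW T0.
have ab01 i : 0 <= a i /\ a i <= b i /\ b i <= T.
  split; first by have := clamp_itv T0' (ab i).1; rewrite in_itv/= => /andP[].
  split; first by apply: clamp_mono => //; have [] := abP i.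
  by have := clamp_itv T0' (ab i).2; rewrite in_itv/= => /andP[].
have subI i : `]a i, b i[%classic `<=` I i.
  move=> x /=; rewrite (abP i).2/= !in_itv/= /a /b => /andP[xa xb].
  apply/andP; split.
  - rewrite ltNge; apply/negP => /(clamp_mono T).
    rewrite (@clamp_id _ T x); first by rewrite leNgt xa.
    have := clamp_itv T0' (ab i).1; have := clamp_itv T0' (ab i).2.
    by rewrite !in_itv/=; lra.
  - rewrite ltNge; apply/negP => /(clamp_mono T).
    rewrite (@clamp_id _ T x); first by rewrite leNgt xb.
    have := clamp_itv T0' (ab i).1; have := clamp_itv T0' (ab i).2.
    by rewrite !in_itv/=; lra.
have trab : trivIset setT (fun i : 'I_n => `]a i, b i[%classic : set R).
  apply/trivIsetP => i j _ _ ij; rewrite -subset0.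
  move/trivIsetP: trI => /(_ i j Logic.I Logic.I ij) <-.
  by move=> x [/subI xi /subI xj].
have sumd : \sum_i (b i - a i) < d.
  rewrite -lte_fin; apply: le_lt_trans Ud.
  rewrite -sumEFin.
  rewrite (_ : (\sum_(i < n) (b i - a i)%:E)%E = \sum_(i < n) mu (`]a i, b i[%classic))%E; last first.
    apply: eq_bigr => i _; rewrite lebesgue_measure_itv/= lte_fin.
    have [//|h] := ltP (a i) (b i).
    have [_ [h' _]] := ab01 i.
    have -> : b i = a i by apply/eqP; rewrite eq_le h h'.
    by rewrite subrr.
  apply: (@le_trans _ _ (\sum_(i < n) mu (I i))%E).
    apply: lee_sum => i _; apply: measure_mono; [exact: measurable_itv|exact: mI|exact: subI].
  rewrite -measure_bigsetU//; apply: measure_mono => //.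
    by apply: bigsetU_measurable => i _; exact: mI.
  by rewrite -bigcup_mkord => x [k _] /IU.
have := H _ a b ab01 trab sumd => /ltW; rewrite -lee_fin; apply: le_trans.
rewrite big_mkord -sumEFin; apply: lee_sum => i _.
apply: (@le_trans _ _ (nu `](ab i).1, (ab i).2])).
  apply: measure_mono; [exact: mI|exact: measurable_itv|].
  rewrite (abP i).2 => x /=; rewrite !in_itv/= => /andP[-> /ltW]//.
rewrite lebesgue_stieltjes_itv_oc; last by have [] := abP i.
by rewrite lee_fin ler_norm.
Unshelve. all: by end_near. Qed.

Lemma monotone_abs_cont_density : exists h : R -> R,
  mu.-integrable setT (EFin \o h) /\
  forall t, t \in `[0, T] -> f t = f 0 + \int[mu]_(s in `[0, t]) h s.
Proof.
have mD : measurable (`]0, T]%classic : set (measurableTypeR R)).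
  exact: measurable_itv.
have nuD : (nu `]0%R, T] < +oo)%E by rewrite lebesgue_stieltjes_itv_oc ?ltW// ltry.
(* Restricted to []0, T]], the Stieltjes measure is finite, as the Radon-Nikodym theorem
   requires. *)
pose nu' := mfrestr mD nuD.
have dom : nu' `<< mu.
  apply/null_content_dominatesP => A mA A0.
  rewrite /nu' /mfrestr /mrestr; apply: nu_dominated.
  - by move=> x [].
  - exact: measurableI.
  - apply/eqP; rewrite eq_le measure_ge0 andbT -A0.
    by apply: measure_mono => //; exact: measurableI.
have [h [h0 hfin inth hE]] := radon_nikodym_sigma_finite dom.
exists (fine \o h); split.
  rewrite (_ : EFin \o (fine \o h) = h)//.
  by apply/funext => x /=; rewrite fineK.
move=> t; rewrite in_itv/= => /andP[t0 tT].
have : nu' [set` `]0, t]] = (f t - f 0)%:E.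
  rewrite /nu' /mfrestr /mrestr setIidl; last first.
    by move=> x /=; rewrite !in_itv/= => /andP[-> xt]; exact: le_trans tT.
  by rewrite lebesgue_stieltjes_itv_oc// /Fc/= /F/= clamp_id ?in_itv/= ?t0// clamp_le0.
have int0 : mu.-integrable (`]0, t] : set R) (EFin \o (fine \o h)).
  rewrite (_ : EFin \o (fine \o h) = h); last by apply/funext => x /=; rewrite fineK.
  exact: integrableS inth.
have hEt : nu' [set` `]0, t]] = (\int[mu]_(s in `]0%R, t]) h s)%E.
  by apply: hE; exact: measurable_itv.
rewrite hEt => hE'.
have : \int[mu]_(s in `]0, t]) fine (h s) = f t - f 0.
  rewrite /Rintegral; under eq_integral do rewrite fineK//.
  by rewrite hE'.
rewrite Rintegral_itv_obnd_cbnd// => ->; lra.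
Qed.

End monotone_radon_nikodym.

(** * Bounded variation and the Jordan decomposition *)

Section abs_cont_variation.
Context {R : realType} (T : R).
Implicit Types f g : R -> R.

Lemma abs_contD f g : abs_cont T f -> abs_cont T g ->
  abs_cont T (fun x => f x + g x).
Proof.
move=> acf acg e e0; have e20 : 0 < e / 2 by rewrite divr_gt0.
have [d1 d10 H1] := acf _ e20; have [d2 d20 H2] := acg _ e20.
exists (Num.min d1 d2); first by rewrite lt_min d10 d20.
move=> I a b abT tr; rewrite lt_min => /andP[/(H1 _ _ _ abT tr) h1 /(H2 _ _ _ abT tr) h2].
rewrite [ltRHS]splitr; apply: le_lt_trans (ltrD h1 h2).
rewrite -big_split/=; apply: ler_sum => i _.
by rewrite opprD addrACA; exact: ler_normD.
Qed.

Lemma abs_contN f : abs_cont T f -> abs_cont T (fun x => - f x).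
Proof.
move=> acf e /acf[d d0 H]; exists d => // I a b abT tr /(H _ _ _ abT tr).
by under [X in _ -> X < _]eq_bigr do rewrite -opprD normrN.
Qed.

Lemma abs_contB f g : abs_cont T f -> abs_cont T g ->
  abs_cont T (fun x => f x - g x).
Proof. by move=> acf /abs_contN; exact: abs_contD. Qed.

Lemma itv_partition_nth_le (x y : R) s i j : itv_partition x y s ->
  (i <= j <= size s)%N -> nth y (x :: s) i <= nth y (x :: s) j.
Proof.
move=> [xs _] /andP[ij js].
have := sorted_leq_nth le_trans le_refl y (s := x :: s).
move=> /(_ (sub_path (fun u v => @ltW _ _ u v) xs)) /(_ i j); apply => //.
- by rewrite inE/= ltnS (leq_trans ij).
Qed.

(** Cutting each interval by its partition gives another disjoint family of the same total length,
    to which the hypothesis applies. The new family is indexed by a dependent sum, which is why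
    [abs_cont] allows any finite index type. *)
Lemma variation_lt f (e d : R) (I : finType) (a b : I -> R) (s : I -> seq R) :
  (forall (J : finType) (a b : J -> R),
      (forall i, 0 <= a i /\ a i <= b i /\ b i <= T) ->
      trivIset setT (fun i => `]a i, b i[%classic : set R) ->
      \sum_i (b i - a i) < d ->
      \sum_i `|f (b i) - f (a i)| < e) ->
  (forall i, 0 <= a i /\ a i <= b i /\ b i <= T) ->
  trivIset setT (fun i => `]a i, b i[%classic : set R) ->
  \sum_i (b i - a i) < d ->
  (forall i, itv_partition (a i) (b i) (s i)) ->
  \sum_i variation (a i) (b i) f (s i) < e.
Proof.
move=> H abT tr sd ps.
pose J : finType := {i : I & 'I_(size (s i))}.
pose A (u : J) := nth (b (tag u)) (a (tag u) :: s (tag u)) (tagged u).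
pose B (u : J) := nth (b (tag u)) (s (tag u)) (tagged u).
have BE (u : J) : B u = nth (b (tag u)) (a (tag u) :: s (tag u)) (tagged u).+1 by [].
have a0 i : nth (b i) (a i :: s i) 0 = a i by [].
have bs i : nth (b i) (a i :: s i) (size (s i)) = b i.
  exact: itv_partition_nth_size (ps i).
have aA u : a (tag u) <= A u.
  by rewrite -[leLHS]a0; apply: itv_partition_nth_le => //=; exact/ltnW.
have Bb u : B u <= b (tag u).
  by rewrite BE -[leRHS]bs; apply: itv_partition_nth_le => //=; rewrite leqnn andbT.
have AB u : A u <= B u.
  by rewrite BE; apply: itv_partition_nth_le => //=; rewrite leqnSn/=.
have sumJ (F : forall i, 'I_(size (s i)) -> R) :
    \sum_i \sum_(k < size (s i)) F i k = \sum_(u : J) F (tag u) (tagged u).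
  by rewrite sig_big_dep.
have -> : \sum_i variation (a i) (b i) f (s i) = \sum_(u : J) `|f (B u) - f (A u)|.
  rewrite -(sumJ (fun i k => `|f (nth (b i) (s i) k) - f (nth (b i) (a i :: s i) k)|)).
  by apply: eq_bigr => i _; rewrite /variation big_mkord.
apply: H.
- move=> u; have [? [_ ?]] := abT (tag u).
  by split; [exact: le_trans (aA u)|split => //; exact: le_trans (Bb u) _].
- apply/trivIsetP => u v _ _ uv; rewrite -subset0 => x/=.
  rewrite !in_itv/= => -[/andP[Aux xBu] /andP[Avx xBv]].
  have [tuv|tuv] := eqVneq (tag u) (tag v); last first.
    move/trivIsetP: tr => /(_ _ _ Logic.I Logic.I tuv); rewrite -subset0.
    move=> /(_ x); apply; split; rewrite /= in_itv/=; apply/andP; split.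
    + exact: le_lt_trans (aA u) _.
    + exact: lt_le_trans (Bb u).
    + exact: le_lt_trans (aA v) _.
    + exact: lt_le_trans (Bb v).
  case: u v tuv uv Aux xBu Avx xBv => i k [j l] /= ij; subst j => kl.
  rewrite /A /B/= => Akx xBk Alx xBl.
  have {}kl : k != l by apply: contra kl => /eqP ->.
  wlog kltl : k l kl Akx xBk Alx xBl / (k < l)%N.
    move=> W; have [kl'|lk'|kl'] := ltngtP k l; first exact: (W k l).
      by apply: (W l k) => //; rewrite eq_sym.
    by move/eqP: kl; apply; exact: val_inj.
  have : nth (b i) (a i :: s i) k.+1 <= nth (b i) (a i :: s i) l.
    by apply: itv_partition_nth_le => //; rewrite kltl/= ltnW.
  by move=> /(lt_le_trans xBk) /(lt_trans Alx); rewrite ltxx.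
- apply: le_lt_trans sd.
  rewrite -(sumJ (fun i k => nth (b i) (s i) k - nth (b i) (a i :: s i) k)).
  apply: ler_sum => i _.
  rewrite -(big_mkord xpredT (fun k => nth (b i) (a i :: s i) k.+1 - nth (b i) (a i :: s i) k)).
  by rewrite telescope_sumr// bs a0.
Qed.

(** With d the delta for epsilon = 1, the variation over an interval shorter than d is at most 1,
    and finitely many steps of length d / 2 cover [0, T]. *)
Lemma abs_cont_bounded_variation f : 0 < T -> abs_cont T f ->
  bounded_variation 0 T f.
Proof.
move=> T0 acf; have [d d0 H] := acf 1 ltr01.
have loc x y : 0 <= x -> x <= y -> y <= T -> y - x < d -> bounded_variation x y f.
  move=> x0 xy yT yxd; exists 1 => _ [s ps <-].
  have := @variation_lt f 1 d unit (fun=> x) (fun=> y) (fun=> s) H.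
  rewrite !big_const card_unit/= !addr0 => W; apply/ltW/W => //.
  by apply/trivIsetP => -[] [].
suff W n y : 0 <= y -> y <= T -> y <= n%:R * (d / 2) -> bounded_variation 0 y f.
  have [n nT] : exists n, T <= n%:R * (d / 2).
    exists (Num.truncn (T / (d / 2))).+1.
    rewrite -ler_pdivrMr ?divr_gt0//; apply/ltW/truncnS_gt.
  exact: (W n T (ltW T0) (lexx _) nT).
elim: n y => [y y0 _|n IH y y0 yT].
  rewrite mul0r => y0'; have -> : y = 0 by apply/eqP; rewrite eq_le y0 y0'.
  exact: bounded_variationxx.
rewrite -natr1 mulrDl mul1r => yn.
have [yd|dy] := leP y (d / 2); first by apply: loc => //; lra.
have c0 : 0 <= y - d / 2 by lra.
have h1 : bounded_variation 0 (y - d / 2) f by apply: IH => //; lra.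
have h2 : bounded_variation (y - d / 2) y f by apply: loc => //; lra.
apply/bounded_variationP => //.
rewrite (total_variationD f c0); last by lra.
rewrite fin_numD; apply/andP; split; apply/bounded_variationP => //.
by lra.
Qed.

(** On each interval a partition almost attains the total variation, and the resulting finer family
    is controlled by [variation_lt]. *)
Lemma abs_cont_total_variation f : 0 < T -> abs_cont T f ->
  abs_cont T (fine \o total_variation 0 ^~ f).
Proof.
move=> T0 acf; have bvf := abs_cont_bounded_variation T0 acf.
have bv x y : 0 <= x -> x <= y -> y <= T -> total_variation x y f \is a fin_num.
  move=> x0 xy yT; apply/bounded_variationP => //.
  by apply: (@bounded_variationl _ _ _ T) => //; apply: bounded_variationr bvf => //; exact: le_trans yT.
have tvB x y : 0 <= x -> x <= y -> y <= T ->
    fine (total_variation 0 y f) - fine (total_variation 0 x f) =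
    fine (total_variation x y f).
  move=> x0 xy yT; rewrite (total_variationD f x0 xy) fineD ?bv//.
    by rewrite addrAC subrr add0r.
  exact: le_trans yT.
move=> e e0; have e20 : 0 < e / 2 by rewrite divr_gt0.
have [d d0 H] := acf _ e20; exists d => // I a b abT tr sd.
(* Half of e is shared among the intervals; the successor keeps the denominator nonzero when there
   is none. *)
pose c := e / 2 / (#|I|.+1)%:R.
have c0 : 0 < c by rewrite divr_gt0.
have part i : exists s, itv_partition (a i) (b i) s /\
    fine (total_variation (a i) (b i) f) < variation (a i) (b i) f s + c.
  have [ai [ab bT]] := abT i.
  have /(ub_ereal_sup_adherent c0) := bv _ _ ai ab bT.
  move=> [_ [_ [s ps <-] <-]] lt_s; exists s; split => //; move: lt_s.
  have tvf := bv _ _ ai ab bT.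
  by rewrite -/(total_variation (a i) (b i) f) -(fineK tvf) -EFinB lte_fin ltrBlDr.
pose s i := sval (cid (part i)).
have sP i : itv_partition (a i) (b i) (s i) /\
    fine (total_variation (a i) (b i) f) < variation (a i) (b i) f (s i) + c.
  exact: (svalP (cid (part i))).
have V := variation_lt H abT tr sd (fun i => (sP i).1).
apply: (@le_lt_trans _ _ (\sum_i (variation (a i) (b i) f (s i) + c))).
  apply: ler_sum => i _ /=; have [ai [ab bT]] := abT i.
  rewrite tvB// ger0_norm; last exact/fine_ge0/total_variation_ge0.
  exact/ltW/(sP i).2.
have cE : c * #|I|.+1%:R = e / 2 by rewrite divfK// pnatr_eq0.
rewrite big_split/= [ltRHS]splitr ltr_leD// sumr_const -[_ *+ #|_|]mulr_natr -cE.
by rewrite ler_pM2l// ler_nat cardT leqnSn.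
Qed.

(** Jordan decomposition: f is the difference of V, its total variation function, and of V - f. Both
    are nondecreasing and absolutely continuous. *)
Lemma abs_cont_density f : 0 < T -> abs_cont T f -> exists h : R -> R,
  (@lebesgue_measure R).-integrable setT (EFin \o h) /\
  forall t, t \in `[0, T] ->
    f t = f 0 + \int[@lebesgue_measure R]_(s in `[0, t]) h s.
Proof.
move=> T0 acf; have bvf := abs_cont_bounded_variation T0 acf.
pose V := fine \o total_variation 0 ^~ f.
pose W x := V x - f x.
have acV : abs_cont T V by exact: abs_cont_total_variation.
have acW : abs_cont T W by exact: abs_contB.
have bv x y : 0 <= x -> x <= y -> y <= T -> total_variation x y f \is a fin_num.
  move=> x0 xy yT; apply/bounded_variationP => //.
  by apply: (@bounded_variationl _ _ _ T) => //; apply: bounded_variationr bvf => //; exact: le_trans yT.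
have VB x y : 0 <= x -> x <= y -> y <= T -> `|f y - f x| <= V y - V x.
  move=> x0 xy yT; rewrite /V/= (total_variationD f x0 xy) fineD ?bv//; last exact: le_trans yT.
  rewrite addrAC subrr add0r -lee_fin fineK ?bv//.
  exact: total_variation_ge.
have ndV : {in `[0, T] &, nondecreasing_fun V}.
  move=> x y; rewrite !in_itv/= => /andP[x0 xT] /andP[y0 yT] xy.
  by rewrite -subr_ge0; apply: le_trans (VB _ _ x0 xy yT).
have ndW : {in `[0, T] &, nondecreasing_fun W}.
  move=> x y; rewrite !in_itv/= => /andP[x0 xT] /andP[y0 yT] xy.
  have := le_trans (ler_norm _) (VB _ _ x0 xy yT); rewrite /W; lra.
have [hV [iV EV]] := monotone_abs_cont_density T0 acV ndV.
have [hW [iW EW]] := monotone_abs_cont_density T0 acW ndW.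
exists (fun x => hV x - hW x); split; first exact: (integrableB measurableT iV iW).
move=> t tT.
have iS (h : R -> R) : (@lebesgue_measure R).-integrable setT (EFin \o h) ->
    (@lebesgue_measure R).-integrable `[0, t] (EFin \o h).
  by apply: integrableS.
rewrite RintegralB//; [|exact: iS|exact: iS].
have := EV _ tT; have := EW _ tT; rewrite /W; lra.
Qed.

End abs_cont_variation.

(** * Derivatives almost everywhere *)

Section measurable_derivative.
Context {R : realType}.
Implicit Type g : R -> R.

Let dq g (h x : R) := h^-1 * (g (h + x) - g x).

Let continuous_dq g h : continuous g -> continuous (dq g h).
Proof.
move=> cg x; apply: cvgM; first exact: cvg_cst.
apply: cvgB; last exact: cg.
apply: (@continuous_comp _ _ _ (fun x => h + x) g); last exact: cg.
by apply: cvgD; [exact: cvg_cst|exact: cvg_id].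
Qed.

(** Cauchy criterion for the difference quotients, with tolerance 1/(n+1) for steps below 1/(m+1).
    For continuous g each such set is closed, so the points of differentiability, a countable
    intersection of countable unions of them, form a Borel set. *)
Let cauchy_dq g (n m : nat) : set R := [set x | forall h k : R,
  0 < `|h| < m.+1%:R^-1 -> 0 < `|k| < m.+1%:R^-1 ->
  `|dq g h x - dq g k x| <= n.+1%:R^-1].

Let closed_cauchy_dq g n m : continuous g -> closed (cauchy_dq g n m).
Proof.
move=> cg.
have cdq h := @continuous_dq g h cg.
have -> : cauchy_dq g n m =
    \bigcap_(hk in [set hk : R * R | 0 < `|hk.1| < m.+1%:R^-1 /\ 0 < `|hk.2| < m.+1%:R^-1])
      [set x | `|dq g hk.1 x - dq g hk.2 x| <= n.+1%:R^-1].
  apply/seteqP; split => x /=.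
    by move=> H [h k]/= [hh kk]; exact: H.
  by move=> H h k hh kk; apply: (H (h, k)).
apply: closed_bigI => -[h k] _ /=.
rewrite [X in closed X](_ : _ = (fun x => `|dq g h x - dq g k x|) @^-1` [set y | y <= n.+1%:R^-1])//.
apply: preimage_closed; last exact: closed_le.
by move=> x _; apply: cvg_norm; apply: cvgB; exact: cdq.
Qed.

Lemma derivable_dq g x : derivable g x 1 <-> cvg (dq g h x @[h --> 0^']).
Proof.
rewrite /derivable; suff -> : (fun h => h^-1 *: ((g \o shift x) (h *: 1) - g x)) = dq g ^~ x by [].
by apply/funext => h; rewrite /dq /=/GRing.scale/= mulr1.
Qed.

Let derivable_cauchy_dq g :
  [set x | derivable g x 1] = \bigcap_n \bigcup_m cauchy_dq g n m.
Proof.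
apply/seteqP; split => x /=.
  move=> /derivable_dq /cvg_ex[/= l gl] n _.
  have e0 : (0 : R) < n.+1%:R^-1 / 2 by rewrite divr_gt0.
  move/cvgrPdist_le: gl => /(_ _ e0)[/= d d0 H].
  exists (Num.truncn d^-1) => //= h k.
  have dm : (Num.truncn d^-1).+1%:R^-1 < d.
    by rewrite -[ltRHS]invrK ltf_pV2 ?posrE ?invr_gt0// Num.Theory.truncnS_gt.
  move=> /andP[h0 hd] /andP[k0 kd].
  have := H h; rewrite /= sub0r normrN => /(_ (lt_trans hd dm)).
  rewrite -normr_gt0 => /(_ h0) Hh.
  have := H k; rewrite /= sub0r normrN => /(_ (lt_trans kd dm)).
  rewrite -normr_gt0 => /(_ k0) Hk.
  rewrite -(subrKA l) [leRHS]splitr (le_trans (ler_normD _ _))// lerD//.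
  by rewrite distrC.
move=> H; apply/derivable_dq/cauchy_cvgP/cauchy_ballP => e e0.
have [m _ Hm] := H (Num.truncn e^-1) Logic.I.
have em : (Num.truncn e^-1).+1%:R^-1 < e.
  by rewrite -[ltRHS]invrK ltf_pV2 ?posrE ?invr_gt0// Num.Theory.truncnS_gt.
have nb : \forall h \near (0 : R)^', 0 < `|h| < m.+1%:R^-1.
  near=> h; apply/andP; split.
    by rewrite normr_gt0; near: h; exact: nbhs_dnbhs_neq.
  by near: h; apply: dnbhs0_lt.
exists ([set dq g h x | h in [set h | 0 < `|h| < m.+1%:R^-1]],
        [set dq g h x | h in [set h | 0 < `|h| < m.+1%:R^-1]]) => /=.
  by split; apply: filterS nb => h hm; exists h.
move=> [a b]/= [[h hm <-] [k km <-]]; rewrite /ball/=.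
by apply: le_lt_trans em; exact: Hm.
Unshelve. all: by end_near. Qed.

Lemma measurable_derivable g : continuous g -> measurable [set x | derivable g x 1].
Proof.
move=> cg; rewrite derivable_cauchy_dq.
apply: bigcap_measurable; first by exists 0%N.
move=> n _; apply: bigcup_measurable => m _.
by apply: closed_measurable; exact: closed_cauchy_dq.
Qed.

Lemma measurable_derive1 g : continuous g ->
  measurable_fun [set x | derivable g x 1] (derive1 g).
Proof.
move=> cg; apply: (@measurable_fun_cvg _ _ _ _ (fun n => dq g n.+1%:R^-1)).
  move=> n; apply: measurable_funTS; apply: continuous_measurable_fun.
  exact: continuous_dq.
move=> x /= dgx.
have h1 : dq g h x @[h --> 0^'] --> derive1 g x.
  by move/derivable_dq : dgx; exact: id.
apply/cvgrPdist_lt => e e0.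
move/cvgrPdist_lt: h1 => /(_ _ e0)[/= d d0 H].
near=> n; apply: H; last by rewrite gt_eqF.
rewrite /= sub0r normrN ger0_norm//.
near: n; exact: (near_infty_natSinv_lt (PosNum d0)).
Unshelve. all: by end_near. Qed.

Lemma derive1_coord m n (f : R -> 'M[R]_(m, n)) x i j : derivable f x 1 ->
  derive1 f x i j = derive1 (fun s => f s i j) x.
Proof. by move=> dfx; rewrite !derive1E derive_mx// mxE. Qed.

Lemma nderivable_derive1 (V : normedModType R) (f : R -> V) x :
  ~ derivable f x 1 -> derive1 f x = point.
Proof.
move=> ndf; apply: dvgP => /cvg_ex[l fl]; apply: ndf; apply/cvg_ex; exists l.
by under eq_fun do rewrite /= scaler1.
Qed.

(** Where the vector function is not derivable its derivative is the default [point], even if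
    coordinate k is derivable there. Measurability is therefore checked on the set where all
    coordinates are derivable, and on its complement, where the function is constant. *)
Lemma measurable_derive1_coord n (f : R -> 'rV[R]_n) k :
  (forall i, continuous (fun s => f s 0 i)) ->
  measurable_fun setT (fun s => derive1 f s 0 k).
Proof.
move=> cf; pose D := [set x | derivable f x 1].
have mD : measurable (D : set R).
  rewrite (_ : D = \bigcap_(i in [set: 'I_n]) [set x | derivable (fun s => f s 0 i) x 1]).
    apply: fin_bigcap_measurable => // i _; apply: measurable_derivable; exact: cf.
  apply/seteqP; split => x /=.
    by move=> /derivable_mxP H i _; exact: H.
  by move=> H; apply/derivable_mxP => i j; rewrite (ord1 i); exact: H.
rewrite -(setUCr D); apply/measurable_funU => //; first exact: measurableC.
split.
  apply: (eq_measurable_fun (derive1 (fun s => f s 0 k))).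
    by move=> x; rewrite inE => dfx; rewrite derive1_coord.
  apply: measurable_funS (measurable_derive1 (cf k)).
    by apply: measurable_derivable; exact: cf.
  by move=> x /= /derivable_mxP; exact.
apply: (eq_measurable_fun (cst ((point : 'rV[R]_n) 0 k))).
  by move=> x; rewrite inE => ndf; rewrite nderivable_derive1.
exact: measurable_cst.
Qed.

End measurable_derivative.

Section abs_cont_derivative.
Context {R : realType} (T : R).
Hypothesis T0 : 0 < T.
Notation mu := (@lebesgue_measure R).

Lemma near_itv_oo (a b x : R) : a < x < b -> \forall y \near x, a < y < b.
Proof.
move=> /andP[ax xb]; near=> y; apply/andP; split; near: y.
  exact: lt_nbhsr.
exact: lt_nbhsl.
Unshelve. all: by end_near. Qed.

Lemma derive1_near_shift (f F : R -> R) (c x : R) : derivable F x 1 ->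
  {near x, f =1 fun y => c + F y} ->
  derivable f x 1 /\ derive1 f x = derive1 F x.
Proof.
move=> dF fF.
have Ff : {near x, cst c + F =1 f} by apply: filterS fF => y ->.
have dF' : derivable (cst c + F) x 1.
  exact: derivableD (derivable_cst _ _ _) dF.
have DE : 'D_1 (cst c + F) x = 'D_1 F x.
  by have := deriveD (derivable_cst c x 1) dF; rewrite derive_cst add0r.
split; first exact: near_eq_derivable dF'.
by rewrite !derive1E -DE; exact: near_eq_derive.
Qed.

(** Lebesgue differentiation. The two functions differ by the constant f 0 only on [0, T], hence the
    restriction to interior points, around which they agree up to that constant. *)
Lemma ae_derive1_density (f h : R -> R) : mu.-integrable setT (EFin \o h) ->
  (forall t, t \in `[0, T] -> f t = f 0 + \int[mu]_(s in `[0, t]) h s) ->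
  {ae mu, forall x, 0 < x < T -> derivable f x 1 /\ derive1 f x = h x}.
Proof.
move=> ih fE.
have ihS A : measurable A -> mu.-integrable A (EFin \o h).
  by move=> mA; apply: integrableS ih.
have lh : locally_integrable [set: R] h.
  exact: open_integrable_locally openT ih.
have := FTC1 (a := BLeft 0) (fun y => ihS _ (measurable_itv _)) lh.
set F := (fun x : R => _) => /=.
apply: filterS; first exact: (ae_filter_ringOfSetsType mu).
move=> x + /andP[x0 xT].
rewrite lte_fin x0 => /(_ isT)[dF FE].
have fF : {near x, f =1 fun y => f 0 + F y}.
  have := @near_itv_oo 0 T x; rewrite x0 xT => /(_ isT).
  by apply: filterS => y /andP[y0 yT]; apply: fE; rewrite in_itv/= !ltW.
by rewrite -FE; exact: derive1_near_shift fF.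
Qed.

End abs_cont_derivative.

Section fatou_bound.
Context d (X : measurableType d) {R : realType} (mu : {measure set X -> \bar R}).

Lemma limn_einf_le (u : nat -> \bar R) (l : \bar R) :
  (forall n, u n <= l)%E -> (limn_einf u <= l)%E.
Proof.
move=> ul; rewrite limn_einf_lim; apply: lime_le; first exact: is_cvg_einfs.
apply: nearW => n; apply: le_trans (ul n); apply: ereal_inf_lbound.
by exists n => /=.
Qed.

(** Fatou's lemma outside the null set where convergence may fail. It serves twice in the lower
    semicontinuity: along the sequence of curves with a fixed step, then as the step tends to 0. *)
Lemma ae_fatou_bound (D : set X) (g_ : nat -> X -> R) (g : X -> R) (K : R) :
  measurable D -> (forall n, measurable_fun D (g_ n)) -> measurable_fun D g ->
  (forall n x, D x -> 0 <= g_ n x) -> (forall x, D x -> 0 <= g x) ->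
  {ae mu, forall x, D x -> g_ n x @[n --> \oo] --> g x} ->
  (forall n, \int[mu]_(x in D) (g_ n x)%:E <= K%:E)%E ->
  (\int[mu]_(x in D) (g x)%:E <= K%:E)%E.
Proof.
move=> mD mg_ mg g_0 g0 [N [mN N0 cN]] gK.
have mDN : measurable (D `\` N) by exact: measurableD.
have mE (h : X -> R) : measurable_fun D h -> measurable_fun (D `\` N) (EFin \o h).
  by move=> mh; apply/measurable_EFinP; apply: measurable_funS mh => // x [].
rewrite (ge0_negligible_integral mN mD)//; last exact/measurable_EFinP.
have -> : (\int[mu]_(x in D `\` N) (g x)%:E =
    \int[mu]_(x in D `\` N) limn_einf (fun n => (g_ n x)%:E))%E.
  apply: eq_integral => x; rewrite inE => -[Dx Nx].
  have cx : g_ n x @[n --> \oo] --> g x.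
    by apply: contrapT => ncx; apply: Nx; apply: cN => /= /(_ Dx).
  have := @cvg_limn_einf_sup _ (fun n => (g_ n x)%:E) (g x)%:E.
  by move=> ->//; apply: cvg_EFin => //; exact: nearW.
apply: le_trans (fatou mu mDN _ _) _.
- by move=> n; exact: mE.
- by move=> n x [Dx _]; rewrite lee_fin g_0.
apply: limn_einf_le => n; apply: le_trans (gK n).
apply: ge0_subset_integral => //.
- exact/measurable_EFinP.
- by move=> x Dx; rewrite lee_fin g_0.
Qed.

End fatou_bound.

Lemma ae_impl d (X : measurableType d) (R : realType)
    (m : {measure set X -> \bar R}) (P Q : X -> Prop) :
  (forall x, P x -> Q x) -> {ae m, forall x, P x} -> {ae m, forall x, Q x}.
Proof. by move=> PQ; apply: (@filterS _ _ (ae_filter_ringOfSetsType m)). Qed.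

Lemma ae_and d (X : measurableType d) (R : realType)
    (m : {measure set X -> \bar R}) (P Q : X -> Prop) :
  {ae m, forall x, P x} -> {ae m, forall x, Q x} -> {ae m, forall x, P x /\ Q x}.
Proof. exact: (@filterI _ _ (ae_filter_ringOfSetsType m)). Qed.

(** * Fundamental theorem of calculus for absolutely continuous curves *)

Section abs_cont_vector.
Context {R : realType} (T : R).
Hypothesis T0 : 0 < T.
Notation mu := (@lebesgue_measure R).

Lemma enormE (u : 'rV[R]_2) : enorm u = Num.sqrt (\sum_k u 0 k ^+ 2).
Proof. by rewrite /enorm /dot; congr Num.sqrt; apply: eq_bigr => k _; rewrite expr2. Qed.

Lemma enorm_sqr (u : 'rV[R]_2) : enorm u ^+ 2 = \sum_k u 0 k ^+ 2.
Proof. by rewrite enormE sqr_sqrtr// sumr_ge0// => k _; exact: sqr_ge0. Qed.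

Lemma enorm_ge0 (u : 'rV[R]_2) : 0 <= enorm u.
Proof. exact: sqrtr_ge0. Qed.

Lemma le_coord_enorm (u : 'rV[R]_2) k : `|u 0 k| <= enorm u.
Proof.
rewrite enormE -sqrtr_sqr ler_sqrt; last by rewrite sumr_ge0// => i _; exact: sqr_ge0.
by rewrite (bigD1 k)//= lerDl sumr_ge0// => i _; exact: sqr_ge0.
Qed.

Lemma enorm_le_sum (u : 'rV[R]_2) : enorm u <= \sum_k `|u 0 k|.
Proof.
rewrite -(@ler_pXn2r _ 2)// ?nnegrE ?enorm_ge0 ?sumr_ge0//.
rewrite enorm_sqr !big_ord_recl !big_ord0 !addr0.
rewrite sqrrD !real_normK ?num_real// lerD2r lerDl mulrn_wge0// mulr_ge0//.
Qed.

Lemma AC_on_abs_cont (f : R -> 'rV[R]_2) k :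
  AC_on T f -> abs_cont T (fun s => f s 0 k).
Proof.
move=> acf e /acf[d d0 H]; exists d => // I a b abT tr sd.
apply: (@le_lt_trans _ _ (\sum_(i < #|I|) enorm (f (b (enum_val i)) - f (a (enum_val i))))).
  rewrite (reindex (@enum_val I predT)) /=; last first.
    exact: onW_bij (enum_val_bij I).
  apply: ler_sum => i _; have := le_coord_enorm (f (b (enum_val i)) - f (a (enum_val i))) k.
  by rewrite !mxE.
apply: H => //.
- apply/trivIsetP => i j _ _ ij; move/trivIsetP : tr; apply => //.
  by apply: contra ij => /eqP/enum_val_inj ->.
- apply: le_lt_trans sd; rewrite [leRHS](reindex (@enum_val I predT)) //=.
  exact: onW_bij (enum_val_bij I).
Qed.

Lemma abs_cont_AC_on (f : R -> 'rV[R]_2) :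
  (forall k, abs_cont T (fun s => f s 0 k)) -> AC_on T f.
Proof.
move=> acf e e0; have e20 : 0 < e / 2 by rewrite divr_gt0.
have [d0 d00 H0] := acf ord0 _ e20; have [d1 d10 H1] := acf (lift ord0 ord0) _ e20.
exists (Num.min d0 d1); first by rewrite lt_min d00 d10.
move=> m a b abT tr; rewrite lt_min => /andP[/(H0 _ _ _ abT tr) h0 /(H1 _ _ _ abT tr) h1].
rewrite [ltRHS]splitr; apply: le_lt_trans (ltrD h0 h1).
rewrite -big_split/=; apply: ler_sum => i _.
apply: le_trans (enorm_le_sum _) _.
by rewrite !big_ord_recl big_ord0 addr0 !mxE.
Qed.

Lemma derive1_clamp (V : normedModType R) (f : R -> V) x :
  0 < x < T -> derive1 f x = derive1 (f \o clamp T) x.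
Proof.
move=> xT; rewrite !derive1E; apply: near_eq_derive.
apply: filterS (near_itv_oo xT) => y /andP[y0 yT] /=.
by rewrite clamp_id// in_itv/= !ltW.
Qed.

Lemma measurable_fun_itvcc_oo (g : R -> R) :
  measurable_fun `]0, T[ g -> measurable_fun `[0, T] g.
Proof.
move=> mg; rewrite -(@setU1itv _ _ (BRight T) 0 false) ?bnd_simp ?ltW//.
have mU : measurable (`]0, T[%classic `|` [set T] : set R) by exact: measurableU.
rewrite -(@setUitv1 _ _ (BRight 0) T true) ?bnd_simp//.
apply/measurable_funU => //; split; first exact: measurable_fun_set1.
by apply/measurable_funU => //; split => //; exact: measurable_fun_set1.
Qed.

(** At 0 and T the value of [derive1 f] may depend on f outside [0, T], so the comparison with the
    clamped function is made on the open interval; the endpoints are then added back as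
    singletons. *)
Lemma measurable_derive1_abs_cont (f : R -> 'rV[R]_2) k : AC_on T f ->
  measurable_fun `[0, T] (fun s => derive1 f s 0 k).
Proof.
move=> acf; apply: measurable_fun_itvcc_oo.
apply: (eq_measurable_fun (fun s => derive1 (f \o clamp T) s 0 k)).
  move=> x; rewrite inE/= in_itv/= => x0T.
  by have /esym := @derive1_clamp 'rV[R]_2 f x x0T => /(congr1 (fun A : 'rV[R]_2 => A 0 k)).
apply: measurable_funTS; apply: (@measurable_derive1_coord _ 2 (f \o clamp T)) => i.
exact: (abs_cont_clamp_continuous T0 (AC_on_abs_cont i acf)).
Qed.

Lemma ae_all_ord (n : nat) (P : 'I_n -> R -> Prop) :
  (forall k, {ae mu, forall x, P k x}) -> {ae mu, forall x, forall k, P k x}.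
Proof.
move=> H; apply: (@filter_forall _ _ P _ (ae_filter_ringOfSetsType mu)).
exact: H.
Qed.

Lemma ae_itv_oo : {ae mu, forall x, x \in `[0, T] -> 0 < x < T}.
Proof.
exists [set 0; T]; split; first exact: measurableU.
  rewrite measureU0//; exact: lebesgue_measure_set1.
move=> x /= /not_implyP[]; rewrite in_itv/= => /andP[x0 xT] /negP.
by rewrite !lt_neqAle x0 xT !andbT negb_and !negbK => /orP[/eqP<-|/eqP->]; [left|right].
Qed.

Lemma AC_on_ae_derivable (f : R -> 'rV[R]_2) : AC_on T f ->
  {ae mu, forall x, 0 < x < T -> derivable f x 1}.
Proof.
move=> acf.
have H k : {ae mu, forall x, 0 < x < T -> derivable (fun s => f s 0 k) x 1}.
  have [h [ih fE]] := abs_cont_density T0 (AC_on_abs_cont k acf).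
  have := ae_derive1_density ih fE; apply: ae_impl.
  by move=> x H /H[].
have := ae_all_ord H; apply: ae_impl.
by move=> x {}H xT; apply/derivable_mxP => i j; rewrite (ord1 i); exact: H.
Qed.

(** The abstract Radon-Nikodym density coincides almost everywhere with the classical derivative,
    which can thus replace it under the integral. *)
Lemma AC_on_FTC (f : R -> 'rV[R]_2) k : AC_on T f ->
  mu.-integrable `[0, T] (fun s => (derive1 f s 0 k)%:E) /\
  forall s t, 0 <= s -> s <= t -> t <= T ->
    f t 0 k - f s 0 k = \int[mu]_(x in `[s, t]) derive1 f x 0 k.
Proof.
move=> acf.
have [h [ih fE]] := abs_cont_density T0 (AC_on_abs_cont k acf).
have ihS A : measurable A -> mu.-integrable A (EFin \o h).
  by move=> mA; apply: integrableS ih.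
have aeE : {ae mu, forall x, `[0, T]%classic x -> h x = derive1 f x 0 k}.
  have := ae_and (ae_and (AC_on_ae_derivable acf) (ae_derive1_density ih fE)) ae_itv_oo.
  apply: ae_impl => x [[df hf] xoo] /xoo xT.
  by have [_ <-] := hf xT; rewrite derive1_coord//; exact: df.
have mdf := measurable_derive1_abs_cont k acf.
have mh : measurable_fun `[0, T] h.
  by apply/measurable_EFinP; apply: measurable_int (ihS _ (measurable_itv _)).
have idf : mu.-integrable `[0, T] (fun s => (derive1 f s 0 k)%:E).
  apply/integrableP; split; first exact/measurable_EFinP.
  rewrite -(@ge0_ae_eq_integral _ _ _ mu _ (fun x => `|(h x)%:E|)%E)//.
  - by have /integrableP[] := ihS _ (measurable_itv `[0, T]).
  - by apply/measurable_EFinP; exact: measurableT_comp.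
  - by apply/measurable_EFinP; exact: measurableT_comp.
  - by apply: ae_impl aeE => x hx xT; rewrite hx.
split => // s t s0 st tT.
have stT : `[s, t]%classic `<=` (`[0, T]%classic : set R).
  by apply: subset_itv; rewrite bnd_simp.
have -> : \int[mu]_(x in `[s, t]) derive1 f x 0 k = \int[mu]_(x in `[s, t]) h x.
  rewrite /Rintegral; congr fine; apply: ae_eq_integral => //.
  - by apply/measurable_EFinP; exact: measurable_funS mdf.
  - by apply/measurable_EFinP; exact: measurable_funS mh.
  - by apply: ae_impl aeE => x hx xT; rewrite hx//; exact: stT.
rewrite (fE t) ?in_itv/= ?tT ?(le_trans s0)// (fE s) ?in_itv/= ?s0 ?(le_trans st)//.
rewrite opprD addrACA subrr add0r Rintegral_itvB ?bnd_simp//; last exact: ihS.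
by rewrite Rintegral_itv_obnd_cbnd//; exact: ihS.
Qed.

End abs_cont_vector.

(** * Integral inequalities on intervals *)

Section interval_integrals.
Context {R : realType}.
Notation mu := (@lebesgue_measure R).
Implicit Types (u : R -> R) (s t : R).

Lemma RintegralE (D : set R) u : measurable D -> mu.-integrable D (EFin \o u) ->
  (\int[mu]_(x in D) u x)%:E = (\int[mu]_(x in D) (u x)%:E)%E.
Proof. by move=> mD iu; rewrite fineK//; exact: integrable_fin_num. Qed.

Lemma integrable_itvZl (i : interval R) (c : R) u : mu.-integrable [set` i] (EFin \o u) ->
  mu.-integrable [set` i] (EFin \o (fun x => c * u x)).
Proof. by move=> iu; apply: (integrableZl _ c iu). Qed.

Lemma integrable_itvD (i : interval R) u v : mu.-integrable [set` i] (EFin \o u) ->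
  mu.-integrable [set` i] (EFin \o v) ->
  mu.-integrable [set` i] (EFin \o (fun x => u x + v x)).
Proof. by move=> iu iv; apply: (integrableD _ iu iv). Qed.

Lemma integrable_cst_itv s t (c : R) : mu.-integrable `[s, t] (EFin \o cst c).
Proof.
apply: continuous_compact_integrable; first exact: segment_compact.
by apply: continuous_subspaceT => x; exact: cvg_cst.
Qed.

Lemma Rintegral_cst_itv s t (c : R) : s <= t ->
  \int[mu]_(x in `[s, t]) c = c * (t - s).
Proof.
move=> st; rewrite Rintegral_cst//= lebesgue_measure_itv/= lte_fin.
have [//|ts] := ltP s t; have -> : t = s by apply/eqP; rewrite eq_le ts st.
by rewrite subrr.
Qed.

(** Cauchy-Schwarz against the constant 1, obtained by expanding the nonnegative integral of (u -
    c)^2, where c is the mean value of u. *)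
Lemma Rintegral_sqr_le s t u : s <= t -> mu.-integrable `[s, t] (EFin \o u) ->
  mu.-integrable `[s, t] (EFin \o (fun x => u x ^+ 2)) ->
  (\int[mu]_(x in `[s, t]) u x) ^+ 2 <=
  (t - s) * \int[mu]_(x in `[s, t]) u x ^+ 2.
Proof.
rewrite le_eqVlt => /predU1P[<- _ _|st iu iu2].
  by rewrite set_itv1 !Rintegral_set1 expr2 !mulr0.
set A := \int[mu]_(x in _) u x; set B := \int[mu]_(x in _) _.
have l0 : 0 < t - s by rewrite subr_gt0.
pose c := A / (t - s).
have ilin : mu.-integrable `[s, t] (EFin \o (fun x => - (2 * c) * u x)).
  exact: integrable_itvZl.
have icst : mu.-integrable `[s, t] (EFin \o cst (c ^+ 2)) by exact: integrable_cst_itv.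
have : 0 <= \int[mu]_(x in `[s, t]) (u x ^+ 2 + (- (2 * c) * u x + cst (c ^+ 2) x)).
  apply: Rintegral_ge0 => x _ /=.
  have -> : u x ^+ 2 + (- (2 * c) * u x + c ^+ 2) = (u x - c) ^+ 2 by ring.
  exact: sqr_ge0.
rewrite RintegralD//; last exact: (integrable_itvD ilin icst).
rewrite RintegralD// RintegralZl// -/A -/B (Rintegral_cst_itv _ (ltW st)).
have AE : A = c * (t - s) by rewrite divfK// gt_eqF.
by move=> /(mulr_ge0 (ltW l0)); rewrite AE; lra.
Qed.

Lemma Rintegral_itv_split s t T u : mu.-integrable `[0, T] (EFin \o u) ->
  0 <= s -> s <= t -> t <= T ->
  \int[mu]_(x in `[0, t]) u x - \int[mu]_(x in `[0, s]) u x =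
  \int[mu]_(x in `[s, t]) u x.
Proof.
move=> iu s0 st tT.
have iu' : mu.-integrable `[0, t] (EFin \o u).
  by apply: integrableS iu => //; apply: subset_itv; rewrite bnd_simp.
rewrite Rintegral_itvB ?bnd_simp// Rintegral_itv_obnd_cbnd//.
by apply: integrableS iu' => //; apply: subset_itv; rewrite bnd_simp.
Qed.

(** The closed intervals may share endpoints; removing these leaves the integrals unchanged and
    makes the intervals disjoint. *)
Lemma sum_Rintegral_itv_le (T : R) (I : finType) (a b : I -> R) u :
  mu.-integrable `[0, T] (EFin \o u) -> (forall x, 0 <= u x) ->
  (forall i, 0 <= a i /\ a i <= b i /\ b i <= T) ->
  trivIset setT (fun i => `]a i, b i[%classic : set R) ->
  \sum_i \int[mu]_(x in `[a i, b i]) u x <= \int[mu]_(x in `[0, T]) u x.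
Proof.
move=> iu u0 abT tr.
have sub i : `]a i, b i[%classic `<=` (`[0, T]%classic : set R).
  by have [? [? ?]] := abT i; apply: subset_itv; rewrite bnd_simp.
have sub' i : `[a i, b i[%classic `<=` (`[0, T]%classic : set R).
  by have [? [? ?]] := abT i; apply: subset_itv; rewrite bnd_simp.
have iuS (D : set R) : measurable D -> D `<=` `[0, T] -> mu.-integrable D (EFin \o u).
  by move=> mD DT; exact: integrableS iu.
have mu_u : measurable_fun `[0, T] (EFin \o u) by apply: measurable_int iu.
rewrite -lee_fin -sumEFin RintegralE//.
under eq_bigr => i _.
  rewrite -Rintegral_itv_bndo_bndc; last exact: iuS.
  rewrite -Rintegral_itv_obnd_cbnd; last exact: iuS.
  rewrite RintegralE//; last exact: iuS.
  over.
rewrite -(@ge0_integral_bigsetU _ _ _ mu _ (fun i => `]a i, b i[%classic))//=; last 4 first.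
- exact: index_enum_uniq.
- by apply: sub_trivIset tr.
- apply: measurable_funS mu_u => //.
  by rewrite -bigcup_seq => x [i _] /sub.
- by move=> x _; rewrite lee_fin.
apply: ge0_subset_integral => //.
- exact: bigsetU_measurable.
- by move=> x _; rewrite lee_fin.
- by rewrite -bigcup_seq => x [i _] /sub.
Qed.

(** Young's inequality without square roots: the square of the right-hand side exceeds l B by a
    square. Being linear in B and in l, the bound can be summed over a family of intervals. *)
Lemma le_normr_AMGM (A B l c : R) : 0 < c -> 0 <= l -> A ^+ 2 <= l * B ->
  0 <= B -> `|A| <= c / 2 * B + l / (2 * c).
Proof.
move=> c0 l0 AB B0.
have c2 : 0 <= 2 * c by rewrite mulr_ge0// ltW.
have pos : 0 <= c / 2 * B + l / (2 * c).
  by rewrite addr_ge0// ?divr_ge0// mulr_ge0// divr_ge0// ltW.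
rewrite -(@ler_pXn2r _ 2)// ?nnegrE//.
rewrite real_normK ?num_real//; apply: le_trans AB _.
have -> : (c / 2 * B + l / (2 * c)) ^+ 2 = (c / 2 * B - l / (2 * c)) ^+ 2 + l * B.
  by field; rewrite gt_eqF.
by rewrite lerDr sqr_ge0.
Qed.

(* [G (t + h) - G t] is the derivative of [P (t + h) - P t], where [P' = G]. *)
Lemma Rintegral_shift_le (G : R -> R) (T M h : R) : 0 < T -> 0 < h ->
  continuous G -> (forall x, 0 <= G x <= M) ->
  \int[mu]_(t in `[0, T]) (G (h + t) - G t) <= h * M.
Proof.
move=> T0 h0 cG GM.
(* The base point -1 lies to the left of 0, so that [P] is differentiable at 0 too. *)
pose P (x : R) := \int[mu]_(t in `[-1, x]) G t.
have dP (x : R) : -1 < x -> is_derive x 1 P (G x).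
  move=> x1; have [] : derivable P x 1 /\ derive1 P x = G x.
    apply: (@continuous_FTC1 _ G (BLeft (-1)) x (x + 1)); last exact: cG.
    - by rewrite ltrDl.
    - apply: continuous_compact_integrable; first exact: segment_compact.
      exact: continuous_subspaceT.
    - by rewrite lte_fin.
  by rewrite derive1E => dPx PE; exact: DeriveDef.
pose H (t : R) := P (h + t) - P t.
have dH (x : R) : -1 < x -> is_derive x 1 H (G (h + x) - G x).
  move=> x1; apply: is_deriveB; last exact: dP.
  have dS : is_derive x 1 (fun t => h + t) (0 + 1) by apply: is_deriveD.
  have := @is_derive1_comp _ P (fun t => h + t) x _ _ (dP (h + x) _) dS.
  by rewrite add0r mulr1; apply; lra.
have cH (x : R) : -1 < x -> {for x, continuous H}.
  move=> /dH[dHx _]; apply: differentiable_continuous; exact/derivable1_diffP.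
have cg : continuous (fun t => G (h + t) - G t).
  move=> x; apply: cvgB; last exact: cG.
  apply: (@continuous_comp _ _ _ (fun x => h + x) G); last exact: cG.
  by apply: cvgD; [exact: cvg_cst|exact: cvg_id].
have FTC := @continuous_FTC2 _ (fun t => G (h + t) - G t) H 0 T T0.
rewrite /Rintegral FTC/=; last 3 first.
- exact: continuous_subspaceT.
- split.
  + by move=> x; rewrite in_itv/= => /andP[x0 _]; have [] := dH x _ => //; lra.
  + by apply: cvg_at_right_filter; apply: cH; lra.
  + by apply: cvg_at_left_filter; apply: cH; lra.
- move=> x; rewrite in_itv/= => /andP[x0 _].
  by have [_] := dH x ltac:(lra); rewrite derive1E.
(* The integral is H T - H 0, and each term is h times a value of G between 0 and M. *)
have MVTP (x : R) : 0 <= x -> exists c, P (h + x) - P x = G c * h.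
  move=> x0; have [|||c _] := @MVT_segment _ P G x (h + x).
  - by rewrite lerDr ltW.
  - by move=> y; rewrite in_itv/= => /andP[xy _]; apply: dP; lra.
  - apply: derivable_within_continuous => y; rewrite in_itv/= => /andP[xy _].
    by have [] := dP y ltac:(lra).
  - by rewrite addrK => ->; exists c.
have [c1 E1] := MVTP T (ltW T0); have [c2 E2] := MVTP 0 (lexx _).
rewrite /H E1 E2.
have /andP[_ G1] := GM c1; have /andP[G2 _] := GM c2; nra.
Qed.

End interval_integrals.

(** * Lower semicontinuity of the energy *)

Lemma cvg_sum_seq (R : realType) (S : Type) (F : set_system S) (FF : Filter F)
    (I : Type) (r : seq I) (f : I -> S -> R) (l : I -> R) :
  (forall i, f i x @[x --> F] --> l i) ->
  \sum_(i <- r) f i x @[x --> F] --> \sum_(i <- r) l i.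
Proof.
move=> fl; elim: r => [|i r IH].
  by rewrite big_nil; under eq_fun do rewrite big_nil; exact: cvg_cst.
by rewrite big_cons; under eq_fun do rewrite big_cons; exact: cvgD.
Qed.

Lemma cvg_sqr (R : realType) (S : Type) (F : set_system S) (FF : Filter F)
    (f : S -> R) (l : R) :
  f x @[x --> F] --> l -> f x ^+ 2 @[x --> F] --> l ^+ 2.
Proof. by move=> fl; rewrite expr2; under eq_fun do rewrite expr2; exact: cvgM. Qed.

Lemma continuous_shift (R : realType) (g : R -> R) (h : R) :
  continuous g -> continuous (fun t => g (h + t)).
Proof.
move=> cg x; apply: (@continuous_comp _ _ _ (fun x => h + x) g); last exact: cg.
by apply: cvgD; [exact: cvg_cst|exact: cvg_id].
Qed.

Lemma continuous_clamp_within (R : realType) (T : R) (V : topologicalType)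
    (g : R -> V) : 0 <= T ->
  {within `[0, T], continuous g} -> continuous (g \o clamp T).
Proof.
move=> T0 cg x; have cT := clamp_itv T0 x.
have := cg (clamp T x); rewrite /continuous_at/= /nbhs/= -nbhs_subspace_in// => H.
apply: cvg_comp H => P /= HP.
have : \forall t \near x, clamp T t \in `[0, T] -> P (clamp T t) by exact: clamp_continuous HP.
rewrite nbhs_filterE; apply: (@filterS _ (nbhs x)) => t; apply.
exact: (clamp_itv T0 t).
Qed.

Section energy.
Context {R : realType} (T : R).
Hypothesis T0 : 0 < T.
Notation mu := (@lebesgue_measure R).
Implicit Types f : R -> 'rV[R]_2.

(** A real number: an infinite integral would be read as 0, so the value is meaningful only together
    with [L2_on T (derive1 f)]. *)
Definition energy f : R :=
  \sum_k \int[mu]_(s in `[0, T]) derive1 f s 0 k ^+ 2.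

Lemma energy_ge0 f : 0 <= energy f.
Proof. by apply: sumr_ge0 => k _; apply: Rintegral_ge0 => x _; exact: sqr_ge0. Qed.

Lemma sqr_increment_le f k s t : AC_on T f -> L2_on T (derive1 f) ->
  0 <= s -> s <= t -> t <= T ->
  (f t 0 k - f s 0 k) ^+ 2 <=
  (t - s) * \int[mu]_(x in `[s, t]) derive1 f x 0 k ^+ 2.
Proof.
move=> acf L2 s0 st tT; have [idf ->//] := AC_on_FTC T0 k acf.
have stT : `[s, t]%classic `<=` (`[0, T]%classic : set R).
  by apply: subset_itv; rewrite bnd_simp.
apply: Rintegral_sqr_le => //.
- exact: integrableS idf.
- by have [_ i2] := L2 k; exact: integrableS i2.
Qed.

(** The right-hand side depends on f only through the bound K: curves of bounded energy are
    equi-absolutely continuous, a property that survives pointwise limits. *)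
Lemma abs_cont_bound f k (e K : R) (I : finType) (a b : I -> R) :
  AC_on T f -> L2_on T (derive1 f) -> energy f <= K -> 0 < e ->
  (forall i, 0 <= a i /\ a i <= b i /\ b i <= T) ->
  trivIset setT (fun i => `]a i, b i[%classic : set R) ->
  \sum_i `|f (b i) 0 k - f (a i) 0 k| <= e / 2 * K + (\sum_i (b i - a i)) / (2 * e).
Proof.
move=> acf L2 fK e0 abT tr.
have u0 x : 0 <= derive1 f x 0 k ^+ 2 by exact: sqr_ge0.
apply: (@le_trans _ _ (\sum_i (e / 2 * (\int[mu]_(x in `[a i, b i]) derive1 f x 0 k ^+ 2)
    + (b i - a i) / (2 * e)))).
  apply: ler_sum => i _; have [ai [ab bT]] := abT i.
  apply: le_normr_AMGM => //; first by rewrite subr_ge0.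
    exact: sqr_increment_le.
  by apply: Rintegral_ge0 => x _.
rewrite big_split/= -mulr_sumr -mulr_suml lerD2r ler_wpM2l ?divr_ge0 ?(ltW e0)//.
have [_ i2] := L2 k.
apply: le_trans (sum_Rintegral_itv_le i2 u0 abT tr) _; apply: le_trans fK.
rewrite /energy (bigD1 k)//= lerDl sumr_ge0// => j _; apply: Rintegral_ge0 => x _; exact: sqr_ge0.
Qed.

(** Energy of coordinate k spent up to time t, made constant outside [0, T] so that
    [Rintegral_shift_le] applies. *)
Let G f k (t : R) := \int[mu]_(x in `[0, clamp T t]) derive1 f x 0 k ^+ 2.

Let G_bound f k t : L2_on T (derive1 f) ->
  0 <= G f k t <= \int[mu]_(x in `[0, T]) derive1 f x 0 k ^+ 2.
Proof.
move=> L2; have [_ i2] := L2 k.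
have := clamp_itv (ltW T0) t; rewrite in_itv/= => /andP[c0 cT].
apply/andP; split; first by apply: Rintegral_ge0 => x _; exact: sqr_ge0.
rewrite -subr_ge0 (Rintegral_itv_split i2)//.
by apply: Rintegral_ge0 => x _; exact: sqr_ge0.
Qed.

Let G_continuous f k : L2_on T (derive1 f) -> continuous (G f k).
Proof.
move=> L2; have [_ i2] := L2 k.
have := parameterized_integral_continuous (ltW T0) i2.
exact: continuous_clamp_within (ltW T0).
Qed.


(** The square of an increment over a step of length at most h is at most h times the energy spent
    during the step, which is an increment of [G]; integrating this shifted difference costs at most
    h times the total energy. *)
Let dq_energy f (h : R) : AC_on T f -> L2_on T (derive1 f) -> 0 < h ->
  (\int[mu]_(t in `[0%R, T])
     (\sum_k ((f (clamp T (h + t)) 0 k - f (clamp T t) 0 k) / h) ^+ 2)%:E <= (energy f)%:E)%E.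
Proof.
move=> acf L2 h0.
pose D (t : R) := \sum_k ((f (clamp T (h + t)) 0 k - f (clamp T t) 0 k) / h) ^+ 2.
pose Gs (t : R) := \sum_k G f k t.
have cfc k : continuous (fun s => f (clamp T s) 0 k).
  exact: (abs_cont_clamp_continuous T0 (AC_on_abs_cont k acf)).
have cD : continuous D.
  move=> x; apply: cvg_sum_seq => k.
  apply: cvg_sqr.
  apply: cvgM; last exact: cvg_cst.
  by apply: cvgB; [exact: (@continuous_shift _ (fun s => f (clamp T s) 0 k) h (cfc k) x)|exact: cfc].
have cGs : continuous Gs by move=> x; apply: cvg_sum_seq => k; exact: G_continuous.
have iC (g : R -> R) : continuous g -> mu.-integrable `[0, T] (EFin \o g).
  move=> cg; apply: continuous_compact_integrable; first exact: segment_compact.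
  exact: continuous_subspaceT.
rewrite -RintegralE//; last exact: iC.
rewrite lee_fin.
have cGB : continuous (fun t => Gs (h + t) - Gs t).
  by move=> x; apply: cvgB; [exact: (@continuous_shift _ Gs h cGs x)|exact: cGs].
apply: (@le_trans _ _ (\int[mu]_(t in `[0, T]) (h^-1 * (Gs (h + t) - Gs t)))).
  apply: le_Rintegral => //; [exact: iC| |].
    by apply: iC => x; apply: cvgM; [exact: cvg_cst|exact: cGB].
  move=> t _; rewrite /D /Gs -sumrB mulr_sumr; apply: ler_sum => k _.
  have := clamp_itv (ltW T0) t; rewrite in_itv/= => /andP[ct0 ctT].
  have := clamp_itv (ltW T0) (h + t); rewrite in_itv/= => /andP[cs0 csT].
  have cts : clamp T t <= clamp T (h + t) by apply: clamp_mono; rewrite lerDr ltW.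
  have := sqr_increment_le k acf L2 ct0 cts csT.
  have [_ i2] := L2 k.
  rewrite -(Rintegral_itv_split i2)// -/(G f k t) -/(G f k (h + t)) => H.
  rewrite expr_div_n ler_pdivrMr ?exprn_gt0//; apply: le_trans H _.
  rewrite (_ : h^-1 * _ * _ = h * (G f k (h + t) - G f k t)); last first.
    by field; rewrite gt_eqF.
  apply: ler_wpM2r.
    by rewrite (Rintegral_itv_split i2)//; apply: Rintegral_ge0 => x _; exact: sqr_ge0.
  have := clamp_lip T (h + t) t; rewrite addrK (ger0_norm (ltW h0)).
  exact: le_trans (ler_norm _).
rewrite RintegralZl//; last exact: iC.
rewrite ler_pdivrMl//; apply: Rintegral_shift_le => // x.
apply/andP; split.
  by apply: sumr_ge0 => k _; have /andP[] := G_bound k x L2.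
by apply: ler_sum => k _; have /andP[] := G_bound k x L2.
Qed.

(** Pointwise convergence is enough. Absolute continuity of the limit is settled before its
    derivative is used; then Fatou's lemma is applied to difference quotients of fixed step along
    the sequence, and again as the step tends to 0. *)
Lemma energy_lsc (f_ : nat -> R -> 'rV[R]_2) f (K : R) :
  (forall i, AC_on T (f_ i)) -> (forall i, L2_on T (derive1 (f_ i))) ->
  (\forall i \near \oo, energy (f_ i) <= K) ->
  (forall s k, s \in `[0, T] -> f_ i s 0 k @[i --> \oo] --> f s 0 k) ->
  [/\ AC_on T f, L2_on T (derive1 f) & energy f <= K].
Proof.
move=> acf_ L2f_ [N _ NK] ff.
have acf : AC_on T f.
  apply: abs_cont_AC_on => k e e0.
  have K0 : 0 <= K by apply: le_trans (NK N _) => //=; exact: energy_ge0.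
  (* This weight makes the energy term of [abs_cont_bound] at most e / 2; with total length below c
     e / 2 the other term is below e / 4. *)
  pose c := e / (K + 1).
  have K1 : 0 < K + 1 by rewrite ltr_wpDl.
  have c0 : 0 < c by rewrite divr_gt0.
  exists (c * e / 2); first by rewrite !divr_gt0// mulr_gt0.
  move=> I a b abT tr sd.
  apply: (@le_lt_trans _ _ (c / 2 * K + (\sum_i (b i - a i)) / (2 * c))).
    have : \sum_j `|f_ i (b j) 0 k - f_ i (a j) 0 k| @[i --> \oo] -->
           \sum_j `|f (b j) 0 k - f (a j) 0 k|.
      apply: cvg_sum_seq => j; have [a0 [ab bT]] := abT j.
      apply: cvg_norm; apply: cvgB; apply: ff; rewrite in_itv/=; apply/andP; split => //.
      - exact: le_trans ab.
      - exact: le_trans bT.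
    move/cvgr_to_le; apply.
    near=> i; apply: abs_cont_bound => //.
    by apply: NK; near: i; exact: nbhs_infty_ge.
  have h1 : c / 2 * K <= e / 2.
    have -> : c / 2 * K = e / 2 * (K / (K + 1)) by rewrite /c; field; rewrite gt_eqF.
    by rewrite ler_piMr ?divr_ge0 ?(ltW e0)// ler_pdivrMr// mul1r lerDl.
  have h2 : (\sum_i (b i - a i)) / (2 * c) < e / 4.
    have c20 : 0 < 2 * c by rewrite mulr_gt0.
    rewrite ltr_pdivrMr//.
    by have -> : e / 4 * (2 * c) = c * e / 2 by lra.
  lra.
have mdf k := measurable_derive1_abs_cont T0 k acf.
have mdf2 k : measurable_fun `[0, T] (fun s => derive1 f s 0 k ^+ 2).
  by apply: measurable_funX; exact: mdf.
have cfc k : continuous (fun s => f (clamp T s) 0 k).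
  exact: (abs_cont_clamp_continuous T0 (AC_on_abs_cont k acf)).
pose D (g : R -> 'rV[R]_2) (n : nat) (t : R) :=
  \sum_k ((g (clamp T (n.+1%:R^-1 + t)) 0 k - g (clamp T t) 0 k) / n.+1%:R^-1) ^+ 2.
have D0 g n t : 0 <= D g n t by apply: sumr_ge0 => k _; exact: sqr_ge0.
have mD g n : AC_on T g -> measurable_fun `[0, T] (D g n).
  move=> acg; apply: measurable_funTS; apply: continuous_measurable_fun.
  move=> x; apply: cvg_sum_seq => k.
  have cg : continuous (fun s => g (clamp T s) 0 k).
    exact: (abs_cont_clamp_continuous T0 (AC_on_abs_cont k acg)).
  apply: cvg_sqr.
  apply: cvgM; last exact: cvg_cst.
  by apply: cvgB; [exact: (@continuous_shift _ (fun s => g (clamp T s) 0 k) _ cg x)|exact: cg].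
have DK n : (\int[mu]_(t in `[0%R, T]) (D f n t)%:E <= K%:E)%E.
  (* Shifting the sequence by N makes the energy bound hold for every index. *)
  apply: (@ae_fatou_bound _ _ _ mu _ (fun i => D (f_ (i + N)%N) n)) => //.
  - by move=> i; exact: mD.
  - exact: mD.
  - apply: aeW => t _; apply: cvg_sum_seq => k.
    apply: cvg_sqr.
    apply: cvgM; last exact: cvg_cst.
    have sh s : s \in `[0, T] -> f_ (i + N)%N s 0 k @[i --> \oo] --> f s 0 k.
      move=> /(ff s k) fs.
      by rewrite (cvg_shiftn N (fun i => f_ i s 0 k)).
    by apply: cvgB; apply: sh; exact: clamp_itv (ltW T0) _.
  - move=> i; apply: le_trans (dq_energy _ _ _) _ => //.
    by rewrite lee_fin; apply: NK => /=; exact: leq_addl.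
have EK : (\int[mu]_(t in `[0%R, T]) (\sum_k derive1 f t 0 k ^+ 2)%:E <= K%:E)%E.
  apply: (@ae_fatou_bound _ _ _ mu _ (D f)) => //.
  - by move=> n; exact: mD.
  - apply: measurable_sum => k; exact: mdf2.
  - by move=> t _; apply: sumr_ge0 => k _; exact: sqr_ge0.
  - have := ae_and (AC_on_ae_derivable T0 acf) (ae_itv_oo T).
    apply: ae_impl => t [df tI] /tI tT; apply: cvg_sum_seq => k; apply: cvg_sqr.
    have dft := df tT.
    rewrite derive1_coord//.
    move/derivable_mxP : dft => /(_ 0 k) /derivable_dq dft.
    apply/cvgrPdist_lt => e e0.
    have /cvgrPdist_lt/(_ _ e0)[/= d d0 H] : h^-1 * (f (h + t) 0 k - f t 0 k) @[h --> 0^'] -->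
      derive1 (fun s => f s 0 k) t by exact: dft.
    have [/andP[t0 tT'] Tt] : 0 < t < T /\ 0 < T - t by split=> //; lra.
    near=> n; rewrite (@clamp_id _ T t) ?in_itv/= ?(ltW t0) ?(ltW tT')//.
    (* For large n the point t + 1/(n+1) is still in [0, T], so the clamp disappears and the
       quotient is the genuine one. *)
    have nT : n.+1%:R^-1 < T - t.
      by near: n; exact: (near_infty_natSinv_lt (PosNum Tt)).
    rewrite clamp_id ?in_itv/=; last first.
      by apply/andP; split; [rewrite addr_ge0// ltW|rewrite -lerBrDr ltW].
    rewrite mulrC; apply: H; last by rewrite gt_eqF.
    rewrite /= sub0r normrN ger0_norm//.
    by near: n; exact: (near_infty_natSinv_lt (PosNum d0)).
have L2 : L2_on T (derive1 f).
  move=> k; split; first exact: mdf.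
  apply/integrableP; split; first by apply/measurable_EFinP; exact: mdf2.
  apply: le_lt_trans (ltry K); apply: le_trans EK.
  apply: ge0_le_integral => //.
  - by apply/measurable_EFinP; apply: measurableT_comp => //; exact: mdf2.
  - by apply/measurable_EFinP; apply: measurable_sum => j; exact: mdf2.
  - move=> t _; rewrite lee_fin ger0_norm ?sqr_ge0// (bigD1 k)//= lerDl.
    by apply: sumr_ge0 => j _; exact: sqr_ge0.
split => //; rewrite -lee_fin; apply: le_trans EK.
rewrite /energy -sumEFin; under eq_bigr => k _ do rewrite RintegralE ?(L2 k).2//.
rewrite -ge0_integral_sum//; first by under eq_integral do rewrite sumEFin.
- by move=> k; apply/measurable_EFinP; exact: mdf2.
- by move=> k t _; rewrite lee_fin sqr_ge0.
Unshelve. all: by end_near.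
Qed.

End energy.

(** * Cut-off functions *)

Section bump.
Context {R : realType}.
Implicit Types (s a c t : R).

Let ramp s t : R := Num.max 0 (s - t).

Let ramp_ge0 s t : 0 <= ramp s t.
Proof. by rewrite /ramp le_max lexx. Qed.

Let ramp_le s t : 0 <= s -> 0 <= t -> ramp s t <= s.
Proof. by move=> s0 t0; rewrite /ramp ge_max s0 gerBl. Qed.

Let ramp0 s t : s <= t -> ramp s t = 0.
Proof. by move=> st; rewrite /ramp max_l// subr_le0. Qed.

Let rampM s t : ramp s t * (s - t) = ramp s t ^+ 2.
Proof.
rewrite /ramp; have [st|ts] := leP (s - t) 0; first by rewrite mul0r expr0n.
by rewrite expr2.
Qed.

Let ramp_continuous s : continuous (ramp s).
Proof.
move=> x; apply: (@continuous_max _ _ (cst 0) (fun t => s - t)); first exact: cvg_cst.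
by apply: cvgB; [exact: cvg_cst|exact: cvg_id].
Qed.

(** The positive part is not differentiable at s, but its square is: this is its first-order Taylor
    expansion with a quadratic error, valid across the kink. *)
Let ramp_sqr_quadratic s x y :
  `|ramp s y ^+ 2 - ramp s x ^+ 2 + 2 * ramp s x * (y - x)| <= (y - x) ^+ 2.
Proof.
rewrite /ramp !maxElt ler_norml.
have q1 := sqr_ge0 (y - x); have q2 := sqr_ge0 (s - y); have q3 := sqr_ge0 (s - x).
case: (ltP 0 (s - x)) => hx; case: (ltP 0 (s - y)) => hy; apply/andP.
- by split; lra.
- by have := mulr_ge0 (ltW hx) (_ : 0 <= y - s); rewrite subr_ge0 -subr_le0 => /(_ hy); split; lra.
- by have := mulr_ge0 (ltW hy) (_ : 0 <= x - s); rewrite subr_ge0 -subr_le0 => /(_ hx); split; nra.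
- by split; lra.
Qed.

Let is_derive_ramp_sqr s x :
  is_derive (x : R) (1 : R) (fun t : R => ramp s t ^+ 2) (- (2 * ramp s x)).
Proof.
suff H : h^-1 *: (((fun t => ramp s t ^+ 2) \o shift x) (h *: (1 : R)) - ramp s x ^+ 2)
    @[h --> 0^'] --> - (2 * ramp s x).
  by apply: DeriveDef; [apply/cvg_ex; exists (- (2 * ramp s x))|exact: cvg_lim].
apply/cvgrPdist_le => e e0; near=> h.
have h0 : h != 0 by near: h; exact: nbhs_dnbhs_neq.
rewrite /= /GRing.scale/= mulr1 distrC.
have := ramp_sqr_quadratic s x (h + x); rewrite addrK => H.
have -> : h^-1 * (ramp s (h + x) ^+ 2 - ramp s x ^+ 2) - - (2 * ramp s x) =
    h^-1 * (ramp s (h + x) ^+ 2 - ramp s x ^+ 2 + 2 * ramp s x * h).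
  by field.
rewrite normrM normfV mulrC ler_pdivrMr ?normr_gt0//.
apply: le_trans H _; rewrite -real_normK ?num_real// expr2 ler_wpM2r//.
near: h; apply: dnbhs0_le e0.
Unshelve. all: by end_near. Qed.

(* [(u / s)^3 (a + c t)] with [u = (s - t)_+], and its first two derivatives;
   [u^3] is written [u^2 (s - t)] so that only [u^2] has to be differentiated. *)
Definition bump s a c t : R := ramp s t ^+ 2 * ((s - t) * (a + c * t) / s ^+ 3).

Definition dbump s a c t : R :=
  ramp s t ^+ 2 * ((c * (s - t) - 3 * (a + c * t)) / s ^+ 3).

Definition ddbump s a c t : R :=
  (6 * ramp s t * (a + c * t) - 6 * c * ramp s t ^+ 2) / s ^+ 3.

Lemma is_derive_bump s a c t : is_derive (t : R) (1 : R) (bump s a c) (dbump s a c t).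
Proof.
have d1 := is_derive_ramp_sqr s t.
rewrite /bump; apply: is_derive_eq.
rewrite !(scaler0, add0r, addr0, mulr0, mul0r, oppr0) /GRing.scale/= /dbump.
have := rampM s t; set u := ramp s t => E.
transitivity ((u ^+ 2 * (c * (s - t) - (a + c * t)) -
  2 * (u * (s - t)) * (a + c * t)) / s ^+ 3); first by ring.
by rewrite E; ring.
Qed.

Lemma is_derive_dbump s a c t : is_derive (t : R) (1 : R) (dbump s a c) (ddbump s a c t).
Proof.
have d1 := is_derive_ramp_sqr s t.
rewrite /dbump; apply: is_derive_eq.
rewrite !(scaler0, add0r, addr0, mulr0, mul0r, oppr0) /GRing.scale/= /ddbump.
have := rampM s t; set u := ramp s t => E.
transitivity ((6 * u * (a + c * t) - 4 * c * u ^+ 2 -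
  2 * c * (u * (s - t))) / s ^+ 3); first by ring.
by rewrite E; ring.
Qed.

Lemma ddbump_continuous s a c : continuous (ddbump s a c).
Proof.
move=> x; rewrite /ddbump.
have cr := @ramp_continuous s x.
apply: cvgM; last exact: cvg_cst.
apply: cvgB; apply: cvgM.
- by apply: cvgM => //; exact: cvg_cst.
- by apply: cvgD; [exact: cvg_cst|apply: cvgM; [exact: cvg_cst|exact: cvg_id]].
- exact: cvg_cst.
- exact: cvg_sqr.
Qed.

Lemma bump_at0 s a c : 0 < s -> bump s a c 0 = a.
Proof.
move=> s0; rewrite /bump /ramp subr0 mulr0 addr0 max_r ?ltW//; field.
by rewrite gt_eqF.
Qed.

Lemma dbump_at0 s a c : 0 < s -> dbump s a c 0 = c - 3 * a / s.
Proof.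
move=> s0; rewrite /dbump /ramp subr0 mulr0 addr0 max_r ?ltW//; field.
by rewrite gt_eqF.
Qed.

Lemma bump_after s a c t : s <= t -> bump s a c t = 0.
Proof. by move=> st; rewrite /bump ramp0// expr0n mul0r. Qed.

Lemma dbump_after s a c t : s <= t -> dbump s a c t = 0.
Proof. by move=> st; rewrite /dbump ramp0// expr0n mul0r. Qed.

Lemma ddbump_after s a c t : s <= t -> ddbump s a c t = 0.
Proof. by move=> st; rewrite /ddbump ramp0// expr0n !mulr0 mul0r subr0 mul0r. Qed.

Let bumpE s a c t : bump s a c t = (ramp s t / s) ^+ 3 * (a + c * t).
Proof.
have -> : bump s a c t = ramp s t * (ramp s t * (s - t)) * ((a + c * t) / s ^+ 3).
  by rewrite /bump; ring.
by rewrite rampM expr_div_n; ring.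
Qed.

Let ratio_itv s t : 0 < s -> 0 <= t -> 0 <= (ramp s t / s) ^+ 3 <= 1.
Proof.
move=> s0 t0; rewrite exprn_ge0 ?divr_ge0 ?(ltW s0)//=.
by rewrite exprn_ile1 ?divr_ge0 ?(ltW s0)// ler_pdivrMr// mul1r ramp_le// ltW.
Qed.

(** The factor (u / s)^3 lies in [0, 1], so a lower bound -e t of a + c t survives, whatever s. With
    e = 0 the bump is nonnegative; with e > 0 it is outweighed by a curve leaving the wall at speed
    at least e. *)
Lemma bump_ge s a c e t : 0 < s -> 0 <= t -> 0 <= a -> 0 <= e -> - e <= c ->
  - (e * t) <= bump s a c t.
Proof.
move=> s0 t0 a0 e0 ec; rewrite bumpE.
have /andP[r0 r1] := ratio_itv s0 t0; set r := _ ^+ 3 in r0 r1 *.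
have : - (e * t) <= a + c * t by nra.
have : 0 <= e * t by rewrite mulr_ge0.
nra.
Qed.

Lemma bump_bound s a c t : 0 < s -> 0 <= t -> `|bump s a c t| <= `|a| + `|c| * s.
Proof.
move=> s0 t0; have [ts|st] := leP t s; last first.
  by rewrite bump_after ?(ltW st)// normr0 addr_ge0// mulr_ge0// ltW.
rewrite bumpE normrM.
have /andP[r0 r1] := ratio_itv s0 t0; rewrite ger0_norm//.
apply: le_trans (ler_piMl _ r1) _ => //.
apply: le_trans (ler_normD _ _) _; rewrite lerD2l normrM ler_wpM2l//.
by rewrite ger0_norm.
Qed.

Lemma dbump_bound s a c t : 0 < s -> 0 <= t ->
  `|dbump s a c t| <= (3 * `|a| + 4 * `|c| * s) / s.
Proof.
move=> s0 t0; have [ts|st] := leP t s; last first.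
  rewrite dbump_after ?(ltW st)// normr0 divr_ge0 ?(ltW s0)// addr_ge0// !mulr_ge0//.
  exact: ltW.
have u0 := ramp_ge0 s t; have us := ramp_le (ltW s0) t0.
have -> : dbump s a c t = (ramp s t / s) ^+ 2 * ((c * (s - t) - 3 * (a + c * t)) / s).
  by rewrite /dbump; field; rewrite gt_eqF.
rewrite normrM.
have r0 : 0 <= (ramp s t / s) ^+ 2 by exact: sqr_ge0.
have r1 : (ramp s t / s) ^+ 2 <= 1.
  by rewrite exprn_ile1 ?divr_ge0 ?(ltW s0)// ler_pdivrMr// mul1r.
rewrite ger0_norm//; apply: le_trans (ler_piMl _ r1) _ => //.
rewrite normrM normfV (gtr0_norm s0) ler_pM2r ?invr_gt0//.
have := ler_norm a; have := ler_norm c; have := ler_norm (- a); have := ler_norm (- c).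
rewrite !normrN ler_norml => ? ? ? ?; apply/andP; split; nra.
Qed.

Lemma ddbump_bound s a c t : 0 < s -> 0 <= t ->
  `|ddbump s a c t| <= (6 * `|a| + 12 * `|c| * s) / s ^+ 2.
Proof.
move=> s0 t0; have [ts|st] := leP t s; last first.
  rewrite ddbump_after ?(ltW st)// normr0 divr_ge0 ?exprn_ge0 ?(ltW s0)// addr_ge0// !mulr_ge0//.
  exact: ltW.
have u0 := ramp_ge0 s t; have us := ramp_le (ltW s0) t0.
have -> : ddbump s a c t = (ramp s t / s) * ((6 * (a + c * t) - 6 * c * ramp s t) / s ^+ 2).
  by rewrite /ddbump; field; rewrite gt_eqF.
have r0 : 0 <= ramp s t / s by rewrite divr_ge0// ltW.
have r1 : ramp s t / s <= 1 by rewrite ler_pdivrMr// mul1r.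
rewrite normrM ger0_norm//; apply: le_trans (ler_piMl _ r1) _ => //.
have s2 : 0 < s ^+ 2 by rewrite exprn_gt0.
rewrite normrM normfV (gtr0_norm s2) ler_pM2r ?invr_gt0//.
have := ler_norm a; have := ler_norm c; have := ler_norm (- a); have := ler_norm (- c).
rewrite !normrN ler_norml => ? ? ? ?; apply/andP; split; nra.
Qed.

(* Take s = tau, unless this forces c < 0 although c >= 0 is required: then
   c = 0 and s = 3 a / (- q), with an energy of order (- q)^3 / a. *)
Lemma bump_parameters (tau e : R) : 0 < tau -> 0 < e ->
  exists2 rho : R, 0 < rho & forall a q, `|a| <= rho -> `|q| <= rho ->
  exists s c, [/\ 0 < s <= tau, c - 3 * a / s = q,
    `|a| + `|c| * s <= e, (3 * `|a| + 4 * `|c| * s) / s <= e &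
    [/\ ((6 * `|a| + 12 * `|c| * s) / s ^+ 2) ^+ 2 * s <= e, `|c| <= e &
      (0 <= a -> posp (- q) ^+ 3 <= rho * a -> 0 <= c)]].
Proof.
move=> tau0 e0.
pose k := 1 + 3 / tau.
(* The sum of the constants of all the required bounds, so that a single rho serves each of them.
   The factor [k] bounds the slope c = q + 3 a / tau by rho k. *)
pose C := 2 + k + (1 + k * tau) + (3 + 4 * k * tau) / tau + (6 + 12 * k * tau) ^+ 2 / tau ^+ 3.
have k0 : 0 < k by rewrite /k ltr_pwDl// divr_ge0// ltW.
have kt : 0 < k * tau by rewrite mulr_gt0.
have C1 : 0 <= (3 + 4 * k * tau) / tau by rewrite divr_ge0 ?(ltW tau0)//; nra.
have C2 : 0 <= (6 + 12 * k * tau) ^+ 2 / tau ^+ 3 by rewrite divr_ge0 ?sqr_ge0 ?exprn_ge0 ?(ltW tau0).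
have C0 : 0 < C by rewrite /C; nra.
pose rho := Num.min 1 (e / C).
have rho0 : 0 < rho by rewrite lt_min ltr01 divr_gt0.
have rho1 : rho <= 1 by rewrite ge_min lexx.
have rhoC : rho * C <= e by rewrite -ler_pdivlMr// ge_min lexx orbT.
have rhoD D : D <= C -> rho * D <= e.
  by move=> DC; apply: le_trans rhoC; rewrite ler_pM2l.
exists rho => // a q ar qr.
(* The exceptional case: the choice s = tau would give a negative slope although a nonnegative one
   is due. *)
have [[a0 [qa qta]]|ncase] :=
    pselect (0 <= a /\ posp (- q) ^+ 3 <= rho * a /\ q < - (3 * a / tau)).
  have q0 : q < 0 by apply: lt_le_trans qta _; rewrite oppr_le0 divr_ge0 ?(ltW tau0)// mulr_ge0.
  have pq : posp (- q) = - q by rewrite /posp max_l// oppr_ge0 ltW.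
  (* If a = 0, the cubic bound would force the positive number -q to vanish. *)
  have a1 : 0 < a.
    rewrite lt_neqAle a0 andbT; apply/negP => /eqP a00.
    move: qa; rewrite pq -a00 mulr0 leNgt exprn_gt0// oppr_gt0//.
  exists (3 * a / (- q)), 0; have mq : 0 < - q by rewrite oppr_gt0.
  have qn0 : q != 0 by rewrite lt_eqF.
  have an0 : a != 0 by rewrite gt_eqF.
  have s0 : 0 < 3 * a / - q by rewrite divr_gt0// mulr_gt0.
  rewrite s0 normr0 !(mulr0, mul0r, addr0) (gtr0_norm a1).
  have ar' : a <= rho by rewrite -(gtr0_norm a1).
  have re : rho <= e by rewrite -[rho]mulr1 rhoD// /C; nra.
  split => //.
  - rewrite ler_pdivrMr//=; move: qta; rewrite ltrNr ltr_pdivrMr// => /ltW; lra.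
  - by field; rewrite ?qn0 ?an0.
  - exact: le_trans re.
  - have -> : 3 * a / (3 * a / - q) = - q by field; rewrite ?qn0 ?an0.
    by rewrite (le_trans _ re)// -(gtr0_norm mq) normrN.
  - split => //; last exact: ltW.
    (* The energy is 36 a^2 / s^3; at s = 3 a / (-q) this is 4/3 of the ratio that the cubic bound
       makes at most rho. *)
    have -> : (6 * a / (3 * a / - q) ^+ 2) ^+ 2 * (3 * a / - q) = 4 / 3 * ((- q) ^+ 3 / a).
      by field; rewrite ?qn0 ?an0.
    have : (- q) ^+ 3 / a <= rho by rewrite ler_pdivrMr// -pq.
    have : rho * 2 <= e by rewrite rhoD// /C; nra.
    lra.
pose c := q + 3 * a / tau.
have cr : `|c| <= rho * k.
  apply: le_trans (ler_normD _ _) _; rewrite /k mulrDr mulr1 lerD//.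
  rewrite -mulrA normrM (ger0_norm (ler0n _ 3)) normrM normfV (gtr0_norm tau0).
  have : `|a| / tau <= rho / tau by rewrite ler_pM2r ?invr_gt0.
  lra.
have ke : rho * k <= e by rewrite rhoD// /C; nra.
exists tau, c; rewrite tau0 lexx.
have t2 : 0 < tau ^+ 2 by rewrite exprn_gt0.
have t3 : 0 < tau ^+ 3 by rewrite exprn_gt0.
have ct : `|c| * tau <= rho * (k * tau) by rewrite mulrA ler_pM2r.
have a0 := normr_ge0 a; have c0 := normr_ge0 c.
split => //.
- by rewrite /c; ring.
- apply: le_trans (rhoD (1 + k * tau) _); first by lra.
  by rewrite /C; nra.
- apply: le_trans (rhoD ((3 + 4 * k * tau) / tau) _); last by rewrite /C; nra.
  by rewrite mulrA ler_pM2r ?invr_gt0//; lra.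
split; first last.
- move=> a0' qa; rewrite leNgt; apply/negP => c0'; apply: ncase; split => //; split => //.
  by move: c0'; rewrite /c; set z := 3 * a / tau; lra.
- exact: le_trans ke.
apply: le_trans (rhoD ((6 + 12 * k * tau) ^+ 2 / tau ^+ 3) _); last by rewrite /C; nra.
have -> : ((6 * `|a| + 12 * `|c| * tau) / tau ^+ 2) ^+ 2 * tau =
    (6 * `|a| + 12 * `|c| * tau) ^+ 2 / tau ^+ 3 by field; rewrite gt_eqF.
rewrite mulrA ler_pM2r ?invr_gt0//.
have H : 6 * `|a| + 12 * `|c| * tau <= rho * (6 + 12 * k * tau) by nra.
apply: (@le_trans _ _ ((rho * (6 + 12 * k * tau)) ^+ 2)).
  by rewrite ler_pXn2r// nnegrE; nra.
rewrite exprMn ler_wpM2r ?sqr_ge0// expr2 ler_piMl//; exact: ltW.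
Qed.

End bump.

(** * Plane geometry *)

Section plane.
Context {R : realType}.
Implicit Types (u v w : 'rV[R]_2) (a t : R).

Lemma row2P u v : u 0 0 = v 0 0 -> u 0 1 = v 0 1 -> u = v.
Proof.
move=> h0 h1; apply/rowP => i.
by have [->|/eqP i1] := eqVneq i 0; [|have -> : i = 1 by case: i i1 => -[|[|]]//= h; [move/eqP|move=> *; exact/val_inj]].
Qed.

Lemma dot2E u v : dot u v = u 0 0 * v 0 0 + u 0 1 * v 0 1.
Proof.
rewrite /dot big_ord_recl big_ord1; congr (_ + u 0 _ * v 0 _); exact: val_inj.
Qed.

Lemma dotDl u v w : dot (u + v) w = dot u w + dot v w.
Proof. by rewrite !dot2E !mxE; ring. Qed.

Lemma dotBl u v w : dot (u - v) w = dot u w - dot v w.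
Proof. by rewrite !dot2E !mxE; ring. Qed.

Lemma dotNl u v : dot (- u) v = - dot u v.
Proof. by rewrite !dot2E !mxE; ring. Qed.

Lemma dotNr u v : dot u (- v) = - dot u v.
Proof. by rewrite !dot2E !mxE; ring. Qed.

Lemma dotZl a u v : dot (a *: u) v = a * dot u v.
Proof. by rewrite !dot2E !mxE; ring. Qed.

Lemma dotC u v : dot u v = dot v u.
Proof. by rewrite !dot2E; ring. Qed.

Lemma dot_unit u : enorm u = 1 -> dot u u = 1.
Proof.
move=> u1; have : enorm u ^+ 2 = 1 by rewrite u1 expr1n.
by rewrite /enorm sqr_sqrtr// dot2E addr_ge0// -expr2 sqr_ge0.
Qed.

Lemma dot_continuous v : continuous (fun u => dot u v).
Proof.
rewrite (_ : (fun u => _) = fun u => u 0 0 * v 0 0 + u 0 1 * v 0 1); last first.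
  by apply/funext => u; rewrite dot2E.
move=> x.
have h i : (fun u : 'rV[R]_2 => u 0 i * v 0 i) @ x --> x 0 i * v 0 i.
  have ci := @coord_continuous R 1 2 0 i x; have := cvgM ci (cvg_cst (v 0 i)); exact.
by have := cvgD (h 0) (h 1); exact.
Qed.

Definition cross u v : R := u 0 0 * v 0 1 - u 0 1 * v 0 0.

Definition perp u : 'rV[R]_2 := \row_(k < 2) if k == 0 then - u 0 1 else u 0 0.

Lemma perp0 u : perp u 0 0 = - u 0 1. Proof. by rewrite mxE. Qed.

Lemma perp1 u : perp u 0 1 = u 0 0. Proof. by rewrite mxE. Qed.

Lemma unit_decomp u v : enorm u = 1 -> v = dot v u *: u + dot v (perp u) *: perp u.
Proof.
move=> /dot_unit; rewrite dot2E => u1; apply: row2P; rewrite !dot2E perp0 perp1 !mxE/=.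
  rewrite -[LHS]mul1r -u1; ring.
rewrite -[LHS]mul1r -u1; ring.
Qed.

Lemma dot_perp u : dot u (perp u) = 0.
Proof. by rewrite dot2E perp0 perp1; ring. Qed.

Lemma unit_orthogonal u v w : enorm u = 1 -> enorm v = 1 -> w != 0 ->
  dot w u = 0 -> dot w v = 0 -> v = u \/ v = - u.
Proof.
move=> u1 v1 w0 wu wv.
have wE := unit_decomp w u1; rewrite wu scale0r add0r in wE.
have c0 : dot w (perp u) != 0 by apply: contraNneq w0 => c0; rewrite wE c0 scale0r.
have pv : dot (perp u) v = 0.
  by move/eqP: wv; rewrite wE dotZl mulf_eq0 (negbTE c0)/= => /eqP.
have vE := unit_decomp v u1; rewrite [dot v (perp u)]dotC pv scale0r addr0 in vE.
have : dot v u ^+ 2 = 1.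
  by have := dot_unit v1; rewrite {1}vE dotZl dotC expr2.
move/eqP; rewrite sqrf_eq1 => /orP[/eqP d1|/eqP d1].
  by left; rewrite vE d1 scale1r.
by right; rewrite vE d1 scaleN1r.
Qed.

(** Cramer's rule. *)
Lemma cross_decomp u v w : cross u v != 0 ->
  w = (cross w v / cross u v) *: u + (cross u w / cross u v) *: v.
Proof. by move=> c0; apply: row2P; rewrite !mxE /cross in c0 *; field. Qed.

Lemma aligned_cross (a b c : 'rV[R]_2) : cross (c - b) (a - b) = 0 -> c != b -> aligned a b c.
Proof.
move=> cr cb; exists b, (c - b); split; last 2 first.
- by exists 0; rewrite scale0r addr0.
- by exists 1; rewrite scale1r subrKC.
have [x0|x0] := eqVneq ((c - b) 0 0) 0.
  have y0 : (c - b) 0 1 != 0.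
    apply: contraNneq cb => y0; rewrite -subr_eq0; apply/eqP; apply: row2P; rewrite ?x0 ?y0 mxE//.
  exists ((a - b) 0 1 / (c - b) 0 1); apply: row2P.
    move: cr; rewrite /cross x0 mul0r sub0r => /eqP; rewrite oppr_eq0 mulf_eq0 (negbTE y0)/=.
    rewrite mxE => /eqP ab; rewrite !mxE in x0 *; rewrite !mxE in ab; rewrite x0 mulr0 addr0; lra.
  by rewrite [in RHS]mxE [X in _ + X]mxE divfK// !mxE; ring.
exists ((a - b) 0 0 / (c - b) 0 0); apply: row2P.
  by rewrite [in RHS]mxE [X in _ + X]mxE divfK// !mxE; ring.
rewrite [in RHS]mxE [X in _ + X]mxE.
have -> : (a - b) 0 0 / (c - b) 0 0 * (c - b) 0 1 = (a - b) 0 1.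
  apply: (mulIf x0); rewrite mulrAC divfK//.
  by move: cr; rewrite /cross; lra.
by rewrite !mxE; ring.
Qed.

Lemma aligned12 (a b : 'rV[R]_2) : aligned a b b.
Proof.
exists a, (b - a); split; first by exists 0; rewrite scale0r addr0.
- by exists 1; rewrite scale1r subrKC.
- by exists 1; rewrite scale1r subrKC.
Qed.

Lemma closure_normP (A : set 'rV[R]_2) x :
  closure A x <-> forall e, 0 < e -> exists2 y, A y & `|x - y| < e.
Proof.
split=> [clA e e0|H B /nbhs_ballP[e /= e0 eB]].
  have [y [Ay By]] := clA _ (nbhsx_ballx x e e0).
  by exists y => //; move: By; rewrite mx_norm_ball.
have [y Ay xy] := H _ e0; exists y; split => //; apply: eB.
by rewrite mx_norm_ball.
Qed.

Lemma closure_convex (A : set 'rV[R]_2) x y t :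
  convex_set (A : set (convex_lmodType 'rV[R]_2)) ->
  closure A x -> closure A y -> 0 <= t <= 1 -> closure A (x + t *: (y - x)).
Proof.
move=> cA /closure_normP clx /closure_normP cly t01.
apply/closure_normP => e e0.
have [x' Ax' xx'] := clx _ e0; have [y' Ay' yy'] := cly _ e0.
have /andP[t0 t1] := t01.
exists (x' + t *: (y' - x')).
  have := @cA y' x' (Itv01 t0 t1) (mem_set Ay') (mem_set Ax').
  rewrite inE; congr (A _); rewrite /conv/= [LHS](_ : _ = t *: y' + (1 - t) *: x')//.
  by apply/rowP => i; rewrite !mxE; ring.
have -> : x + t *: (y - x) - (x' + t *: (y' - x')) =
    (1 - t) *: (x - x') + t *: (y - y').
  by apply/rowP => i; rewrite !mxE; ring.
apply: le_lt_trans (ler_normD _ _) _; rewrite !normrZ (ger0_norm t0) ger0_norm ?subr_ge0//.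
(* The strict inequality comes from the weight 1 - t of the first term, which vanishes at t = 1. *)
have [t1'|t1'] := ltP t 1.
  have : 0 < (1 - t) * (e - `|x - x'|) by rewrite mulr_gt0// subr_gt0.
  have : 0 <= t * (e - `|y - y'|) by rewrite mulr_ge0// subr_ge0 ltW.
  lra.
have -> : t = 1 by lra.
by rewrite subrr mul0r add0r mul1r.
Qed.

End plane.

(** * Polygonal domains *)

Section polygon.
Context {R : realType} (Omega : set 'rV[R]_2) (N : nat) (nu n : 'I_N -> 'rV[R]_2).
Hypothesis cvxO : convex_domain Omega.
Hypothesis polO : polygonal_boundary Omega nu.
Hypothesis outn : outward_normals Omega nu n.
Implicit Types (x y z v w : 'rV[R]_2).

Let oO : open Omega. Proof. by have [] := cvxO. Qed.

Let clO_convex x y t : closure Omega x -> closure Omega y -> 0 <= t <= 1 ->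
  closure Omega (x + t *: (y - x)).
Proof. by apply: closure_convex; have [] := cvxO. Qed.

Let n1 j : enorm (n j) = 1. Proof. by have [] := outn j. Qed.

Let n_edge j : dot (nu (ordS j) - nu j) (n j) = 0.
Proof. by have [_ + _] := outn j; rewrite dotC. Qed.

Let edge_neq0 j : nu (ordS j) - nu j != 0.
Proof.
rewrite subr_eq0; apply/eqP => e; have [_ _ /(_ j)] := polO; apply.
by rewrite e; exact: aligned12.
Qed.

Let edge_closure j x : closed_segment (nu j) (nu (ordS j)) x -> closure Omega x.
Proof.
move=> xj; have [_ bE _] := polO.
have : boundary Omega x by rewrite bE; exists j.
by case.
Qed.

Let vertex_closure j : closure Omega (nu j).
Proof.
apply: (@edge_closure j); exists 0; last by rewrite scale0r addr0.
by rewrite /= in_itv/= lexx ler01.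
Qed.

(** Were x strictly beyond the line of edge j, the convex hull of x and the edge would contain the
    points m + t n_j above the midpoint m for small t, which the outward normal forbids. *)
Lemma closure_halfplane j x : closure Omega x -> dot (x - nu j) (n j) <= 0.
Proof.
move=> clx; rewrite leNgt; apply/negP => d0.
have [_ _ out] := outn j.
set e := nu (ordS j) - nu j; pose m := nu j + 2^-1 *: e.
have mj : open_segment (nu j) (nu (ordS j)) m.
  by exists 2^-1 => //; rewrite /= in_itv/=; apply/andP; split; lra.
set d := dot (x - nu j) (n j) in d0.
pose l := dot e (perp (n j)).
have eE : e = l *: perp (n j).
  by rewrite [LHS](unit_decomp e (n1 j)) n_edge scale0r add0r.
have l0 : l != 0 by apply: contraNneq (edge_neq0 j) => l0; rewrite -/e eE l0 scale0r.
pose k := dot (x - m) (perp (n j)) / l.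
have xmE : x - m = d *: n j + k *: e.
  rewrite [LHS](unit_decomp (x - m) (n1 j)); congr (_ *: _ + _).
    by rewrite /m opprD addrA dotBl dotZl n_edge mulr0 subr0.
  by rewrite eE scalerA divfK.
have H := out m mj.
have near0 : \forall t \near 0^'+, t / d <= 2^-1 /\ `|t / d * k| <= 4^-1.
  have tend : t / d @[t --> 0^'+] --> 0.
    rewrite -[X in _ --> X](mul0r d^-1); apply: cvgM; last exact: cvg_cst.
    by apply: cvg_within_filter; exact: cvg_id.
  have h1 : \forall t \near 0^'+, `|t / d| <= 2^-1.
    by apply: cvgr0_norm_le tend _ _; rewrite invr_gt0.
  have tend2 : t / d * k @[t --> 0^'+] --> 0.
    by rewrite -[X in _ --> X](mul0r k); apply: cvgM => //; exact: cvg_cst.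
  have h2 : \forall t \near 0^'+, `|t / d * k| <= 4^-1.
    by apply: cvgr0_norm_le tend2 _ _; rewrite invr_gt0.
  by apply: filterS2 h1 h2 => t h1 h2; split => //; apply: le_trans h1; exact: ler_norm.
have [t [[nclt [td tk]] t0]] : exists t, (~ closure Omega (m + t *: n j) /\
    (t / d <= 2^-1 /\ `|t / d * k| <= 4^-1)) /\ 0 < t.
  apply: (@filter_ex _ (0 : R)^'+); apply: filterI.
    exact: filterI H near0.
  exact: nbhs_right_gt.
apply: nclt; pose s := t / d.
have s0 : 0 < s by rewrite divr_gt0.
(* Chosen so that the point of the segment from [nu j + r *: e] to x with parameter s is exactly
   [m + t *: n j]; the bounds on s and s k keep r in [0, 1]. *)
pose r := 2^-1 - s * k / (1 - s).
have r01 : 0 <= r <= 1.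
  have s1 : 0 < 1 - s by rewrite -/s in td; lra.
  have : `|s * k / (1 - s)| <= 2^-1.
    rewrite normrM normfV (gtr0_norm s1) ler_pdivrMr//; rewrite -/s in td tk.
    by apply: le_trans tk _; lra.
  by rewrite /r ler_norml => /andP[? ?]; apply/andP; split; lra.
have clr : closure Omega (nu j + r *: e).
  by apply: (@edge_closure j); exists r => //=; rewrite in_itv.
have s01 : 0 <= s <= 1 by rewrite ltW//=; rewrite -/s in td; lra.
have := clO_convex clr clx s01; congr (closure Omega _).
have -> : x = m + (x - m) by rewrite addrC subrK.
rewrite xmE /m; have -> : t = s * d by rewrite divfK// gt_eqF.
have s1 : 1 - s != 0 by rewrite -/s in td; rewrite gt_eqF//; lra.
apply/rowP => i; rewrite !mxE /r; field.
by [].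
Qed.

(** A point of the open set lying on the line could be pushed along the normal to the wrong side. *)
Lemma domain_halfplane j x : Omega x -> dot (x - nu j) (n j) < 0.
Proof.
move=> Ox; rewrite lt_neqAle closure_halfplane ?andbT; last exact: subset_closure.
apply/eqP => d0.
have /nbhs_ballP[e /= e0 eO] := open_nbhs_nbhs (conj oO Ox).
pose c := e / 2 / (`|n j| + 1).
have n0 : 0 < `|n j| + 1 by rewrite ltr_wpDl.
have c0 : 0 < c by rewrite !divr_gt0.
have Oc : Omega (x + c *: n j).
  apply: eO; rewrite -ball_normE/= opprD addNKr normrN normrZ (gtr0_norm c0).
  rewrite /c mulrAC ltr_pdivrMr//.
  have : 0 <= `|n j| by []. nra.
have := @closure_halfplane j _ (subset_closure Oc).
rewrite addrAC dotDl d0 add0r dotZl (dot_unit (n1 j)) mulr1.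
by rewrite leNgt c0.
Qed.

Let O_interior : Omega° = Omega. Proof. exact/interior_id/oO. Qed.

Let dot_edge j x : closed_segment (nu j) (nu (ordS j)) x -> dot (x - nu j) (n j) = 0.
Proof. by move=> [t _ <-]; rewrite addrAC subrr add0r dotZl n_edge mulr0. Qed.

(** On the way from an interior point p to x, a boundary point would lie on some edge; but before x
    is reached all half-plane inequalities are strict, because they are strict at p. *)
Lemma halfplanes_closure x : (forall k, dot (x - nu k) (n k) <= 0) -> closure Omega x.
Proof.
move=> xk; have [_ [p Op] _ _] := cvxO; have [_ bE _] := polO.
pose g (t : R) : 'rV[R]_2 := p + t *: (x - p).
have cg : continuous g.
  move=> t; apply: cvgD; first exact: cvg_cst.
  by apply: cvgZr_tmp; exact: cvg_id.
have inside t : 0 <= t < 1 -> closure Omega (g t) -> Omega (g t).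
  move=> /andP[t0 t1] clt; apply: contrapT => nO.
  have : boundary Omega (g t) by split=> //; rewrite O_interior.
  rewrite bE => -[k _ /dot_edge].
  have -> : g t - nu k = (1 - t) *: (p - nu k) + t *: (x - nu k).
    by apply/rowP => i; rewrite /g !mxE; ring.
  rewrite dotDl !dotZl.
  have := domain_halfplane k Op; have := xk k; nra.
(* The parameters in [0, 1[ whose point is in [Omega] form a nonempty open and closed subset, hence
   all of [0, 1[. *)
have : connected `[0, (1 : R)[ by apply/connected_intervalP; exact: interval_is_interval.
move=> /(_ (`[0, 1[ `&` g @^-1` Omega)) H.
have {}H : `[0, 1[ `&` g @^-1` Omega = `[0, 1[%classic.
  apply: H.
  - by exists 0; split; rewrite /= ?in_itv/= ?lexx ?ltr01// /g scale0r addr0.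
  - exists (g @^-1` Omega) => //; apply: open_comp => // t _; exact: cg.
  - exists (g @^-1` (closure Omega)).
      by apply: closed_comp => [t _|]; [exact: cg|exact: closed_closure].
    apply/seteqP; split => t [tI]; first by move=> Ot; split => //; exact: subset_closure.
    by move=> ct; split => //; apply: inside => //; move: tI; rewrite /= in_itv.

apply: contrapT => nx.
have : \forall t \near (1 : R), ~ closure Omega (g t).
  have : \forall y \near g 1, ~ closure Omega y.
    have -> : g 1 = x by rewrite /g scale1r subrKC.
    have oC : open (~` closure Omega) by apply: closed_openC; exact: closed_closure.
    exact: (open_nbhs_nbhs (conj oC nx)).
  exact: (cg 1).
move=> /nbhs_ballP[e /= e0 eO].
pose t := 1 - Num.min (e / 2) 1.
have m0 : 0 < Num.min (e / 2) 1 by rewrite lt_min divr_gt0/=.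
have m1 : Num.min (e / 2) 1 <= 1 by rewrite ge_min lexx orbT.
have me : Num.min (e / 2) 1 <= e / 2 by rewrite ge_min lexx.
apply: (eO t).
  by rewrite -ball_normE/= /t subKr gtr0_norm//; lra.
apply: subset_closure.
have : `[0, 1[%classic t by rewrite /= in_itv/= /t; apply/andP; split; lra.
by rewrite -H => -[_].
Qed.

Definition active y k := dot (y - nu k) (n k) = 0.

(** The walls about which the assumptions on [Theta] speak at y. They are active, but [active] only
    says that y is on the line of wall k, possibly outside edge k; [corner_frame] shows that the
    active walls bring no further normal. *)
Definition listed y k := open_segment (nu k) (nu (ordS k)) y \/
  exists2 j, y = nu j & k = ord_pred j \/ k = j.

Let active_dot y z k : active y k -> dot (z - nu k) (n k) = dot (z - y) (n k).
Proof. by rewrite /active !dotBl => yk; lra. Qed.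

Lemma listed_active y k : listed y k -> active y k.
Proof.
move=> [[t t01 <-]|[j -> [->|->]]].
- apply: dot_edge; exists t => //; move: t01; rewrite /= !in_itv/= => /andP[? ?].
  by rewrite !ltW.
- by rewrite /active; have := n_edge (ord_pred j); rewrite ord_predK.
- by rewrite /active subrr dot2E !mxE; ring.
Qed.

(** The direction of the edge determines the unit normal up to sign, and an interior point, strictly
    inside both half-planes, excludes the opposite sign. *)
Let same_normal j k : dot (nu (ordS j) - nu j) (n k) = 0 -> active (nu j) k -> n k = n j.
Proof.
move=> ek ak; have [_ [p Op] _ _] := cvxO.
have [//|nkj] := unit_orthogonal (n1 j) (n1 k) (edge_neq0 j) (n_edge j) ek.
have := domain_halfplane j Op; have := domain_halfplane k Op.
by rewrite (active_dot p ak) nkj dotNr oppr_lt0 => /lt_trans/[apply]; rewrite ltxx.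
Qed.

(** Both ends of the edge satisfy the inequality of wall k, and a strict convex combination of them
    attains equality, so both ends do. *)
Let active_edge j y k : open_segment (nu j) (nu (ordS j)) y -> active y k -> n k = n j.
Proof.
move=> [t]; rewrite /= in_itv/= => /andP[t0 t1] <- yk.
have h1 := closure_halfplane k (@vertex_closure j).
have h2 := closure_halfplane k (@vertex_closure (ordS j)).
move: yk; rewrite /active.
have -> : nu j + t *: (nu (ordS j) - nu j) - nu k =
  (1 - t) *: (nu j - nu k) + t *: (nu (ordS j) - nu k).
  by apply/rowP => i; rewrite !mxE; ring.
rewrite dotDl !dotZl => h3.
have e1 : dot (nu j - nu k) (n k) = 0 by nra.
have e2 : dot (nu (ordS j) - nu k) (n k) = 0 by nra.
by apply: same_normal => //; rewrite -(active_dot _ e1).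
Qed.

Let corner_cross j :
  cross (nu (ordS j) - nu j) (nu (ord_pred j) - nu j) != 0.
Proof.
apply/eqP => c0; have [_ _ /(_ j)] := polO; apply.
by apply: aligned_cross => //; rewrite -subr_eq0 edge_neq0.
Qed.

Let dot_pred j : dot (nu (ord_pred j) - nu j) (n (ord_pred j)) = 0.
Proof.
have := n_edge (ord_pred j); rewrite ord_predK => h.
by rewrite -opprB dotNl h oppr0.
Qed.

Let cross_orthogonal u v w : w != 0 -> dot u w = 0 -> dot v w = 0 -> cross u v = 0.
Proof.
move=> w0; rewrite !dot2E /cross => uw vw.
have [x0|x0] := eqVneq (w 0 0) 0.
  have y0 : w 0 1 != 0.
    by apply: contraNneq w0 => y0; apply/eqP; apply: row2P; rewrite mxE.
  apply: (mulIf y0); rewrite mul0r.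
  transitivity (u 0 0 * (v 0 0 * w 0 0 + v 0 1 * w 0 1) -
    v 0 0 * (u 0 0 * w 0 0 + u 0 1 * w 0 1)); first by ring.
  by rewrite uw vw !mulr0 subrr.
apply: (mulIf x0); rewrite mul0r.
transitivity (v 0 1 * (u 0 0 * w 0 0 + u 0 1 * w 0 1) -
  u 0 1 * (v 0 0 * w 0 0 + v 0 1 * w 0 1)); first by ring.
by rewrite uw vw !mulr0 subrr.
Qed.

Let n_neq0 j : n j != 0.
Proof.
apply/eqP => h; have := dot_unit (n1 j); rewrite h dot2E !mxE => /eqP.
by rewrite mulr0 addr0 eq_sym oner_eq0.
Qed.

(** A vector v along edge k, issued from the vertex, has nonnegative coordinates on the two edges e
    and f of the corner. As e and f have nonpositive products with the normal of k while v has
    product 0, an edge with positive coordinate is orthogonal to that normal. *)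
Let active_vertex j k : active (nu j) k -> n k = n (ord_pred j) \/ n k = n j.
Proof.
move=> ak.
set e := nu (ordS j) - nu j; set f := nu (ord_pred j) - nu j.
have c0 : cross e f != 0 := corner_cross j.
(* The vector goes from the vertex to an end of edge k different from it. *)
have [v [v0 vk [v1 v2]]] : exists v, [/\ v != 0, dot v (n k) = 0 &
    dot v (n j) <= 0 /\ dot v (n (ord_pred j)) <= 0].
  have pj : active (nu j) (ord_pred j) by apply: listed_active; right; exists j => //; left.
    have W i : nu i != nu j -> dot (nu i - nu k) (n k) = 0 ->
      exists v, [/\ v != 0, dot v (n k) = 0 & dot v (n j) <= 0 /\ dot v (n (ord_pred j)) <= 0].
    move=> ij ik; exists (nu i - nu j); split; first by rewrite subr_eq0.
      by rewrite -(active_dot _ ak).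
    by rewrite -(active_dot _ pj); split; exact/closure_halfplane/vertex_closure.
  have [kj|kj] := eqVneq (nu k) (nu j); last by apply: (W k kj); rewrite subrr dot2E !mxE; ring.
  by apply: (W (ordS k)); [rewrite -kj -subr_eq0 edge_neq0|exact: n_edge].
have ek : dot e (n k) <= 0 by rewrite -(active_dot _ ak); exact/closure_halfplane/vertex_closure.
have fk : dot f (n k) <= 0 by rewrite -(active_dot _ ak); exact/closure_halfplane/vertex_closure.
have pj : active (nu j) (ord_pred j) by apply: listed_active; right; exists j => //; left.
have fj : dot f (n j) < 0.
  rewrite lt_neqAle closure_halfplane ?andbT; last exact: vertex_closure.
  apply: contraNneq c0 => fj.
  by apply/eqP; apply: (cross_orthogonal (n_neq0 j)) => //; exact: n_edge.
have ep : dot e (n (ord_pred j)) < 0.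
  rewrite lt_neqAle -(active_dot _ pj) closure_halfplane ?andbT; last exact: vertex_closure.
  rewrite (active_dot _ pj); apply: contraNneq c0 => epj.
  by apply/eqP; apply: (cross_orthogonal (n_neq0 (ord_pred j))) => //; exact: dot_pred.
have vE := cross_decomp v c0; move: vE.
set al := _ / _; set be := _ / _ => vE.
have be0 : 0 <= be.
  move: v1; rewrite vE dotDl !dotZl n_edge mulr0 add0r; nra.
have al0 : 0 <= al.
  move: v2; rewrite vE dotDl !dotZl dot_pred mulr0 addr0; nra.
move: vk; rewrite vE dotDl !dotZl => vk.
have [al00|al00] := eqVneq al 0; last first.
  right; apply: same_normal => //.
  have : 0 < al by rewrite lt_neqAle eq_sym al00.
  by rewrite -/e => al1; nra.
left; have be1 : 0 < be.
  rewrite lt_neqAle be0 andbT; apply: contraNneq v0 => be00.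
  by rewrite vE al00 -be00 !scale0r addr0.
have fk0 : dot f (n k) = 0 by move: vk; rewrite al00 mul0r add0r; nra.
apply: same_normal.
  by rewrite ord_predK -opprB dotNl -/f fk0 oppr0.
by rewrite /active (active_dot _ ak).
Qed.

(* A vector of the frame which is not an active normal only completes the basis. *)
Lemma corner_frame y : closure Omega y -> exists m1 m2,
  [/\ cross m1 m2 != 0, (forall k, active y k -> n k = m1 \/ n k = m2) &
   forall m, m = m1 \/ m = m2 ->
     (exists2 k, listed y k & m = n k) \/ (forall k, active y k -> n k <> m)].
Proof.
move=> cly; have [Oy|nOy] := pselect (Omega y).
  have noact k : ~ active y k.
    by move=> yk; have := domain_halfplane k Oy; rewrite yk ltxx.
  pose d1 : 'rV[R]_2 := \row_(k < 2) (k == 0)%:R.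
  exists d1, (perp d1); split.
  - by rewrite /cross perp0 perp1 !mxE/= mulr1 oppr0 mulr0 subr0 oner_neq0.
  - by move=> k /noact.
  - by move=> m _; right => k /noact.
have : boundary Omega y by split=> //; rewrite O_interior.
have [_ bE _] := polO; rewrite bE => -[j _ yj].
have vcase i : y = nu i -> exists m1 m2,
  [/\ cross m1 m2 != 0, (forall k, active y k -> n k = m1 \/ n k = m2) &
   forall m, m = m1 \/ m = m2 ->
     (exists2 k, listed y k & m = n k) \/ (forall k, active y k -> n k <> m)].
  move=> yi; exists (n (ord_pred i)), (n i); split.
  (* If the two normals were parallel, both edges at the vertex would be orthogonal to the same
     vector, hence parallel to each other. *)
  - apply: contraNneq (corner_cross i) => c0.
    have := unit_decomp (n (ord_pred i)) (n1 i).
    have -> : dot (n (ord_pred i)) (perp (n i)) = 0.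
      by move: c0; rewrite dot2E perp0 perp1 /cross; lra.
    rewrite scale0r addr0 => nE.
    apply/eqP; apply: (cross_orthogonal (n_neq0 (ord_pred i))); last exact: dot_pred.
    by rewrite nE dotC dotZl [dot (n i) (_ - _)]dotC n_edge mulr0.
  - by move=> k; rewrite yi; exact: active_vertex.
  - by move=> m [->|->]; left; [exists (ord_pred i)|exists i] => //; right; exists i; auto.
case: yj => t; rewrite /= in_itv/= => /andP[t0 t1] yE.
have [t00|t00] := eqVneq t 0; first by apply: (vcase j); rewrite -yE t00 scale0r addr0.
have [t11|t11] := eqVneq t 1; first by apply: (vcase (ordS j)); rewrite -yE t11 scale1r subrKC.
have yj : open_segment (nu j) (nu (ordS j)) y.
  by exists t => //; rewrite /= in_itv/= !lt_neqAle t0 t1 t11 eq_sym t00.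
exists (n j), (perp (n j)); split.
- have := dot_unit (n1 j); rewrite dot2E /cross perp0 perp1 => h.
  by rewrite (_ : _ - _ = 1) ?oner_neq0//; lra.
- by move=> k /(active_edge yj); left.
- move=> m [->|->]; first by left; exists j => //; left.
  right => k /(active_edge yj) -> h.
  by have := dot_unit (n1 j); rewrite {2}h dot_perp => /eqP; rewrite eq_sym oner_eq0.
Qed.

(** Inactive walls leave room for a short time by continuity, and there are finitely many walls. *)
Lemma tangent_cone_active y w : closure Omega y ->
  (forall k, active y k -> dot w (n k) <= 0) -> tangent_cone Omega y w.
Proof.
move=> cly yw.
have H : \forall t \near 0^'+, forall k, dot (y + t *: w - nu k) (n k) <= 0.
  apply: filter_forall => k; have := closure_halfplane k cly.
  rewrite le_eqVlt => /orP[/eqP yk|yk].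
    near=> t; rewrite addrAC dotDl yk add0r dotZl pmulr_rle0; first exact: yw.
    by near: t; exact: nbhs_right_gt.
  have : dot (y - nu k) (n k) + t * dot w (n k) @[t --> 0^'+] --> dot (y - nu k) (n k) + 0 * dot w (n k).
    apply: cvgD; first exact: cvg_cst.
    apply: cvgM; last exact: cvg_cst.
    by apply: cvg_within_filter; exact: cvg_id.
  rewrite mul0r addr0 => cv.
  near=> t; rewrite addrAC dotDl dotZl; apply/ltW; near: t.
  exact: (cvgr_lt _ cv _ yk).
apply: filterS H => t; exact: halfplanes_closure.
Unshelve. all: by end_near. Qed.

End polygon.

(** * Curves and one-sided derivatives *)

Section curves.
Context {R : realType} (T : R).
Hypothesis T0 : 0 < T.
Implicit Types (f g : R -> 'rV[R]_2) (u v : 'rV[R]_2).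

Lemma row_norm_le u (e : R) : 0 <= e -> `|u| <= e <-> forall k, `|u 0 k| <= e.
Proof.
have E : `|u| = \big[Num.max/0]_ij `|u ij.1 ij.2| := mx_normrE u.
move=> e0; rewrite E; split=> [ue k|uk].
  by apply: le_trans ue; exact: (le_bigmax _ _ (0, k)).
by apply: bigmax_le => // -[i k] _ /=; rewrite (ord1 i).
Qed.

Lemma le_coord_norm u k : `|u 0 k| <= `|u|.
Proof. by have /row_norm_le : 0 <= `|u| by []; move=> /(_ u)[+ _]; exact. Qed.

Lemma cvg_rowP (S : Type) (F : set_system S) (FF : Filter F) (h : S -> 'rV[R]_2) u :
  h x @[x --> F] --> u <-> forall k, h x 0 k @[x --> F] --> u 0 k.
Proof.
split=> [hu k|hu].
  apply/cvgrPdist_le => e e0; move/cvgrPdist_le : hu => /(_ _ e0).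
  apply: filterS => x /(row_norm_le _ (ltW e0))/(_ k).
  by rewrite !mxE.
apply/cvgrPdist_le => e e0.
have : \forall x \near F, forall k, `|u 0 k - h x 0 k| <= e.
  by apply: filter_forall => k; move/cvgrPdist_le : (hu k); exact.
by apply: filterS => x H; apply/row_norm_le => [|k]; [exact: ltW|rewrite !mxE].
Qed.

Lemma has_derivative_within_coord f s v : has_derivative_within `[0, T] f s v <->
  forall k, (t - s)^-1 * (f t 0 k - f s 0 k) @[t --> within `[0, T] s^'] --> v 0 k.
Proof.
have E k : (fun t => (t - s)^-1 * (f t 0 k - f s 0 k)) =
    (fun t => ((t - s)^-1 *: (f t - f s)) 0 k).
  by apply/funext => t; rewrite !mxE.
rewrite /has_derivative_within; split=> [/cvg_rowP H k|H].
  by rewrite E; exact: H.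
by apply/cvg_rowP => k; rewrite -E; exact: H.
Qed.

Lemma has_derivative_withinD f g s u v :
  has_derivative_within `[0, T] f s u -> has_derivative_within `[0, T] g s v ->
  has_derivative_within `[0, T] (fun t => f t + g t) s (u + v).
Proof.
move=> fu gv; rewrite /has_derivative_within.
rewrite (_ : (fun t => _) = fun t => (t - s)^-1 *: (f t - f s) + (t - s)^-1 *: (g t - g s)).
  exact: cvgD.
by apply/funext => t; rewrite opprD addrACA scalerDr.
Qed.

Lemma is_derive_within f s v : (forall k, is_derive s (1 : R) (fun t => f t 0 k) (v 0 k)) ->
  has_derivative_within `[0, T] f s v.
Proof.
move=> df; apply/has_derivative_within_coord => k.
have [dfk Dfk] := df k.
have : h^-1 * (f (h + s) 0 k - f s 0 k) @[h --> 0^'] --> v 0 k.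
  rewrite -Dfk -derive1E /derive1; move/derivable_dq : dfk; exact: id.
move/cvgrPdist_le => H; apply/cvgrPdist_le => e /H[/= d d0 {}H].
exists d => //= t; rewrite /ball_/= => st ts _.
have := H (t - s); rewrite /ball_/= sub0r normrN distrC => /(_ st).
by rewrite subrK subr_eq0; exact.
Qed.

Lemma within_itv_dnbhs (P : R -> Prop) s : 0 < s < T ->
  (\forall t \near within `[0, T] s^', P t) -> \forall t \near s^', P t.
Proof.
move=> sT [d /= d0 H].
have [e /= e0 eT] := near_itv_oo sT.
exists (Num.min d e); first by rewrite /= lt_min d0.
move=> t /=; rewrite lt_min => /andP[td te] ts; apply: H => //.
by have /andP[? ?] := eT _ te; rewrite in_itv/= !ltW.
Qed.

Lemma has_derivative_within_is_derive f s v k : 0 < s < T ->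
  has_derivative_within `[0, T] f s v -> is_derive s (1 : R) (fun t => f t 0 k) (v 0 k).
Proof.
move=> sT /has_derivative_within_coord/(_ k)/cvgrPdist_le H.
have cv : h^-1 *: (((fun t => f t 0 k) \o shift s) (h *: (1 : R)) - f s 0 k) @[h --> 0^'] --> v 0 k.
  apply/cvgrPdist_le => e /H /(within_itv_dnbhs sT)[/= d d0 {}H].
  exists d => //= h; rewrite /ball_/= sub0r normrN => hd h0.
  have := H (h + s); rewrite /ball_/= opprD addrCA subrr addr0 normrN => /(_ hd).
  by rewrite addrK /GRing.scale/= mulr1; apply; rewrite -subr_eq0 addrK.
by apply: DeriveDef; [apply/cvg_ex; exists (v 0 k)|exact: cvg_lim].
Qed.

Lemma within_continuous_rowP f (A : set R) : {within A, continuous f} <->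
  forall k, {within A, continuous (fun t => f t 0 k)}.
Proof.
split=> [cf k s|cf s]; first by move/cvg_rowP : (cf s); exact.
by apply/cvg_rowP => k; exact: cf.
Qed.

Lemma AC_on_continuous f : AC_on T f -> {within `[0, T], continuous f}.
Proof.
move=> acf; apply/within_continuous_rowP => k.
have := abs_cont_clamp_continuous T0 (AC_on_abs_cont k acf).
move=> /continuous_subspaceT /= H.
apply: (@subspace_eq_continuous _ `[0, T] _ ((fun s => f s 0 k) \o clamp T)) => //.
by move=> s; rewrite inE/= => sT; rewrite clamp_id.
Qed.

Lemma has_derivative_within_continuous f (df : R -> 'rV[R]_2) :
  (forall s, s \in `[0, T] -> has_derivative_within `[0, T] f s (df s)) ->
  {within `[0, T], continuous f}.
Proof.
move=> fd; apply/within_continuous_rowP => k.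
apply/subspace_continuousP => s sT.
have /has_derivative_within_coord/(_ k) := fd s sT.
move/cvgrPdist_le => /(_ _ ltr01)[/= d d0 H].
apply/cvgrPdist_le => e e0.
pose M := `|df s 0 k| + 1.
have M0 : 0 < M by rewrite ltr_wpDl.
exists (Num.min d (e / M)); first by rewrite /= lt_min d0 divr_gt0.
move=> t /=; rewrite lt_min => /andP[td te] tT.
have [->|ts] := eqVneq t s; first by rewrite subrr normr0 ltW.
have ts0 : t - s != 0 by rewrite subr_eq0.
have -> : f s 0 k - f t 0 k = (s - t) * ((t - s)^-1 * (f t 0 k - f s 0 k)) by field.
have QM : `|(t - s)^-1 * (f t 0 k - f s 0 k)| <= M.
  have := H t td ts tT; rewrite distrC => HQ.
  rewrite -[X in `|X|](subrK (df s 0 k)) addrC; apply: le_trans (ler_normD _ _) _.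
  by rewrite lerD2l.
rewrite normrM; apply: (@le_trans _ _ (`|s - t| * M)); first by rewrite ler_wpM2l.
by rewrite -ler_pdivlMr// ltW.
Qed.

Lemma uniform_normP (f_ : nat -> R -> 'rV[R]_2) f (A : set R) :
  {uniform A, f_ @ \oo --> f} <->
  forall e, 0 < e -> \forall i \near \oo, forall s, A s -> `|f s - f_ i s| < e.
Proof.
split=> [H e e0|H].
  have : nbhs (f : {uniform` A -> 'rV[R]_2}) [set h | forall s, A s -> `|f s - h s| < e].
    apply/uniform_nbhs; exists [set xy | ball xy.1 e xy.2]; split.
      by rewrite -entourage_from_ballE; exists e.
    by move=> h /= H' s As; have := H' s As; rewrite -ball_normE.
  by move/H.
move=> P /uniform_nbhs[E [+ EP]].
rewrite -entourage_from_ballE => -[e /= e0 eE].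
apply: filterS (H e e0) => i fi; apply: EP => s As; apply: eE.
by rewrite /= -ball_normE; exact: fi.
Qed.

Lemma MVT_within f g s t k :
  (forall r, r \in `[0, T] -> has_derivative_within `[0, T] f r (g r)) ->
  s \in `[0, T] -> t \in `[0, T] -> exists c, [/\ c \in `[0, T], `|s - c| <= `|s - t| &
    f t 0 k - f s 0 k = g c 0 k * (t - s)].
Proof.
move=> fg sT tT.
have H x y : x \in `[0, T] -> y \in `[0, T] -> x <= y ->
    exists2 c, c \in `[x, y] & f y 0 k - f x 0 k = g c 0 k * (y - x).
  rewrite !in_itv/= => /andP[x0 xT] /andP[y0 yT] xy.
  apply: (@MVT_segment _ (fun t => f t 0 k) (fun t => g t 0 k)) => //.
    move=> r; rewrite in_itv/= => /andP[xr ry].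
    have r01 : 0 < r < T by rewrite (le_lt_trans x0)//= (lt_le_trans ry).
    have rT : r \in `[0, T] by rewrite in_itv/= !ltW//; case/andP : r01.
    exact: has_derivative_within_is_derive r01 (fg r rT).
  have := (within_continuous_rowP _ _).1 (has_derivative_within_continuous fg) k.
  apply: continuous_subspaceW.
  by apply: subset_itv; rewrite bnd_simp.
have [st|/ltW ts] := leP s t.
  have [c] := H _ _ sT tT st; rewrite in_itv/= => /andP[sc ct] E; exists c; split => //.
    move: sT tT; rewrite !in_itv/= => /andP[s0 _] /andP[_ tT].
    by rewrite (le_trans s0)// (le_trans ct).
  by rewrite distrC (distrC s) !ger0_norm ?subr_ge0// lerD2r.
have [c] := H _ _ tT sT ts; rewrite in_itv/= => /andP[tc cs] E; exists c; split => //.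
- move: sT tT; rewrite !in_itv/= => /andP[_ sT] /andP[t0 _].
  by rewrite (le_trans t0)// (le_trans cs).
- by rewrite !ger0_norm ?subr_ge0// lerD2l lerN2.
- by rewrite -opprB E -mulrN opprB.
Qed.

(** The mean value theorem for the i-th curve replaces its difference quotient by a value of g_i
    near s, within 2 e / 3 of g s for all large i; the bound then passes to the limit in i. It is
    applied per coordinate, the intermediate point depending on the coordinate. *)
Lemma has_derivative_within_uniform_limit (f_ g_ : nat -> R -> 'rV[R]_2) f g :
  (forall i s, s \in `[0, T] -> has_derivative_within `[0, T] (f_ i) s (g_ i s)) ->
  (forall i, {within `[0, T], continuous (g_ i)}) ->
  {within `[0, T], continuous g} ->
  {uniform `[0, T], f_ @ \oo --> f} -> {uniform `[0, T], g_ @ \oo --> g} ->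
  forall s, s \in `[0, T] -> has_derivative_within `[0, T] f s (g s).
Proof.
move=> fg_ cg_ cg /uniform_normP ff /uniform_normP gg s sT.
apply/has_derivative_within_coord => k.
have cf_ i := has_derivative_within_continuous (fg_ i).
have ffk t : t \in `[0, T] -> f_ i t 0 k @[i --> \oo] --> f t 0 k.
  move=> tT; apply/cvgrPdist_lt => e /ff; apply: filterS => i /(_ t tT).
  by apply: le_lt_trans; have := le_coord_norm (f t - f_ i t) k; rewrite !mxE.
apply/cvgrPdist_le => e e0.
have e3 : 0 < e / 3 by rewrite divr_gt0.
have /subspace_continuousP/(_ s sT)/cvgrPdist_le/(_ _ e3)[/= d d0 gd] :=
  (within_continuous_rowP _ _).1 cg k.
exists d => //= t std ts tT.
have ts0 : t - s != 0 by rewrite subr_eq0.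
have tsn0 : 0 < `|t - s| by rewrite normr_gt0.
have -> : g s 0 k - (t - s)^-1 * (f t 0 k - f s 0 k) =
    (t - s)^-1 * (g s 0 k * (t - s) - (f t 0 k - f s 0 k)) by field.
rewrite normrM normfV mulrC ler_pdivrMr//.
have cv : `|g s 0 k * (t - s) - (f_ i t 0 k - f_ i s 0 k)| @[i --> \oo] -->
    `|g s 0 k * (t - s) - (f t 0 k - f s 0 k)|.
  apply: cvg_norm; apply: cvgB; first exact: cvg_cst.
  by apply: cvgB; exact: ffk.
apply: (cvgr_to_le cv); near=> i.
have gi : forall r, r \in `[0, T] -> `|g r - g_ i r| < e / 3.
  by near: i; exact: gg.
have [c [cT cs E]] : exists c, [/\ c \in `[0, T], `|s - c| <= `|s - t| &
    f_ i t 0 k - f_ i s 0 k = g_ i c 0 k * (t - s)].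
  exact: MVT_within (fg_ i) sT tT.
rewrite E -mulrBl normrM ler_pM2r//.
have -> : g s 0 k - g_ i c 0 k = (g s 0 k - g c 0 k) + (g c - g_ i c) 0 k.
  by rewrite !mxE; ring.
apply: le_trans (ler_normD _ _) _.
have h1 : `|g s 0 k - g c 0 k| <= e / 3 by apply: gd => //; exact: le_lt_trans std.
have h2 : `|(g c - g_ i c) 0 k| <= e / 3.
  by apply: le_trans (le_coord_norm _ _) _; apply/ltW/gi.
lra.
Unshelve. all: by end_near.
Qed.

End curves.

Section perturbation.
Context {R : realType} (T : R).
Hypothesis T0 : 0 < T.
Notation mu := (@lebesgue_measure R).

Lemma lipschitz_abs_cont (f : R -> R) (L : R) :
  (forall x y, x \in `[0, T] -> y \in `[0, T] -> `|f x - f y| <= L * `|x - y|) ->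
  abs_cont T f.
Proof.
move=> fL e e0; pose L1 := Num.max L 1.
have L10 : 0 < L1 by rewrite lt_max ltr01 orbT.
exists (e / L1); first by rewrite divr_gt0.
move=> I a b abT _; rewrite ltr_pdivlMr// => /le_lt_trans; apply.
rewrite mulr_suml; apply: ler_sum => i _; have [a0 [ab bT]] := abT i.
have aI : a i \in `[0, T] by rewrite in_itv/= a0 (le_trans ab).
have bI : b i \in `[0, T] by rewrite in_itv/= bT (le_trans a0).
apply: le_trans (fL _ _ bI aI) _; rewrite ger0_norm ?subr_ge0// mulrC.
by rewrite ler_wpM2l ?subr_ge0// le_max lexx.
Qed.

Lemma is_derive_abs_cont (f g : R -> R) :
  (forall x : R, is_derive x (1 : R) f (g x)) -> continuous g -> abs_cont T f.
Proof.
move=> dfg cg.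
have [c _ gc] : exists2 c, c \in `[0, T] & forall t, t \in `[0, T] -> `|g t| <= `|g c|.
  apply: (@EVT_max _ (fun t => `|g t|)); first exact: ltW.
  by apply: continuous_subspaceT => x; apply: cvg_norm; exact: cg.
apply: (@lipschitz_abs_cont _ `|g c|) => x y.
wlog xy : x y / x <= y => [W xT yT|xT yT].
  have [xy|/ltW yx] := leP x y; first exact: W.
  by rewrite distrC (distrC x); exact: W.
have [||d] := @MVT_segment _ f g x y.
- exact: xy.
- apply: derivable_within_continuous => z _; by have [] := dfg z.
- rewrite in_itv/= => /andP[xd dy] E; rewrite distrC E normrM (distrC x) ler_wpM2r//.
  apply: gc; move: xT yT; rewrite !in_itv/= => /andP[x0 _] /andP[_ yT].
  by rewrite (le_trans x0)// (le_trans dy).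
Qed.

(** The second derivative vanishes after time s, so its sup bound is integrated over a length s and
    not T. *)
Lemma Rintegral_ddbump_sqr_le s a c : 0 < s <= T ->
  \int[mu]_(t in `[0, T]) ddbump s a c t ^+ 2 <=
  ((6 * `|a| + 12 * `|c| * s) / s ^+ 2) ^+ 2 * s.
Proof.
move=> /andP[s0 sT]; set L := _ / _.
have L0 : 0 <= L.
  rewrite divr_ge0 ?exprn_ge0 ?(ltW s0)// addr_ge0// ?mulr_ge0// ?(ltW s0)//.
have iC (x y : R) : mu.-integrable `[x, y] (EFin \o (fun t => ddbump s a c t ^+ 2)).
  apply: continuous_compact_integrable; first exact: segment_compact.
  by apply: continuous_subspaceT => t; apply: cvg_sqr; exact: ddbump_continuous.
have := Rintegral_itv_split (iC 0 T) (ltW s0) sT (lexx _).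
have -> : \int[mu]_(x in `[s, T]) ddbump s a c x ^+ 2 = 0.
  transitivity (\int[mu]_(x in `[s, T]) (0 : R)).
    apply: eq_Rintegral => x; rewrite inE/= in_itv/= => /andP[sx _].
    by rewrite ddbump_after// expr0n.
  by rewrite Rintegral_cst_itv// mul0r.
move/eqP; rewrite subr_eq0 => /eqP ->.
apply: (@le_trans _ _ (\int[mu]_(x in `[0, s]) L ^+ 2)).
  apply: le_Rintegral => //.
    exact: (integrable_cst_itv 0 s (L ^+ 2)).
  move=> t /=; rewrite in_itv/= => /andP[t0 _].
  by rewrite -real_normK ?num_real// ler_pXn2r ?nnegrE//; exact: ddbump_bound.
by rewrite Rintegral_cst_itv ?(ltW s0)// subr0.
Qed.

Lemma right_derivative (f : R -> 'rV[R]_2) v k : has_derivative_within `[0, T] f 0 v ->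
  t^-1 * (f t 0 k - f 0 0 k) @[t --> 0^'+] --> v 0 k.
Proof.
move=> /has_derivative_within_coord/(_ k)/cvgrPdist_le H.
apply/cvgrPdist_le => e /H[/= d d0 {}H].
exists (Num.min d T); first by rewrite /= lt_min d0.
move=> t; rewrite /ball_/= sub0r normrN lt_min => /andP[td tT] t0.
have := H t; rewrite /ball_/= sub0r normrN subr0 => /(_ td); apply.
  by rewrite gt_eqF.
by rewrite in_itv/= (ltW t0)/= -(gtr0_norm t0) ltW.
Qed.

Lemma right_derivative_dot (f : R -> 'rV[R]_2) v u : has_derivative_within `[0, T] f 0 v ->
  t^-1 * dot (f t - f 0) u @[t --> 0^'+] --> dot v u.
Proof.
move=> fv; rewrite (_ : (fun t => _) =
    fun t => t^-1 * (f t 0 0 - f 0 0 0) * u 0 0 + t^-1 * (f t 0 1 - f 0 0 1) * u 0 1).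
  by rewrite dot2E; apply: cvgD; apply: cvgM; (exact: right_derivative||exact: cvg_cst).
by apply/funext => t; rewrite dot2E !mxE; ring.
Qed.

End perturbation.

(** * Recovery of competitors *)

Section recovery.
Context {R : realType} (T : R) (Omega : set 'rV[R]_2).
Hypothesis T0 : 0 < T.
Notation mu := (@lebesgue_measure R).

Definition C2_curve (d d' d'' : R -> 'rV[R]_2) :=
  forall k, [/\ forall t : R, is_derive t (1 : R) (fun s => d s 0 k) (d' t 0 k),
    forall t : R, is_derive t (1 : R) (fun s => d' s 0 k) (d'' t 0 k)
    & continuous (fun t => d'' t 0 k)].

Lemma Gamma_from_shift xi eta y w d d' d'' :
  Gamma_from Omega T y w (xi, eta) -> C2_curve d d' d'' ->
  (forall t, t \in `[0, T] -> closure Omega (xi t + d t)) ->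
  Gamma_from Omega T (y + d 0) (w + d' 0)
    (fun t => xi t + d t, fun t => eta t + d' t).
Proof.
move=> [[/= C1 AC D X] <- <-] C2 cl.
have dD t : t \in `[0, T] ->
    has_derivative_within `[0, T] (fun t => xi t + d t) t (eta t + d' t).
  move=> tT; apply: has_derivative_withinD; first exact: D.
  by apply: is_derive_within => k; have [] := C2 k.
have AC' : AC_on T (fun t => eta t + d' t).
  apply: abs_cont_AC_on => k.
  rewrite (_ : (fun s => _) = fun s => eta s 0 k + d' s 0 k).
    apply: abs_contD; first exact: AC_on_abs_cont.
    by have [_ h1 h2] := C2 k; exact: (is_derive_abs_cont T0 h1 h2).
  by apply/funext => s; rewrite mxE.
split=> //; split=> //=.
- exists (fun t => eta t + d' t); split; first exact: dD.
  exact: AC_on_continuous.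
- by move=> t tT; split => //=; exact: cl.
Qed.

Lemma Gamma_from_right_derivative xi eta y w u : Gamma_from Omega T y w (xi, eta) ->
  t^-1 * dot (xi t - y) u @[t --> 0^'+] --> dot w u.
Proof.
move=> [[/= _ _ D _] <- <-]; apply: (right_derivative_dot T0).
by apply: D; rewrite in_itv/= lexx ltW.
Qed.

Lemma near_right_itv (P : R -> Prop) : (\forall t \near 0^'+, P t) ->
  \forall e \near 0^'+, forall t : R, 0 < t <= e -> P t.
Proof.
move=> [e /= e0 H]; exists e => //= x; rewrite /ball_/= sub0r normrN => xe x0 t /andP[t0 tx].
by apply: H => //; rewrite /ball_/= sub0r normrN gtr0_norm// (le_lt_trans tx)// -(gtr0_norm x0).
Qed.

Lemma le_dot_norm (u v : 'rV[R]_2) : enorm v = 1 -> `|dot u v| <= 2 * `|u|.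
Proof.
move=> v1; have vk k : `|v 0 k| <= 1 by rewrite -v1; exact: le_coord_enorm.
rewrite dot2E; apply: le_trans (ler_normD _ _) _; rewrite !normrM mulr_natl mulr2n.
by apply: lerD; rewrite -[leRHS]mulr1; apply: ler_pM => //; exact: le_coord_norm.
Qed.

Lemma C2_curve_bump s1 a1 c1 s2 a2 c2 (e1 e2 : 'rV[R]_2) :
  C2_curve (fun t => bump s1 a1 c1 t *: e1 + bump s2 a2 c2 t *: e2)
    (fun t => dbump s1 a1 c1 t *: e1 + dbump s2 a2 c2 t *: e2)
    (fun t => ddbump s1 a1 c1 t *: e1 + ddbump s2 a2 c2 t *: e2).
Proof.
have comp (f1 f2 g1 g2 : R -> R) (t : R) k : is_derive t (1 : R) f1 (g1 t) ->
    is_derive t (1 : R) f2 (g2 t) ->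
    is_derive t (1 : R) (fun s => (f1 s *: e1 + f2 s *: e2) 0 k) ((g1 t *: e1 + g2 t *: e2) 0 k).
  move=> d1 d2; rewrite (_ : (fun s => _) = fun s => e1 0 k * f1 s + e2 0 k * f2 s).
    rewrite !mxE (mulrC (g1 t)) (mulrC (g2 t)).
    by apply: is_deriveD.
  by apply/funext => s; rewrite !mxE (mulrC (f1 s)) (mulrC (f2 s)).
move=> k; split=> [t|t|].
- by apply: comp; exact: is_derive_bump.
- by apply: comp; exact: is_derive_dbump.
- rewrite (_ : (fun t => _) = fun t => ddbump s1 a1 c1 t * e1 0 k + ddbump s2 a2 c2 t * e2 0 k).
    move=> t; apply: cvgD; (apply: cvgM; [exact: ddbump_continuous|exact: cvg_cst]).
  by apply/funext => s; rewrite !mxE.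
Qed.

Lemma Rintegral_ddbump_comb_le s1 a1 c1 s2 a2 c2 (e1 e2 : 'rV[R]_2) K e k :
  0 < s1 <= T -> 0 < s2 <= T -> `|e1| <= K -> `|e2| <= K ->
  ((6 * `|a1| + 12 * `|c1| * s1) / s1 ^+ 2) ^+ 2 * s1 <= e ->
  ((6 * `|a2| + 12 * `|c2| * s2) / s2 ^+ 2) ^+ 2 * s2 <= e ->
  \int[mu]_(t in `[0, T]) (ddbump s1 a1 c1 t *: e1 + ddbump s2 a2 c2 t *: e2) 0 k ^+ 2 <=
  4 * K ^+ 2 * e.
Proof.
move=> s1T s2T e1K e2K i1 i2.
have cdd s a c : {within `[0, T], continuous (fun t => ddbump s a c t ^+ 2)}.
  by apply: continuous_subspaceT => t; apply: cvg_sqr; exact: ddbump_continuous.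
have idd s a c : mu.-integrable `[0, T] (EFin \o (fun t => ddbump s a c t ^+ 2)).
  by apply: continuous_compact_integrable => //; exact: segment_compact.
have sqK (e0 : 'rV[R]_2) : `|e0| <= K -> e0 0 k ^+ 2 <= K ^+ 2.
  move=> h; rewrite -real_normK ?num_real// ler_pXn2r ?nnegrE//.
    exact: le_trans (le_coord_norm _ _) h.
  exact: le_trans h.
apply: (@le_trans _ _ (\int[mu]_(t in `[0, T])
    (2 * K ^+ 2 * (ddbump s1 a1 c1 t ^+ 2) + 2 * K ^+ 2 * (ddbump s2 a2 c2 t ^+ 2)))).
  apply: le_Rintegral => //.
  - apply: continuous_compact_integrable; first exact: segment_compact.
    apply: continuous_subspaceT => t; apply: cvg_sqr.
    by have [_ _] := C2_curve_bump s1 a1 c1 s2 a2 c2 e1 e2 k; exact.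
  - by apply: integrable_itvD; apply: integrable_itvZl.
  - move=> t _; rewrite !mxE; set x := ddbump _ _ _ _; set z := ddbump _ _ _ _.
    apply: (@le_trans _ _ (2 * (x ^+ 2 * e1 0 k ^+ 2) + 2 * (z ^+ 2 * e2 0 k ^+ 2))).
      rewrite -subr_ge0 (_ : _ - _ = (x * e1 0 k - z * e2 0 k) ^+ 2) ?sqr_ge0//; ring.
    by apply: lerD; rewrite -mulrA ler_pM2l// mulrC ler_wpM2r ?sqr_ge0// sqK.
rewrite RintegralD//; [|exact: integrable_itvZl..].
rewrite !RintegralZl//.
have := le_trans (Rintegral_ddbump_sqr_le a1 c1 s1T) i1.
have := le_trans (Rintegral_ddbump_sqr_le a2 c2 s2T) i2.
move=> h2 h1; rewrite -mulrDr (_ : 4 * _ * e = 2 * K ^+ 2 * (e + e)); last by ring.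
by rewrite ler_wpM2l ?lerD// mulr_ge0// sqr_ge0.
Qed.

End recovery.

(** * Admissible perturbations inside the polygon *)

Section recovery_polygon.
Context {R : realType} (T : R) (Omega : set 'rV[R]_2) (N : nat) (nu n : 'I_N -> 'rV[R]_2).
Hypothesis T0 : 0 < T.
Hypothesis cvxO : convex_domain Omega.
Hypothesis polO : polygonal_boundary Omega nu.
Hypothesis outn : outward_normals Omega nu n.
Notation mu := (@lebesgue_measure R).

Lemma active_dot y k x : active nu n y k -> dot (x - nu k) (n k) = dot (x - y) (n k).
Proof. by rewrite /active !dotBl => /eqP; rewrite subr_eq0 => /eqP ->. Qed.

Lemma active_halfplane y k x : active nu n y k -> closure Omega x -> dot (x - y) (n k) <= 0.
Proof. by move=> ay xO; rewrite -(active_dot _ ay); exact: closure_halfplane xO. Qed.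

Lemma active_velocity (xi : R -> 'rV[R]_2) y w k :
  (forall t, t \in `[0, T] -> closure Omega (xi t)) -> xi 0 = y ->
  has_derivative_within `[0, T] xi 0 w -> active nu n y k -> dot w (n k) <= 0.
Proof.
move=> X xi0 D ay; have wn := right_derivative_dot T0 (u := n k) D.
apply: (cvgr_to_le wn); near=> t.
have t0 : 0 < t by [].
have tT : t \in `[0, T] by rewrite in_itv/= (ltW t0)/=; near: t; exact: nbhs_right_le.
rewrite mulr_ge0_le0// ?invr_ge0 ?(ltW t0)// xi0; apply: active_halfplane => //.
exact: X.
Unshelve. all: by end_near. Qed.

Lemma Gamma_from_active xi eta y w k : Gamma_from Omega T y w (xi, eta) ->
  active nu n y k -> dot w (n k) <= 0.
Proof.
move=> [[/= _ _ D X] xi0 eta0]; apply: active_velocity xi0 _ => [t /X[]//|].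
by rewrite -eta0; apply: D; rewrite in_itv/= lexx ltW.
Qed.

(** This is the condition for a displacement of normal component [- bump s a c t] to stay behind
    wall k. If w is tangent to the wall, the bump must be nonnegative; otherwise the curve recedes
    at no less than half its initial normal speed, which absorbs any slope c >= -e. *)
Lemma near_wall_bump xi eta y w k : Gamma_from Omega T y w (xi, eta) ->
  active nu n y k ->
  \forall e \near 0^'+, forall s a c t, 0 < s -> 0 <= a -> `|c| <= e ->
    (dot w (n k) = 0 -> 0 <= c) -> 0 <= t <= e -> t <= T ->
    dot (xi t - y) (n k) <= bump s a c t.
Proof.
move=> G ay; have wn := Gamma_from_right_derivative T0 (u := n k) G.
have [[_ _ _ X] /= xi0 _] := G.
have := Gamma_from_active G ay; rewrite le_eqVlt => /predU1P[w0|w0].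
  near=> e => s a c t s0 a0 _ /(_ w0) c0 /andP[t0 _] tT.
  apply: (@le_trans _ _ 0); last by rewrite -oppr0 -(mul0r t); apply: bump_ge => //; rewrite oppr0.
  apply: active_halfplane => //; have [] // := X t; by rewrite in_itv/= t0.
have p0 : 0 < - dot w (n k) / 2 by rewrite divr_gt0// oppr_gt0.
have H : \forall t \near 0^'+, dot (xi t - y) (n k) <= - (- dot w (n k) / 2 * t).
  have h : dot w (n k) < - (- dot w (n k) / 2) by lra.
  near=> t; have t0 : 0 < t by [].
  have : t^-1 * dot (xi t - y) (n k) <= - (- dot w (n k) / 2).
    near: t; exact: cvgr_le wn _ h.
  by rewrite mulrC ler_pdivrMr// mulNr.
near=> e => s a c t s0 a0 ce _ /andP[t0 te] tT.
have ep : e <= - dot w (n k) / 2 by near: e; exact: nbhs_right_le.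
apply: (@le_trans _ _ (- (- dot w (n k) / 2 * t))).
  have [->|t0'] := eqVneq t 0; first by rewrite xi0 subrr mulr0 oppr0 dot2E !mxE !mul0r addr0.
  have He : forall t, 0 < t <= e -> dot (xi t - y) (n k) <= - (- dot w (n k) / 2 * t).
    near: e; exact: near_right_itv H.
  by apply: He; rewrite lt_neqAle eq_sym t0' t0.
apply: bump_ge => //; first exact: ltW.
by rewrite lerNl (le_trans (ler_norm _))// normrN (le_trans ce).
Unshelve. all: by end_near. Qed.

(** The curve starts strictly inside the half-plane and keeps a margin for a short time. The same e
    is both the duration and the margin. *)
Lemma near_inactive xi eta y w k : Gamma_from Omega T y w (xi, eta) ->
  ~ active nu n y k ->
  \forall e \near 0^'+, forall t, 0 <= t <= e -> t <= T -> dot (xi t - nu k) (n k) + e <= 0.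
Proof.
move=> G ny; have [[_ _ _ X] /= xi0 _] := G.
have yO : closure Omega y by rewrite -xi0; have [] // := X 0; rewrite in_itv/= lexx ltW.
have : dot (y - nu k) (n k) < 0.
  by rewrite lt_neqAle (closure_halfplane cvxO polO outn k yO) andbT; apply/eqP.
set m := dot _ _ => m0.
have wn := Gamma_from_right_derivative T0 (u := n k) G.
have H : \forall t \near 0^'+, dot (xi t - y) (n k) <= - m / 2.
  near=> t; have t0 : 0 < t by [].
  have h : t^-1 * dot (xi t - y) (n k) <= `|dot w (n k)| + 1.
    by near: t; apply: cvgr_le wn _ _; rewrite (le_lt_trans (ler_norm _))// ltrDl.
  rewrite mulrC ler_pdivrMr// in h; apply: le_trans h _.
  have b0 : 0 < `|dot w (n k)| + 1 by rewrite ltr_wpDl.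
  rewrite mulrC -ler_pdivlMr//; near: t; apply: nbhs_right_le.
  by rewrite divr_gt0// divr_gt0// oppr_gt0.
near=> e => t /andP[t0 te] tT.
have em : e <= - m / 2 by near: e; apply: nbhs_right_le; rewrite divr_gt0// oppr_gt0.
suff : dot (xi t - y) (n k) <= - m / 2.
  by move: em; rewrite /m !dotBl; lra.
have [->|t0'] := eqVneq t 0.
  by rewrite xi0 subrr dot2E !mxE !mul0r addr0 divr_ge0// oppr_ge0 ltW.
have He : forall t, 0 < t <= e -> dot (xi t - y) (n k) <= - m / 2.
  near: e; exact: near_right_itv H.
by apply: He; rewrite lt_neqAle eq_sym t0' t0.
Unshelve. all: by end_near. Qed.


Lemma recovery xi eta y w (ys ws : nat -> 'rV[R]_2) eps :
  Gamma_from Omega T y w (xi, eta) ->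
  (forall i, closure Omega (ys i)) ->
  ys i @[i --> \oo] --> y -> ws i @[i --> \oo] --> w ->
  (forall k, listed nu y k -> forall e, 0 < e -> \forall i \near \oo,
    posp (dot (ws i) (n k)) ^+ 3 <= e * `|dot (y - ys i) (n k)|) ->
  0 < eps -> \forall i \near \oo, exists d d' d'' : R -> 'rV[R]_2,
    [/\ C2_curve d d' d'',
      forall t, t \in `[0, T] -> `|d t| <= eps /\ `|d' t| <= eps,
      \sum_(k < 2) \int[mu]_(t in `[0, T]) d'' t 0 k ^+ 2 <= eps
    & Gamma_from Omega T (ys i) (ws i) (fun t => xi t + d t, fun t => eta t + d' t)].
Proof.
move=> G ysO ysy wsw Hk eps0; have [[_ _ _ X] /= xi0 _] := G.
have yO : closure Omega y by rewrite -xi0; have [] // := X 0; rewrite in_itv/= lexx ltW.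
have [m1 [m2 [C0 act lst]]] := corner_frame cvxO polO outn yO.
(* Opposite of the basis dual to m1, m2: the product of e_i with m_j is -1 if i = j and 0 otherwise,
   so a bump along e_i pushes away from wall i without moving normally to the other. *)
pose e1 := (cross m1 m2)^-1 *: perp m2; pose e2 := - ((cross m1 m2)^-1 *: perp m1).
have frame u : - dot u m1 *: e1 + - dot u m2 *: e2 = u.
  move: C0; rewrite /e1 /e2 /cross => C0.
  by apply: row2P; rewrite !mxE/= !dot2E; field.
have m12 : m1 != m2 by apply: contraNneq C0 => ->; rewrite /cross; apply/eqP; ring.
have m21 : m2 != m1 by rewrite eq_sym.
have de m : m = m1 \/ m = m2 -> dot e1 m = - (m == m1)%:R /\ dot e2 m = - (m == m2)%:R.
  move: C0; rewrite /e1 /e2 /cross => C0.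
  case=> ->; rewrite ?eqxx ?(negbTE m12) ?(negbTE m21) ?oppr0 !dot2E !mxE/=;
    by split; field.
pose K := `|e1| + `|e2|.
have K0 : 0 <= K by rewrite addr_ge0.
have [e1K e2K] : `|e1| <= K /\ `|e2| <= K by rewrite lerDl lerDr.
have : \forall e \near 0^'+, forall k : 'I_N, active nu n y k -> forall s a c t,
   0 < s -> 0 <= a -> `|c| <= e -> (dot w (n k) = 0 -> 0 <= c) -> 0 <= t <= e -> t <= T ->
    dot (xi t - y) (n k) <= bump s a c t.
  apply: filter_forall => k; have [ak|nk] := pselect (active nu n y k).
    by have := near_wall_bump G ak; apply: filterS => e h _.
  by near=> e.
have : \forall e \near 0^'+, forall k : 'I_N, ~ active nu n y k -> forall t,
   0 <= t <= e -> t <= T -> dot (xi t - nu k) (n k) + e <= 0.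
  apply: filter_forall => k; have [ak|nk] := pselect (active nu n y k).
    by near=> e.
  by have := near_inactive G nk; apply: filterS => e h _.
move=> Hin Hac.
(* One scale for everything: duration of the cut-offs, margin to the inactive walls, and slope
   tolerated by the active ones. *)
have [del [Hinac Hwall delT del0]] : exists del : R,
    [/\ forall k : 'I_N, ~ active nu n y k -> forall t, 0 <= t <= del -> t <= T ->
        dot (xi t - nu k) (n k) + del <= 0,
      forall k : 'I_N, active nu n y k -> forall s a c t,
        0 < s -> 0 <= a -> `|c| <= del -> (dot w (n k) = 0 -> 0 <= c) ->
        0 <= t <= del -> t <= T -> dot (xi t - y) (n k) <= bump s a c t,
      del <= T & 0 < del].
  near (0 : R)^'+ => e; exists e; split=> //.
  - by near: e.
  - by near: e.
  - by near: e; exact: nbhs_right_le.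
(* Size of the bumps. The factor 2 comes from [le_dot_norm], which compares with the sup norm; 8 is
   4 for each of the two coordinates in [Rintegral_ddbump_comb_le]. *)
have [e [e0 ed eK eKd e4]] : exists e : R,
    [/\ 0 < e, e <= del, e * K <= eps, 2 * (e * K) <= del & 8 * K ^+ 2 * e <= eps].
  have K10 : 0 < K + 1 by rewrite ltr_wpDl.
  have h x : 0 < x -> \forall e \near 0^'+, e * (K + 1) <= x.
    by move=> x0; near=> z; rewrite -ler_pdivlMr//; near: z; apply: nbhs_right_le; rewrite divr_gt0.
  near (0 : R)^'+ => e; have e0 : 0 < e by [].
  have KK z : 0 <= z -> z * K <= z * (K + 1) by move=> z0; rewrite ler_wpM2l// lerDl.
  exists e; split=> //.
  - by near: e; exact: nbhs_right_le.
  - by apply: le_trans (KK _ (ltW e0)) _; near: e; exact: h.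
  - have : e * (K + 1) <= del / 2 by near: e; apply: h; rewrite divr_gt0.
    have := KK _ (ltW e0); lra.
  - have : e * (K + 1) <= eps / (8 * (K + 1)) by near: e; apply: h; rewrite divr_gt0// mulr_gt0.
    rewrite ler_pdivlMr ?mulr_gt0//; apply: le_trans.
    rewrite -subr_ge0 (_ : _ - _ = 8 * e * (2 * K + 1)); last by ring.
    by rewrite mulr_ge0// ?mulr_ge0 ?addr_ge0 ?mulr_ge0 ?(ltW e0).
have [rho rho0 Hrho] := bump_parameters del0 e0.
have dl (u : nat -> 'rV[R]_2) (u0 m : 'rV[R]_2) : u i @[i --> \oo] --> u0 ->
    \forall i \near \oo, `|- dot (u i - u0) m| <= rho.
  move=> uu0; have : dot (u i - u0) m @[i --> \oo] --> (0 : R).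
    rewrite (_ : 0 = dot (u0 - u0) m); last by rewrite subrr dot2E !mxE !mul0r addr0.
    have h : u i - u0 @[i --> \oo] --> u0 - u0 by apply: cvgB => //; exact: cvg_cst.
    by have := cvg_comp _ _ h (@dot_continuous _ m (u0 - u0)); exact.
  move=> /cvgr0_norm_le/(_ _ rho0); apply: filterS => i; by rewrite normrN.
have Hl : \forall i \near \oo, forall k : 'I_N, listed nu y k ->
    posp (dot (ws i) (n k)) ^+ 3 <= rho * `|dot (y - ys i) (n k)|.
  apply: filter_forall => k; have [lk|nk] := pselect (listed nu y k).
    by have := Hk k lk rho rho0; apply: filterS => i h _.
  by near=> i.
near=> i.
have HL : forall k : 'I_N, listed nu y k ->
    posp (dot (ws i) (n k)) ^+ 3 <= rho * `|dot (y - ys i) (n k)| by near: i.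
have bl m : m = m1 \/ m = m2 -> exists s c, let a := - dot (ys i - y) m in
    [/\ 0 < s <= del, c - 3 * a / s = - dot (ws i - w) m, `|a| + `|c| * s <= e,
       (3 * `|a| + 4 * `|c| * s) / s <= e
     & ((6 * `|a| + 12 * `|c| * s) / s ^+ 2) ^+ 2 * s <= e /\
       forall k t, active nu n y k -> n k = m -> 0 <= t <= del -> t <= T ->
         dot (xi t - y) m <= bump s a c t].
  move=> mm; set a := - dot _ _.
  have arho : `|a| <= rho by rewrite /a; case: mm => ->; near: i; exact: dl.
  have qrho : `|- dot (ws i - w) m| <= rho by case: mm => ->; near: i; exact: dl.
  have [s [c [sd cq b1 b2 [b3 ce cc]]]] := Hrho _ _ arho qrho.
  exists s, c; split=> //; split=> // k t ak nkm t0 tT; rewrite -nkm.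
  have a0 : 0 <= a by rewrite oppr_ge0 -nkm; exact: active_halfplane.
  apply: Hwall => //; [by case/andP: sd|exact: le_trans ce ed|].
  move=> w0; apply: cc => //.
  (* As w.n = 0, the relative normal speed is the outward speed of [ws i] itself; the cubic bound is
     known for a listed wall k' with the same normal. *)
  have [[k' lk' mk']|/(_ _ ak)//] := lst _ mm.
  rewrite opprK dotBl -nkm w0 subr0 nkm mk'; apply: le_trans (HL _ lk') _.
  by rewrite -mk' -opprB dotNl -/a ger0_norm.
have [s1 [c1 [s1d q1 v1 dv1 [E1 H1]]]] := bl m1 (or_introl erefl).
have [s2 [c2 [s2d q2 v2 dv2 [E2 H2]]]] := bl m2 (or_intror erefl).
set a1 := - dot (ys i - y) m1 in q1 v1 dv1 E1 H1.
set a2 := - dot (ys i - y) m2 in q2 v2 dv2 E2 H2.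
have /andP[s10 s1le] := s1d; have /andP[s20 s2le] := s2d.
pose d t := bump s1 a1 c1 t *: e1 + bump s2 a2 c2 t *: e2.
pose d' t := dbump s1 a1 c1 t *: e1 + dbump s2 a2 c2 t *: e2.
pose d'' t := ddbump s1 a1 c1 t *: e1 + ddbump s2 a2 c2 t *: e2.
have comb x z : `|x| <= e -> `|z| <= e -> `|x *: e1 + z *: e2| <= e * K.
  move=> xe ze; apply: le_trans (ler_normD _ _) _; rewrite mulrDr (normrZ x e1) (normrZ z e2).
  by apply: lerD; apply: ler_wpM2r.
have dbnd t : 0 <= t -> `|d t| <= e * K.
  by move=> t0; apply: comb; (apply: le_trans (bump_bound _ _ _ t0) _).
exists d, d', d''; have C2 := C2_curve_bump s1 a1 c1 s2 a2 c2 e1 e2; split=> //.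
- move=> t; rewrite in_itv/= => /andP[t0 tT]; split; first exact: le_trans (dbnd _ t0) eK.
  by apply: le_trans eK; apply: comb; (apply: le_trans (dbump_bound _ _ _ t0) _).
- apply: (@le_trans _ _ (\sum_(k < 2) 4 * K ^+ 2 * e)).
    apply: ler_sum => k _; apply: Rintegral_ddbump_comb_le => //.
      by rewrite s10 (le_trans s1le).
    by rewrite s20 (le_trans s2le).
  by rewrite big_const_ord iter_addr_0 (_ : _ *+ 2 = 8 * K ^+ 2 * e)//; ring.
have -> : ys i = y + d 0 by rewrite /d !bump_at0// frame addrC subrK.
have -> : ws i = w + d' 0 by rewrite /d' !dbump_at0// q1 q2 frame addrC subrK.
apply: (Gamma_from_shift T0 G C2) => t tT.
have /andP[t0 tle] : 0 <= t <= T by rewrite in_itv/= in tT.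
have [/= cl _] := X _ tT.
(* After [del] both bumps are switched off and the competitor is unchanged. *)
have [td|/ltW dt] := leP t del; last first.
  rewrite /d !bump_after ?scale0r ?addr0//; [exact: le_trans s2le dt|exact: le_trans s1le dt].
apply: (halfplanes_closure cvxO polO outn) => k.
rewrite addrAC dotDl.
have [ak|nk] := pselect (active nu n y k); last first.
  have := Hinac _ nk t; rewrite t0 td => /(_ isT tle).
  have [n1 _ _] := outn k.
  move=> h; apply: le_trans _ h; rewrite lerD2l; apply: le_trans (ler_norm _) _.
  apply: le_trans (le_dot_norm _ n1) _; apply: le_trans _ eKd; rewrite ler_pM2l//; exact: dbnd.
rewrite (active_dot _ ak).
rewrite /d [X in _ + X]dotDl (dotZl _ e1) (dotZl _ e2).
case: (act _ ak) => nm; have [d1 d2] := de (n k) (act _ ak).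
  rewrite d1 d2 nm eqxx (negbTE m12) oppr0 mulr0 addr0 mulrN1 subr_le0.
  by apply: (H1 k) => //; rewrite t0.
rewrite d1 d2 nm eqxx (negbTE m21) oppr0 mulr0 add0r mulrN1 subr_le0.
by apply: (H2 k) => //; rewrite t0.
Unshelve. all: by end_near. Qed.

End recovery_polygon.

(** * Costs *)

Lemma is_derive_row (R : realType) (f : R -> 'rV[R]_2) (x : R) (v : 'rV[R]_2) :
  (forall k, is_derive x (1 : R) (fun t => f t 0 k) (v 0 k)) ->
  derivable f x 1 /\ derive1 f x = v.
Proof.
move=> dv; have df : derivable f x 1.
  by apply/derivable_mxP => i k; rewrite (ord1 i); have [] := dv k.
split=> //; apply/rowP => k; rewrite (derive1_coord _ _ df).
by rewrite derive1E; have [_ ->] := dv k.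
Qed.

Section cost.
Context {R : realType} (T : R) (Omega : set 'rV[R]_2).
Hypothesis T0 : 0 < T.
Notation mu := (@lebesgue_measure R).

Lemma ae_eq_integrable (D : set R) (f g : R -> \bar R) : measurable D ->
  measurable_fun D f -> mu.-integrable D g -> {ae mu, forall x, D x -> f x = g x} ->
  mu.-integrable D f.
Proof.
move=> mD mf /integrableP[mg ig] fg; apply/integrableP; split=> //.
suff -> : (\int[mu]_(x in D) `|f x| = \int[mu]_(x in D) `|g x|)%E by [].
apply: ge0_ae_eq_integral => //; [exact: measurableT_comp|exact: measurableT_comp|].
by apply: ae_impl fg => x H /H ->.
Qed.

Lemma ae_derive1_energy (f h : R -> 'rV[R]_2) : AC_on T f -> L2_on T h ->
  {ae mu, forall x, 0 < x < T -> derive1 f x = h x} ->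
  L2_on T (derive1 f) /\
  energy T f = \sum_(k < 2) \int[mu]_(s in `[0, T]) h s 0 k ^+ 2.
Proof.
move=> acf L2h fh.
have aek k : {ae mu, forall x, x \in `[0, T] ->
    (derive1 f x 0 k ^+ 2)%:E = (h x 0 k ^+ 2)%:E}.
  have := ae_and fh (ae_itv_oo T); apply: ae_impl => x [H1 H2] /H2/H1 ->.
  by [].
have mk k : measurable_fun `[0, T] (fun s => (derive1 f s 0 k ^+ 2)%:E).
  by apply/measurable_EFinP; apply: measurable_funX; exact: measurable_derive1_abs_cont.
have mD : measurable (`[0, T] : set R) by exact: measurable_itv.
split.
  move=> k; have [mh ih] := L2h k; split; first exact: measurable_derive1_abs_cont.
  exact: (ae_eq_integrable mD (mk k) ih (aek k)).
apply: eq_bigr => k _; have [mh ih] := L2h k.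
rewrite /Rintegral; congr fine; apply: ae_eq_integral => //; [exact: mk|exact: (measurable_int mu)|exact: aek].
Qed.

Lemma derive1_shift_ae (eta d d' : R -> 'rV[R]_2) : AC_on T eta ->
  (forall k (t : R), is_derive t (1 : R) (fun s => d s 0 k) (d' t 0 k)) ->
  {ae mu, forall x, 0 < x < T -> derive1 (fun t => eta t + d t) x = derive1 eta x + d' x}.
Proof.
move=> aceta dd; have := AC_on_ae_derivable T0 aceta; apply: ae_impl => x H /H deta.
have ex k : is_derive x (1 : R) (fun t => eta t 0 k) (derive1 (fun t => eta t 0 k) x).
  apply: DeriveDef; last by rewrite derive1E.
  by move/derivable_mxP : deta; exact.
have sx k : is_derive x (1 : R) (fun t => (eta t + d t) 0 k) ((derive1 eta x + d' x) 0 k).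
  rewrite (_ : (fun t => _) = (fun t => eta t 0 k) + (fun t => d t 0 k)).
    by have h := dd k x; have h' := ex k; rewrite mxE (derive1_coord _ _ deta); exact: is_deriveD.
  by apply/funext => t; rewrite mxE.
by have [_ ->] := is_derive_row sx.
Qed.

(** Weighted Young inequality: with th small, the energy of eta is multiplied by almost 1, and the
    large factor 1 + 1 / th falls on the perturbation, whose energy is made small afterwards. Here
    [d] perturbs the velocity. *)
Lemma energy_perturb (eta c d d' : R -> 'rV[R]_2) th : AC_on T eta ->
  AC_on T (fun t => eta t + d t) ->
  L2_on T (derive1 eta) ->
  C2_curve c d d' -> 0 < th ->
  L2_on T (derive1 (fun t => eta t + d t)) /\
  energy T (fun t => eta t + d t) <= (1 + th) * energy T eta +
    (1 + th^-1) * \sum_(k < 2) \int[mu]_(t in `[0, T]) d' t 0 k ^+ 2.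
Proof.
move=> aceta acs L2eta C2 th0.
have dd k (t : R) : is_derive t (1 : R) (fun s => d s 0 k) (d' t 0 k).
  by have [_ h _] := C2 k; exact: h.
have cd k : continuous (fun t => d' t 0 k) by have [] := C2 k.
have mD : measurable (`[0, T] : set R) by exact: measurable_itv.
have md k : measurable_fun `[0, T] (fun t => d' t 0 k).
  by apply: measurable_funTS; apply: continuous_measurable_fun.
have id k : mu.-integrable `[0, T] (EFin \o (fun t => d' t 0 k ^+ 2)).
  apply: continuous_compact_integrable; first exact: segment_compact.
  by apply: continuous_subspaceT => t; apply: cvg_sqr; exact: cd.
pose b k t := (1 + th) * (derive1 eta t 0 k ^+ 2) + (1 + th^-1) * (d' t 0 k ^+ 2).
have ib k : mu.-integrable `[0, T] (EFin \o b k).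
  by apply: integrable_itvD; apply: integrable_itvZl => //; have [] := L2eta k.
have le_b k t : (derive1 eta t + d' t) 0 k ^+ 2 <= b k t.
  rewrite mxE /b; move: (derive1 eta t 0 k) (d' t 0 k) => x z.
  rewrite -subr_ge0 (_ : _ - _ = th * (x - th^-1 * z) ^+ 2).
    by rewrite mulr_ge0 ?sqr_ge0 ?ltW.
  by field; rewrite gt_eqF.
have L2s : L2_on T (fun t => derive1 eta t + d' t).
  move=> k; have [me ie] := L2eta k.
  have ms : measurable_fun `[0, T] (fun t => (derive1 eta t + d' t) 0 k).
    rewrite (_ : (fun t => _) = fun t => derive1 eta t 0 k + d' t 0 k).
      exact: measurable_funD.
    by apply/funext => t; rewrite mxE.
  split; first exact: ms.
  apply: (@le_integrable _ _ R mu _ mD (fun s => ((derive1 eta s + d' s) 0 k ^+ 2)%:E) _ _ _ (ib k)).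
    by apply/measurable_EFinP; apply: measurable_funX.
  move=> t _ /=; rewrite lee_fin ger0_norm ?sqr_ge0//.
  by apply: le_trans (le_b k t) _; exact: ler_norm.
have [L2 ->] := ae_derive1_energy acs L2s (derive1_shift_ae aceta dd).
split=> //; rewrite /energy !mulr_sumr -big_split/=; apply: ler_sum => k _.
rewrite -!RintegralZl//; last by have [] := L2eta k.
rewrite -RintegralD//; [|by apply: integrable_itvZl => //; have [] := L2eta k
  |exact: integrable_itvZl].
apply: le_Rintegral; [exact: mD|by have [] := L2s k|exact: ib|].
by move=> t _; exact: le_b.
Qed.

Definition running_cost (ell : 'rV[R]_2 * 'rV[R]_2 * R -> R) (xi eta : R -> 'rV[R]_2) : R :=
  \int[mu]_(t in `[0, T]) ell (xi t, eta t, t).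

Lemma within_ball_ell (ell : 'rV[R]_2 * 'rV[R]_2 * R -> R) a0 b0 s eps :
  {within Xi Omega `*` `[0, T], continuous ell} ->
  closure Omega a0 -> s \in `[0, T] -> 0 < eps ->
  exists2 r, 0 < r & forall (a b : 'rV[R]_2) t, closure Omega a -> t \in `[0, T] ->
    `|a0 - a| < r -> `|b0 - b| < r -> `|s - t| < r ->
    `|ell (a0, b0, s) - ell (a, b, t)| < eps.
Proof.
move=> cell cla sT eps0.
have XsT : (Xi Omega `*` `[0, T]) (a0, b0, s) by [].
have /cvgrPdist_lt/(_ _ eps0) := (subspace_continuousP _ _).1 cell _ XsT.
move=> /nbhs_ballP[r /= r0 Hr]; exists r => // a b t clA tT h1 h2 h3.
apply: Hr; last by split.
by split => /=; [split => /=; rewrite mx_norm_ball|].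
Qed.

Lemma within_near (f : R -> 'rV[R]_2) s e : {within `[0, T], continuous f} ->
  s \in `[0, T] -> 0 < e -> \forall t \near s, t \in `[0, T] -> `|f s - f t| < e.
Proof.
move=> cf sT e0; have := (subspace_continuousP _ _).1 cf _ sT.
by move=> /cvgrPdist_lt/(_ _ e0); exact.
Qed.

Lemma running_cost_integrable (ell : 'rV[R]_2 * 'rV[R]_2 * R -> R) xi eta :
  {within Xi Omega `*` `[0, T], continuous ell} -> Gamma Omega T (xi, eta) ->
  mu.-integrable `[0, T] (EFin \o (fun t => ell (xi t, eta t, t))).
Proof.
move=> cell [/= _ AC D X].
have cxi := has_derivative_within_continuous D.
have ceta := AC_on_continuous T0 AC.
apply: continuous_compact_integrable; first exact: segment_compact.
apply/subspace_continuousP => s sT; apply/cvgrPdist_lt => e e0.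
have [cls _] := X _ sT.
have [r r0 Hr] := within_ball_ell (eta s) cell cls sT e0.
have h1 := within_near cxi sT r0; have h2 := within_near ceta sT r0.
have h3 : \forall t \near s, `|s - t| < r by apply/nbhs_ballP; exists r.
move: h1 h2 h3; apply: filterS3 => t h1 h2 h3 tT.
have [clt _] := X _ tT; exact: (Hr _ _ _ clt tT (h1 tT) (h2 tT) h3).
Qed.

(** The domain of [ell] is unbounded in velocity, so uniformity is claimed only near the given
    curve, by compactness of [0, T]. *)
Lemma uniform_close_along (ell : 'rV[R]_2 * 'rV[R]_2 * R -> R) xi eta eps :
  {within Xi Omega `*` `[0, T], continuous ell} -> Gamma Omega T (xi, eta) -> 0 < eps ->
  \forall e \near 0^'+, forall t, t \in `[0, T] -> forall a b : 'rV[R]_2,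
    closure Omega a -> `|xi t - a| <= e -> `|eta t - b| <= e ->
    `|ell (xi t, eta t, t) - ell (a, b, t)| <= eps.
Proof.
move=> cell [/= _ AC D X] eps0.
have cxi := has_derivative_within_continuous D.
have ceta := AC_on_continuous T0 AC.
have /compact_near_coveringP cpt := @segment_compact _ 0 T.
have := cpt R 0^'+ (fun e t => t \in `[0, T] -> forall a b : 'rV[R]_2,
    closure Omega a -> `|xi t - a| <= e -> `|eta t - b| <= e ->
    `|ell (xi t, eta t, t) - ell (a, b, t)| <= eps) _.
move=> H; suff : \forall e \near 0^'+, `[0, T] `<=` (fun t => t \in `[0, T] -> forall a b : 'rV[R]_2,
    closure Omega a -> `|xi t - a| <= e -> `|eta t - b| <= e ->
    `|ell (xi t, eta t, t) - ell (a, b, t)| <= eps).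
  by apply: filterS => e He t tT; exact: He.
apply: H => s sT.
have [cls _] := X _ sT.
have eps20 : 0 < eps / 2 by rewrite divr_gt0.
have [r r0 Hr'] := within_ball_ell (eta s) cell cls sT eps20.
have r2 : 0 < r / 2 by rewrite divr_gt0.
have hxi := within_near cxi sT r2.
have heta := within_near ceta sT r2.
have hs : \forall t \near s, `|s - t| < r.
  by apply/nbhs_ballP; exists r.
exists ([set t | [/\ t \in `[0, T] -> `|xi s - xi t| < r / 2,
    t \in `[0, T] -> `|eta s - eta t| < r / 2 & `|s - t| < r]],
  [set e | e < r / 2]) => /=.
  by split; [near=> t; split; near: t|exact: nbhs_right_lt].
move=> [t e] [/= [h1 h2 h3] er] tT.
have {}h1 := h1 tT; have {}h2 := h2 tT.
move=> a b clA xia etab.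
have /= [cxt _] := X _ tT.
have rr : r / 2 < r by lra.
have E1 : `|ell (xi s, eta s, s) - ell (xi t, eta t, t)| < eps / 2.
  by apply: Hr' => //; apply: lt_trans rr.
have E2 : `|ell (xi s, eta s, s) - ell (a, b, t)| < eps / 2.
  apply: Hr' => //.
    by rewrite -(subrKA (xi t)) (le_lt_trans (ler_normD _ _))//; lra.
  by rewrite -(subrKA (eta t)) (le_lt_trans (ler_normD _ _))//; lra.
rewrite -(subrKA (ell (xi s, eta s, s))) (le_trans (ler_normD _ _))//.
by rewrite (distrC (ell (xi t, eta t, t))); lra.
Unshelve. all: by end_near. Qed.

Lemma static_cost_close (ell : 'rV[R]_2 * 'rV[R]_2 * R -> R) g xi eta eps :
  {within Xi Omega `*` `[0, T], continuous ell} -> {within Xi Omega, continuous g} ->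
  Gamma Omega T (xi, eta) -> 0 < eps ->
  \forall e \near 0^'+, forall xi' eta', Gamma Omega T (xi', eta') ->
    (forall t, t \in `[0, T] -> `|xi t - xi' t| <= e /\ `|eta t - eta' t| <= e) ->
    `|running_cost ell xi eta + g (xi T, eta T) -
      (running_cost ell xi' eta' + g (xi' T, eta' T))| <= eps.
Proof.
move=> cell cg G eps0.
have TT : T \in `[0, T] by rewrite in_itv/= lexx ltW.
(* This tolerance on [ell] integrates to eps / 2 over [0, T]; the rest is for the final cost. *)
have eT0 : 0 < eps / 2 / T by rewrite !divr_gt0.
have e20 : 0 < eps / 2 by rewrite divr_gt0.
have H1 := uniform_close_along cell G eT0.
have [/= _ _ _ X] := G; have XT := X _ TT.
have /cvgrPdist_lt/(_ _ e20)/nbhs_ballP[r /= r0 Hr] := (subspace_continuousP _ _).1 cg _ XT.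
have H2 : \forall e \near 0^'+, e < r by exact: nbhs_right_lt.
move: H1 H2; apply: filterS2 => e H1 er xi' eta' G' close.
have [/= _ _ _ X'] := G'.
have gT : `|g (xi T, eta T) - g (xi' T, eta' T)| < eps / 2.
  have [h1 h2] := close _ TT.
  apply: Hr; last exact: X'.
  by split => /=; rewrite mx_norm_ball /ball_/=; [exact: le_lt_trans h1 er|exact: le_lt_trans h2 er].
have i1 := running_cost_integrable cell G; have i2 := running_cost_integrable cell G'.
have mD : measurable (`[0, T] : set R) by exact: measurable_itv.
have iB : mu.-integrable `[0, T]
    (EFin \o (fun t => ell (xi t, eta t, t) - ell (xi' t, eta' t, t))).
  have := integrable_itvD i1 (integrable_itvZl (-1) i2).
  by congr (mu.-integrable _ _); apply/funext => t /=; rewrite mulN1r.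
have rc : `|running_cost ell xi eta - running_cost ell xi' eta'| <= eps / 2.
  rewrite /running_cost -RintegralB//.
  apply: le_trans (le_normr_Rintegral _ _) _ => //.
  apply: (@le_trans _ _ (\int[mu]_(t in `[0, T]) (eps / 2 / T))).
    apply: le_Rintegral => //.
    - exact: integrable_norm iB.
    - exact: (integrable_cst_itv 0 T).
    - move=> t tT; have [h1 h2] := close _ tT; apply: H1 => //.
      by have [] := X' _ tT.
  by rewrite Rintegral_cst_itv ?(ltW T0)// subr0 divfK// gt_eqF.
rewrite opprD addrACA; apply: le_trans (ler_normD _ _) _.
by rewrite [leRHS]splitr lerD// ltW.
Qed.

Lemma static_cost_ge (ell : 'rV[R]_2 * 'rV[R]_2 * R -> R) g :
  {within Xi Omega `*` `[0, T], continuous ell} ->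
  bounded_from_below (Xi Omega `*` `[0, T]) ell -> bounded_from_below (Xi Omega) g ->
  exists m, forall xi eta, Gamma Omega T (xi, eta) ->
    m <= running_cost ell xi eta + g (xi T, eta T).
Proof.
move=> cell [m1 H1] [m2 H2]; exists (m1 * T + m2) => xi eta G.
have [/= _ _ _ X] := G; apply: lerD.
  rewrite -[in leLHS](subr0 T) -(Rintegral_cst_itv m1 (ltW T0)).
  apply: le_Rintegral => //.
  - exact: (integrable_cst_itv 0 T m1).
  - exact: running_cost_integrable.
  - by move=> t tT; apply: H1; split => //=; exact: X.
by apply: H2; apply: X; rewrite in_itv/= lexx ltW.
Qed.

Lemma cost_fin (ell : 'rV[R]_2 * 'rV[R]_2 * R -> R) g xi eta :
  {within Xi Omega `*` `[0, T], continuous ell} -> Gamma Omega T (xi, eta) ->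
  L2_on T (derive1 eta) ->
  cost T ell g xi eta (derive1 eta) =
  (running_cost ell xi eta + g (xi T, eta T) + 2^-1 * energy T eta)%:E.
Proof.
move=> cell G L2; rewrite /cost; case: asboolP => // _.
have iell := running_cost_integrable cell G.
have iE k : mu.-integrable `[0, T] (EFin \o (fun s => derive1 eta s 0 k ^+ 2)).
  by have [] := L2 k.
have iE2 : mu.-integrable `[0, T] (EFin \o (fun s => derive1 eta s 0 0 ^+ 2 + derive1 eta s 0 1 ^+ 2)).
  exact: integrable_itvD.
have mD : measurable (`[0, T] : set R) by exact: measurable_itv.
have E s : enorm (derive1 eta s) ^+ 2 = derive1 eta s 0 0 ^+ 2 + derive1 eta s 0 1 ^+ 2.
  by rewrite enorm_sqr big_ord_recl big_ord1; congr (_ + derive1 eta s 0 _ ^+ 2); exact: val_inj.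
transitivity ((\int[mu]_(s in `[0, T]) (ell (xi s, eta s, s) +
    2^-1 * (derive1 eta s 0 0 ^+ 2 + derive1 eta s 0 1 ^+ 2)))%:E + (g (xi T, eta T))%:E)%E.
  rewrite RintegralE//; last first.
    by apply: integrable_itvD => //; exact: integrable_itvZl.
  by congr (_ + _)%E; apply: eq_integral => s _; rewrite E.
rewrite -EFinD; congr EFin.
rewrite RintegralD//; last exact: integrable_itvZl.
rewrite RintegralZl// RintegralD// /energy big_ord_recl big_ord1 /running_cost addrAC.
have -> : lift ord0 ord0 = 1 :> 'I_2 by exact: val_inj.
by have -> : ord0 = 0 :> 'I_2 by exact: val_inj.
Qed.

Lemma cost_lty_L2_on (ell : 'rV[R]_2 * 'rV[R]_2 * R -> R) g xi eta deta :
  (cost T ell g xi eta deta < +oo)%E -> L2_on T deta.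
Proof. by rewrite /cost; case: asboolP. Qed.

End cost.

(** * Integration by parts for absolutely continuous curves *)

Section weak_derivative.
Context {R : realType} (T : R).
Hypothesis T0 : 0 < T.
Notation mu := (@lebesgue_measure R).

Lemma abs_cont_normr_bounded (f : R -> R) : abs_cont T f ->
  exists2 M, 0 < M & forall t, t \in `[0, T] -> `|f t| <= M.
Proof.
move=> acf; have cf := abs_cont_clamp_continuous T0 acf.
have [c _ fc] : exists2 c, c \in `[0, T] &
    forall t, t \in `[0, T] -> `|f (clamp T t)| <= `|f (clamp T c)|.
  apply: (@EVT_max _ (fun t => `|f (clamp T t)|)); first exact: ltW.
  by apply: continuous_subspaceT => x; apply: cvg_norm; exact: cf.
exists (`|f (clamp T c)| + 1); first by rewrite ltr_wpDl.
move=> t tT; have := fc _ tT; rewrite clamp_id// => h.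
by apply: le_trans h _; rewrite lerDl.
Qed.

Lemma abs_contM (f g : R -> R) : abs_cont T f -> abs_cont T g ->
  abs_cont T (fun x => f x * g x).
Proof.
move=> acf acg e e0.
have [F F0 fF] := abs_cont_normr_bounded acf.
have [G G0 gG] := abs_cont_normr_bounded acg.
have eG : 0 < e / 2 / G by rewrite !divr_gt0.
have eF : 0 < e / 2 / F by rewrite !divr_gt0.
have [d1 d10 H1] := acf _ eG; have [d2 d20 H2] := acg _ eF.
exists (Num.min d1 d2); first by rewrite lt_min d10 d20.
move=> I a b abT tr; rewrite lt_min => /andP[/(H1 _ _ _ abT tr) h1 /(H2 _ _ _ abT tr) h2].
rewrite ltr_pdivlMr// in h1; rewrite ltr_pdivlMr// in h2.
rewrite [ltRHS]splitr; apply: le_lt_trans (ltrD h1 h2).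
rewrite !mulr_suml -big_split/=; apply: ler_sum => i _; have [a0 [ab bT]] := abT i.
have aI : a i \in `[0, T] by rewrite in_itv/= a0 (le_trans ab).
have bI : b i \in `[0, T] by rewrite in_itv/= bT (le_trans a0).
rewrite (_ : _ - _ = (f (b i) - f (a i)) * g (b i) + (g (b i) - g (a i)) * f (a i)); last by ring.
apply: le_trans (ler_normD _ _) _; rewrite !normrM; apply: lerD.
  by rewrite ler_wpM2l// gG.
by rewrite ler_wpM2l// fF.
Qed.

Lemma integrable_within_continuous (f : R -> R) : {within `[0, T], continuous f} ->
  mu.-integrable `[0, T] (EFin \o f).
Proof. by move=> cf; apply: continuous_compact_integrable => //; exact: segment_compact. Qed.

(** The product [phi *: eta] is absolutely continuous and vanishes at 0 and T, so its derivative,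
    given almost everywhere by the product rule, has integral 0. *)
Lemma AC_on_weak_derivative (eta : R -> 'rV[R]_2) : AC_on T eta ->
  weak_derivative T eta (derive1 eta).
Proof.
move=> ac phi k [dphi cphi [a [b [a0 bT supp]]]].
have dphi' (t : R) : is_derive t (1 : R) phi (derive1 phi t).
  by apply: DeriveDef; rewrite ?derive1E//; exact: dphi.
have acphi : abs_cont T phi := is_derive_abs_cont T0 dphi' cphi.
have acp : AC_on T (fun t => phi t *: eta t).
  apply: abs_cont_AC_on => j.
  rewrite (_ : (fun s => _) = fun s => phi s * eta s 0 j).
    by apply: abs_contM => //; exact: AC_on_abs_cont.
  by apply/funext => s; rewrite mxE.
have [i1 F1] := AC_on_FTC T0 k ac.
have [i2 /(_ 0 T (lexx _) (ltW T0) (lexx _)) F2] := AC_on_FTC T0 k acp.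
have phi0 : phi 0 = 0 by apply: supp; rewrite in_itv/= negb_and -ltNge a0.
have phiT : phi T = 0 by apply: supp; rewrite in_itv/= negb_and -!ltNge bT orbT.
rewrite phi0 phiT !scale0r subrr in F2.
have ceta := (within_continuous_rowP _ _).1 (AC_on_continuous T0 ac) k.
have iA : mu.-integrable `[0, T] (EFin \o (fun s => eta s 0 k * derive1 phi s)).
  apply: integrable_within_continuous; move=> x; apply: cvgM; first exact: ceta.
  by apply: continuous_subspaceT; exact: cphi.
have [M M0 phiM] := abs_cont_normr_bounded acphi.
have md := measurable_derive1_abs_cont T0 k ac.
have mphi : measurable_fun `[0, T] phi.
  apply: measurable_funTS; apply: continuous_measurable_fun => t.
  by apply: differentiable_continuous; apply/derivable1_diffP; exact: dphi.
have iB : mu.-integrable `[0, T] (EFin \o (fun s => derive1 eta s 0 k * phi s)).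
  have mD : measurable (`[0, T] : set R) by exact: measurable_itv.
  have iM := integrable_itvZl M i1.
  apply: (@le_integrable _ _ R mu _ mD _ _ _ _ iM).
    by apply/measurable_EFinP; exact: measurable_funM.
  move=> t tT /=; rewrite lee_fin !normrM mulrC (ger0_norm (ltW M0)).
  by rewrite ler_wpM2r// phiM.
apply/eqP; rewrite -subr_eq0 opprK -RintegralD//; apply/eqP.
rewrite [RHS]F2 /Rintegral; congr fine.
apply: ae_eq_integral => //.
- by have /(measurable_int mu) := integrable_itvD iA iB.
- exact: (measurable_int mu i2).
have := ae_and (AC_on_ae_derivable T0 ac) (ae_itv_oo T).
apply: ae_impl => x [H1 H2] /H2/H1 deta; congr EFin.
have ex j : is_derive x (1 : R) (fun t => eta t 0 j) (derive1 eta x 0 j).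
  rewrite (derive1_coord _ _ deta); apply: DeriveDef; last by rewrite derive1E.
  by move/derivable_mxP : deta; exact.
have px j : is_derive x (1 : R) (fun t => (phi t *: eta t) 0 j)
    ((derive1 phi x *: eta x + phi x *: derive1 eta x) 0 j).
  rewrite (_ : (fun t => _) = phi * (fun t => eta t 0 j)).
    have dx := dphi' x; have dy := ex j; apply: is_derive_eq.
    by rewrite !mxE /= addrC (mulrC (derive1 phi x)).
  by apply/funext => t; rewrite mxE.
have [_ ->] := is_derive_row px.
by rewrite !mxE; ring.
Qed.

End weak_derivative.

(** * Closedness of the optimal curves *)

Section optimal_limit.
Context {R : realType} (T : R) (Omega : set 'rV[R]_2) (N : nat) (nu n : 'I_N -> 'rV[R]_2).
Hypothesis T0 : 0 < T.
Hypothesis cvxO : convex_domain Omega.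
Hypothesis polO : polygonal_boundary Omega nu.
Hypothesis outn : outward_normals Omega nu n.
Notation mu := (@lebesgue_measure R).

Lemma AC_on_W12 (eta : R -> 'rV[R]_2) : AC_on T eta -> L2_on T (derive1 eta) -> W12 T eta.
Proof.
move=> ac L2; split; last by exists (derive1 eta) => //; exact: AC_on_weak_derivative.
move=> k; have ck := (within_continuous_rowP _ _).1 (AC_on_continuous T0 ac) k.
split.
  by apply/measurable_EFinP; apply: (measurable_int mu (integrable_within_continuous ck)).
by apply: integrable_within_continuous => x; apply: cvg_sqr; exact: ck.
Qed.

(** Makes every optimal cost finite. The curve leaves y with velocity w, stays on a short segment in
    the direction of w, which the tangent cone puts in the closure, and returns to y. *)
Lemma finite_energy_curve y w : closure Omega y -> tangent_cone Omega y w ->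
  exists xi eta, Gamma_from Omega T y w (xi, eta) /\ L2_on T (derive1 eta).
Proof.
move=> yO tan.
have [tau [tau0 Htau]] : exists tau, 0 < tau /\
    forall t, 0 < t <= tau -> closure Omega (y + t *: w).
  near (0 : R)^'+ => e; exists e; split=> //; near: e; exact: near_right_itv tan.
have z0 k (t : R) : is_derive t (1 : R) (fun _ : R => (0 : 'rV[R]_2) 0 k) ((0 : 'rV[R]_2) 0 k).
  by rewrite mxE; exact: is_derive_cst.
have y0 k (t : R) : is_derive t (1 : R) (fun _ : R => y 0 k) ((0 : 'rV[R]_2) 0 k).
  by rewrite mxE; exact: is_derive_cst.
have G0 : Gamma_from Omega T y 0 (cst y, cst 0).
  have D s : has_derivative_within `[0, T] (cst y) s 0 by exact: is_derive_within.
  have ac0 : AC_on T (cst (0 : 'rV[R]_2)).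
    apply: abs_cont_AC_on => k; apply: (is_derive_abs_cont T0 (fun t => z0 k t)).
    by move=> x; exact: cvg_cst.
  split=> //; split => //=.
  by exists (cst 0); split=> // => x; exact: cvg_cst.
(* Offset 0 and initial speed 1 along w, added to the curve at rest in y; the bump stays between 0
   and tau. *)
have C2 := C2_curve_bump tau 0 1 tau 0 0 w 0.
have E t : bump tau 0 1 t *: w + bump tau 0 0 t *: 0 = bump tau 0 1 t *: w.
  by rewrite scaler0 addr0.
have := Gamma_from_shift T0 G0 C2.
rewrite E bump_at0// scale0r !addr0 dbump_at0// mulr0 mul0r subr0 scale1r scaler0 addr0 add0r.
move=> G; set xi := fun t => _ in G; set eta := fun t => _ in G.
have Gw : Gamma_from Omega T y w (xi, eta).
  apply: G => t; rewrite in_itv/= E => /andP[t0 tT].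
  have b0 : 0 <= bump tau 0 1 t.
    by have := @bump_ge _ tau 0 1 0 t tau0 t0 (lexx _) (lexx _); rewrite mul0r !oppr0; apply.
  have [->|bn0] := eqVneq (bump tau 0 1 t) 0; first by rewrite scale0r addr0.
  apply: Htau; rewrite lt_neqAle eq_sym bn0 b0 /=.
  apply: le_trans (ler_norm _) _; apply: le_trans (bump_bound _ _ tau0 t0) _.
  by rewrite normr0 add0r normr1 mul1r.
exists xi, eta; split=> //.
have [[/= _ ac0 _ _] _ _] := G0; have [[/= _ ac _ _] _ _] := Gw.
have L20 : L2_on T (derive1 (cst (0 : 'rV[R]_2) : R -> 'rV[R]_2)).
  move=> k; rewrite (_ : derive1 _ = cst 0); last first.
    by apply/funext => x; rewrite derive1_cst.
  by rewrite /= mxE expr0n/=; split; [exact: measurable_cst|exact: (integrable_cst_itv 0 T 0)].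
by have [] := energy_perturb T0 ac0 ac L20 C2 ltr01.
Unshelve. all: by end_near. Qed.

Lemma posp_dot_le_enorm (u v : 'rV[R]_2) : enorm v = 1 -> posp (dot u v) ^+ 2 <= enorm u ^+ 2.
Proof.
move=> /dot_unit v1; have -> : enorm u ^+ 2 = dot u u.
  by rewrite /enorm sqr_sqrtr// dot2E addr_ge0// -expr2 sqr_ge0.
apply: (@le_trans _ _ (dot u v ^+ 2)).
  by rewrite /posp; case: (leP (dot u v) 0) => // _; rewrite expr0n sqr_ge0.
move: v1; rewrite !dot2E => v1.
have -> : u 0 0 * u 0 0 + u 0 1 * u 0 1 =
    (u 0 0 * u 0 0 + u 0 1 * u 0 1) * (v 0 0 * v 0 0 + v 0 1 * v 0 1) by rewrite v1 mulr1.
rewrite -subr_ge0 (_ : _ - _ = (u 0 0 * v 0 1 - u 0 1 * v 0 0) ^+ 2) ?sqr_ge0//; ring.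
Qed.

Lemma posp_ge0 (x : R) : 0 <= posp x. Proof. by rewrite le_max lexx orbT. Qed.

(** At a vertex with w = 0, the normal being a unit vector, the square of (w^i . n)_+ is at most
    |w^i|^2 and hence at most the bracket of the third assumption. *)
Lemma listed_condition (ys ws : nat -> 'rV[R]_2) (y w : 'rV[R]_2) k e :
  [/\ forall j, open_segment (nu j) (nu (ordS j)) y ->
          (fun i => posp (dot (ws i) (n j)) ^+ 3) =o_\oo
            (fun i => dot (y - ys i) (n j)),
        forall j, y = nu j -> w <> 0 ->
          forall k, k = ord_pred j \/ k = j ->
          (fun i => posp (dot (ws i) (n k)) ^+ 3) =o_\oo
            (fun i => dot (y - ys i) (n k))
      & forall j, y = nu j -> w = 0 ->
          forall k, k = ord_pred j \/ k = j ->
          (fun i => posp (dot (ws i) (n k)) *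
              (enorm (y - ys i) `^ (2 / 3) + enorm (ws i) ^+ 2)) =o_\oo
            (fun i => dot (y - ys i) (n k))] ->
  listed nu y k -> 0 < e -> \forall i \near \oo,
    posp (dot (ws i) (n k)) ^+ 3 <= e * `|dot (y - ys i) (n k)|.
Proof.
have le (a b : nat -> R) : a =o_\oo b -> 0 < e -> \forall i \near \oo, `|a i| <= e * `|b i|.
  by move=> /eqoP ab e0; exact: ab.
move=> [A1 A2 A3] lk e0.
have hb (a b : nat -> R) : a =o_\oo b -> (forall i, posp (dot (ws i) (n k)) ^+ 3 <= a i) ->
    \forall i \near \oo, posp (dot (ws i) (n k)) ^+ 3 <= e * `|b i|.
  move=> /le/(_ e0) + h; apply: filterS => i; apply: le_trans.
  by apply: le_trans (h i) _; exact: ler_norm.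
case: lk => [s|[j yj kj]]; first by apply: hb (A1 _ s) _.
have [w0|w0] := pselect (w = 0); last by apply: hb (A2 _ yj w0 _ kj) _.
apply: hb (A3 _ yj w0 _ kj) _ => i.
rewrite exprS ler_wpM2l ?posp_ge0//; have [n1 _ _] := outn k.
by apply: le_trans (posp_dot_le_enorm _ n1) _; rewrite lerDr powR_ge0.
Qed.

(** The set of admissible pairs need not be closed, so admissibility of the limit has to be
    supplied. *)
Lemma closed_in_limit (Theta : set ('rV[R]_2 * 'rV[R]_2)) (ys ws : nat -> 'rV[R]_2) y w :
  closed_in (Xi_ad Omega) Theta -> (forall i, Theta (ys i, ws i)) ->
  (ys i, ws i) @[i --> \oo] --> (y, w) -> Xi_ad Omega (y, w) -> Theta (y, w).
Proof.
move=> [F cF ->] H yw X; split=> //; apply: (closed_cvg F cF _ _ yw).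
by near=> i; have [] := H i.
Unshelve. all: by end_near. Qed.

(** Comparison with [finite_energy_curve] keeps the cost of a minimizer out of its infinite
    branch. *)
Lemma Gamma_opt_L2_on (ell : 'rV[R]_2 * 'rV[R]_2 * R -> R) g y w p :
  {within Xi Omega `*` `[0, T], continuous ell} -> Xi_ad Omega (y, w) ->
  Gamma_opt Omega T ell g y w p -> L2_on T (derive1 p.2).
Proof.
move=> cell [yO tan] [_ _ opt]; have [xi [eta [G L2]]] := finite_energy_curve yO tan.
have [Gq _ _] := G; apply: (@cost_lty_L2_on _ T ell g p.1 p.2).
by apply: le_lt_trans (opt _ G) _; rewrite (cost_fin T0 g cell Gq L2) ltry.
Qed.

Lemma eventually_cost_le (ell : 'rV[R]_2 * 'rV[R]_2 * R -> R) g
    (ys ws : nat -> 'rV[R]_2) y w (xis etas : nat -> R -> 'rV[R]_2) xi eta eps :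
  {within Xi Omega `*` `[0, T], continuous ell} -> {within Xi Omega, continuous g} ->
  (forall i, closure Omega (ys i)) ->
  ys i @[i --> \oo] --> y -> ws i @[i --> \oo] --> w ->
  (forall k, listed nu y k -> forall e, 0 < e -> \forall i \near \oo,
    posp (dot (ws i) (n k)) ^+ 3 <= e * `|dot (y - ys i) (n k)|) ->
  (forall i, Gamma_opt Omega T ell g (ys i) (ws i) (xis i, etas i)) ->
  (forall i, L2_on T (derive1 (etas i))) ->
  Gamma_from Omega T y w (xi, eta) -> L2_on T (derive1 eta) -> 0 < eps ->
  \forall i \near \oo,
    running_cost T ell (xis i) (etas i) + g (xis i T, etas i T) + 2^-1 * energy T (etas i) <=
    running_cost T ell xi eta + g (xi T, eta T) + 2^-1 * energy T eta + eps.
Proof.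
move=> cell cg ysO ysy wsw Hk opt L2s G L2 eps0.
have eps3 : 0 < eps / 3 by rewrite divr_gt0.
have E0 : 0 <= energy T eta := energy_ge0 _ _.
have [[/= _ ac _ _] _ _] := G; have [G' _ _] := G.
(* The error eps is split in three: the factor th on the energy of eta, the energy of the
   perturbation, and the change of the running and final costs. *)
have [th [th0 thE]] : exists th, 0 < th /\ 2^-1 * (th * energy T eta) <= eps / 3.
  have E1 : 0 < energy T eta + 1 by rewrite ltr_wpDl.
  exists (eps / 3 / (energy T eta + 1)); split; first by rewrite divr_gt0.
  rewrite mulrAC -mulrA; apply: (@le_trans _ _ (2^-1 * (eps / 3))); last by lra.
  rewrite ler_pM2l// -[leRHS]mulr1 ler_pM2l// ler_pdivrMr// mul1r lerDl.
  exact: ler01.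
have th1 : 0 < 1 + th^-1 by rewrite addr_gt0// invr_gt0.
have [e [e0 eth Hclose]] : exists e, [/\ 0 < e, 2^-1 * ((1 + th^-1) * e) <= eps / 3 &
    forall xi' eta', Gamma Omega T (xi', eta') ->
    (forall t, t \in `[0, T] -> `|xi t - xi' t| <= e /\ `|eta t - eta' t| <= e) ->
    `|running_cost T ell xi eta + g (xi T, eta T) -
      (running_cost T ell xi' eta' + g (xi' T, eta' T))| <= eps / 3].
  have H := static_cost_close T0 cell cg G' eps3.
  near (0 : R)^'+ => e; exists e; split=> //; last by near: e; exact: H.
  rewrite mulrC -ler_pdivlMr ?invr_gt0// mulrC -ler_pdivlMr//.
  by near: e; apply: nbhs_right_le; rewrite !divr_gt0// invr_gt0.
have := recovery T0 cvxO polO outn G ysO ysy wsw Hk e0.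
apply: filterS => i [d [d' [d'' [C2 dsmall d2 Gi]]]].
have [Gii _ _] := Gi; have [/= _ aci _ _] := Gii.
have [L2i Ei] := energy_perturb T0 ac aci L2 C2 th0.
have [[Go _ _] _ /(_ _ Gi)/= mini] := opt i.
rewrite (cost_fin T0 g cell Gii L2i) (cost_fin T0 g cell Go (L2s i)) lee_fin in mini.
apply: le_trans mini _.
have close := Hclose _ _ Gii _.
have {}close : `|running_cost T ell xi eta + g (xi T, eta T) -
      (running_cost T ell (fun t => xi t + d t) (fun t => eta t + d' t) +
       g (xi T + d T, eta T + d' T))| <= eps / 3.
  by apply: close => t tT; rewrite !opprD !addNKr !normrN; exact: dsmall.
move: close; rewrite ler_norml => /andP[close _].
have Ed : (1 + th^-1) * \sum_(k < 2) \int[mu]_(t in `[0, T]) d'' t 0 k ^+ 2 <= (1 + th^-1) * e.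
  by rewrite ler_pM2l.
have {Ei Ed} := le_trans Ei (lerD (lexx _) Ed).
move: close eth thE; move: (running_cost _ _ _ _ + _) => A; move: (running_cost _ _ _ _ + _) => B.
move: (energy T eta) (energy T _) ((1 + th^-1) * e) => X Y Z; clear; lra.
Unshelve. all: by end_near. Qed.

End optimal_limit.

Theorem proposition5p1 (R : realType) (T : R) (Omega : set 'rV[R]_2) (N : nat)
    (nu n : 'I_N -> 'rV[R]_2)
    (ell : 'rV[R]_2 * 'rV[R]_2 * R -> R) (g : 'rV[R]_2 * 'rV[R]_2 -> R)
    (Theta : set ('rV[R]_2 * 'rV[R]_2)) :
  0 < T ->
  convex_domain Omega ->
  polygonal_boundary Omega nu ->
  outward_normals Omega nu n ->
  {within Xi Omega `*` `[0, T], continuous ell} ->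
  bounded_from_below (Xi Omega `*` `[0, T]) ell ->
  {within Xi Omega, continuous g} ->
  bounded_from_below (Xi Omega) g ->
  closed_in (Xi_ad Omega) Theta ->
  (forall (xs vs : nat -> 'rV[R]_2) (x v : 'rV[R]_2),
    (forall i, Theta (xs i, vs i)) -> Theta (x, v) ->
    (xs i, vs i) @[i --> \oo] --> (x, v) ->
    [/\ forall j, open_segment (nu j) (nu (ordS j)) x ->
          (fun i => posp (dot (vs i) (n j)) ^+ 3) =o_\oo
            (fun i => dot (x - xs i) (n j)),
        forall j, x = nu j -> v <> 0 ->
          forall k, k = ord_pred j \/ k = j ->
          (fun i => posp (dot (vs i) (n k)) ^+ 3) =o_\oo
            (fun i => dot (x - xs i) (n k))
      & forall j, x = nu j -> v = 0 ->
          forall k, k = ord_pred j \/ k = j ->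
          (fun i => posp (dot (vs i) (n k)) *
              (enorm (x - xs i) `^ (2 / 3) + enorm (vs i) ^+ 2)) =o_\oo
            (fun i => dot (x - xs i) (n k))]) ->
  forall (ys ws : nat -> 'rV[R]_2) (y w : 'rV[R]_2)
    (xis etas : nat -> R -> 'rV[R]_2) (xi eta : R -> 'rV[R]_2),
    (forall i, Theta (ys i, ws i)) ->
    (ys i, ws i) @[i --> \oo] --> (y, w) ->
    (forall i, Gamma_opt Omega T ell g (ys i) (ws i) (xis i, etas i)) ->
    {uniform `[0, T], xis @ \oo --> xi} ->
    {uniform `[0, T], etas @ \oo --> eta} ->
    Gamma_opt Omega T ell g y w (xi, eta).
Proof.
have le_energy (a b B E e : R) : a + 2^-1 * E <= B + e -> b - a <= e ->
    E <= 2 * (B + (e + e) - b) by lra.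
have ge_energy (b C E : R) : E <= 2 * (C - b) -> b + 2^-1 * E <= C by lra.
move=> T0 cvxO polO outn cell bell cg bg clTheta cond ys ws y w xis etas xi eta.
move=> HTheta yw opt uxi ueta.
have Gi i : Gamma_from Omega T (ys i) (ws i) (xis i, etas i) by have [] := opt i.
have GGi i : Gamma Omega T (xis i, etas i) by have [] := Gi i.
have Tin : T \in `[0, T] by rewrite in_itv/= lexx ltW.
have in0 : 0 \in `[0, T] by rewrite in_itv/= lexx ltW.
have ysO i : closure Omega (ys i) by have [F _ E] := clTheta; have := HTheta i; rewrite E => -[[]].
have ysy : ys i @[i --> \oo] --> y by have := cvg_comp _ _ yw (@cvg_fst _ _ _ _ _); exact.
have wsw : ws i @[i --> \oo] --> w by have := cvg_comp _ _ yw (@cvg_snd _ _ _ _ _); exact.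
have ptw (f_ : nat -> R -> 'rV[R]_2) f t : {uniform `[0, T], f_ @ \oo --> f} ->
    t \in `[0, T] -> f_ i t @[i --> \oo] --> f t.
  move=> /uniform_normP H tT; apply/cvgrPdist_lt => e e0.
  by apply: filterS (H e e0) => i; exact.
have xi0 : xi 0 = y.
  apply: (cvg_unique _ (ptw _ _ _ uxi in0)); first exact: norm_hausdorff.
  by rewrite /= (_ : (fun i => _) = ys)//; apply/funext => i; have [] := Gi i.
have eta0 : eta 0 = w.
  apply: (cvg_unique _ (ptw _ _ _ ueta in0)); first exact: norm_hausdorff.
  by rewrite /= (_ : (fun i => _) = ws)//; apply/funext => i; have [] := Gi i.
have clxi t : t \in `[0, T] -> closure Omega (xi t).
  move=> tT; apply: (closed_cvg _ (@closed_closure _ Omega) _ _ (ptw _ _ _ uxi tT)).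
  by near=> i; have [_ _ _ /(_ _ tT) []] := GGi i.
have cetas i : {within `[0, T], continuous (etas i)}.
  by apply: AC_on_continuous => //; have [] := GGi i.
have ceta : {within `[0, T], continuous eta}.
  apply: (@uniform_limit_continuous_subspace _ _ _ (etas @ \oo)) ueta.
  by exists 0%N => // i _; exact: cetas.
have D : forall t, t \in `[0, T] -> has_derivative_within `[0, T] xi t (eta t).
  have Di i s : s \in `[0, T] -> has_derivative_within `[0, T] (xis i) s (etas i s).
    by have [_ _ h _] := GGi i; exact: h.
  exact: (has_derivative_within_uniform_limit Di cetas ceta uxi ueta).
have yO : closure Omega y by rewrite -xi0; exact: clxi.
(* The limit curve stays in the closure and leaves y with velocity w, which makes (y, w)
   admissible. *)
have tan : tangent_cone Omega y w.
  apply: (tangent_cone_active cvxO polO outn yO) => k.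
  by apply: (active_velocity T0 cvxO polO outn clxi xi0); rewrite -eta0; exact: D.
have yTheta : Theta (y, w) by apply: (closed_in_limit clTheta HTheta yw).
have Hk k : listed nu y k -> forall e, 0 < e -> \forall i \near \oo,
    posp (dot (ws i) (n k)) ^+ 3 <= e * `|dot (y - ys i) (n k)|.
  by move=> lk e e0; exact: (listed_condition outn (cond _ _ _ _ HTheta yTheta yw) lk e0).
have L2s i : L2_on T (derive1 (etas i)).
  apply: (@Gamma_opt_L2_on _ _ _ T0 ell g (ys i) (ws i) (xis i, etas i) cell _ (opt i)).
  by have [F _ E] := clTheta; have := HTheta i; rewrite E => -[].
have acs i : AC_on T (etas i) by have [] := GGi i.
have Hle xi' eta' eps := @eventually_cost_le _ _ _ _ _ _ T0 cvxO polO outn ell g ys ws y w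
      xis etas xi' eta' eps cell cg ysO ysy wsw Hk opt L2s.
have lsc K : (\forall i \near \oo, energy T (etas i) <= K) ->
    [/\ AC_on T eta, L2_on T (derive1 eta) & energy T eta <= K].
  move=> EK; apply: (energy_lsc T0 acs L2s EK) => s k sT.
  by have := cvg_comp _ _ (ptw _ _ _ ueta sT) (@coord_continuous R 1 2 0 k _); exact.
(* Any finite-cost curve from (y, w) bounds the total costs along the sequence; as the static costs
   are at least m, it bounds the energies. *)
have [zeta [theta [Gz L2z]]] := finite_energy_curve T0 yO tan.
have [m Hm] := static_cost_ge T0 cell bell bg.
have [ac L2 _] : [/\ AC_on T eta, L2_on T (derive1 eta) & energy T eta <=
    2 * (running_cost T ell zeta theta + g (zeta T, theta T) + 2^-1 * energy T theta + (1 + 1) - m)].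
  apply: lsc; apply: filterS (Hle _ _ _ Gz L2z ltr01) => i /le_energy; apply.
  by apply: (@le_trans _ _ 0); rewrite ?ler01// subr_le0; exact: Hm (GGi i).
have GG : Gamma Omega T (xi, eta).
  by split=> //= [|t tT]; [exists eta|split=> //=; exact: clxi].
split=> /=; [by split|exact: AC_on_W12|].
move=> [xi' eta'] Gq /=; rewrite (cost_fin T0 g cell GG L2).
have [L2q|nL2q] := pselect (L2_on T (derive1 eta')); last first.
  by rewrite /cost; case: asboolP => // _; exact: leey.
have [GGq _ _] := Gq.
rewrite (cost_fin T0 g cell GGq L2q) lee_fin; apply/ler_addgt0Pr => e e0.
have e20 : 0 < e / 2 by rewrite divr_gt0.
(* Second use of semicontinuity, now with the sharp bound: the static costs along the sequence tend
   to those of (xi, eta), so what the competitor's cost leaves bounds the energies. *)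
suff [_ _] : [/\ AC_on T eta, L2_on T (derive1 eta) & energy T eta <=
    2 * (running_cost T ell xi' eta' + g (xi' T, eta' T) + 2^-1 * energy T eta' +
      (e / 2 + e / 2) - (running_cost T ell xi eta + g (xi T, eta T)))].
  by rewrite -splitr => /ge_energy.
apply: lsc; have [d [d0 Hd]] : exists d, 0 < d /\
    forall zeta theta, Gamma Omega T (zeta, theta) ->
    (forall t, t \in `[0, T] -> `|xi t - zeta t| <= d /\ `|eta t - theta t| <= d) ->
    `|running_cost T ell xi eta + g (xi T, eta T) -
      (running_cost T ell zeta theta + g (zeta T, theta T))| <= e / 2.
  have H := static_cost_close T0 cell cg GG e20.
  by near (0 : R)^'+ => d; exists d; split=> //; near: d; exact: H.
have /uniform_normP/(_ _ d0) h1 := uxi; have /uniform_normP/(_ _ d0) h2 := ueta.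
have h3 := Hle _ _ _ Gq L2q e20.
move: h1 h2 h3; apply: filterS3 => i h1 h2 h3.
have : `|running_cost T ell xi eta + g (xi T, eta T) -
    (running_cost T ell (xis i) (etas i) + g (xis i T, etas i T))| <= e / 2.
  by apply: Hd => // t tT; split; apply: ltW; [exact: h1|exact: h2].
by move=> /(le_trans (ler_norm _)); exact: le_energy.
Unshelve. all: by end_near. Qed.
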